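(* Let $k>0$ and let $\varepsilon\in[0,\varepsilon_0)$, with $\varepsilon_0>0$ sufficiently small. Then there exists a unique, $k$-dependent propagation speed $c(\varepsilon)$ such that the equation $$\frac{\partial u}{\partial t}+ku\frac{\partial u}{\partial x}H(u-\varepsilon)=\frac{\partial^2 u}{\partial x^2}+u(1-u)H(u-\varepsilon)$$ admits a unique (up to translation) critical front solution connecting the rest states $u=1$ and $u=0$. Moreover, $c(\varepsilon)=c(0)-\Delta c(\varepsilon)$, where $c(0)=\lim_{\varepsilon\to0^+}c(\varepsilon)=c_{\rm crit}$, with $c_{\rm crit}=2$ if $k\le 2$ and $c_{\rm crit}=\frac k2+\frac2k$ if $k>2$, and where, to leading order in $\varepsilon$ (that is, up to a factor $1+o(1)$ as $\varepsilon\to0^+$), $$\Delta c(\varepsilon)=\begin{cases}\dfrac{\pi^2}{(\ln\varepsilon)^2} & \text{if } k<2,\\[2mm] \dfrac{\pi^2}{4(\ln\varepsilon)^2} & \text{if } k=2,\\[2mm] \dfrac{2}{k^{1+8/k^2}}\,\dfrac{(k^2-4)^{4/k^2}}{\Gamma(1+4/k^2)\,\Gamma(1-4/k^2)}\,\varepsilon^{1-4/k^2} & \text{if } k>2.\end{cases}$$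
   Context: Here $u=u(x,t)$ with $x\in\mathbb R$, $t\ge0$; $H$ is the Heaviside function ($H(s)=0$ for $s<0$, $H(s)=1$ for $s>0$); $\Gamma(\cdot)$ is the Gamma function. A front solution with speed $c$ is a travelling wave $u(x,t)=U(\xi)$, $\xi=x-ct$, with $U(-\infty)=1$, $U(\infty)=0$; equivalently, a heteroclinic orbit from $Q^-=(1,0)$ to $Q^+=(0,0)$ of the first-order system $U'=V$, $V'=-cV+kUVH(U-\varepsilon)-U(1-U)H(U-\varepsilon)$ (orbits are continuous in $(U,V)$ across $\{U=\varepsilon\}$, and satisfy the equations for $U\ne\varepsilon$). For $\varepsilon>0$, the front is called critical if it corresponds to an intersection in $\{U=\varepsilon\}$ of the unstable manifold $W^{\rm u}(Q^-)$, followed through $\{\varepsilon<U<1,\ V<0\}$, with the stable manifold $W^{\rm s}(Q^+)$, which in $\{0\le U<\varepsilon\}$ is the line $V=-cU$. For $\varepsilon=0$ (no cut-off), fronts exist for all $c\ge c_{\rm crit}$, and the critical front is the one that propagates with the minimal speed $c_{\rm crit}$. *)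

(* Defs.v *)
(* Stdlib reals with Coquelicot. *)
From Stdlib Require Export Reals.
From Coquelicot Require Export Coquelicot.
Open Scope R_scope.

(* The value at 0 plays no role: the equations are imposed only off {u = eps}. *)
Definition Heaviside (s : R) : R := if Rlt_dec 0 s then 1 else 0.

(* Euler's integral; it converges for 0 < x, the only range used below. *)
Definition Gamma (x : R) : R :=
  RInt_gen (fun t => Rpower t (x - 1) * exp (- t))
    (at_right 0) (Rbar_locally p_infty).

(* The reaction and advection terms jump across {u = eps}.  There only
   continuity of u_x is required, which matches continuity of (U, V) along
   orbits of the travelling-wave system.  For eps = 0 this still forbids an orbit
   from stopping at u = 0 with nonzero slope. *)
Definition solves_pde (k eps : R) (u : R -> R -> R) : Prop :=
  (forall x t, 0 <= t ->
     ex_derive (fun y => u y t) x /\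
     continuous (Derive (fun y => u y t)) x) /\
  (forall x t, 0 < t -> u x t <> eps ->
     ex_derive (fun s => u x s) t /\
     ex_derive (Derive (fun y => u y t)) x /\
     Derive (fun s => u x s) t
       + k * u x t * Derive (fun y => u y t) x * Heaviside (u x t - eps)
     = Derive (Derive (fun y => u y t)) x
       + u x t * (1 - u x t) * Heaviside (u x t - eps)).

Definition travelling_wave (c : R) (U : R -> R) (u : R -> R -> R) : Prop :=
  forall x t, 0 <= t -> u x t = U (x - c * t).

Definition front_solution (k eps c : R) (u : R -> R -> R) : Prop :=
  solves_pde k eps u /\
  exists U : R -> R,
    travelling_wave c U u /\ is_lim U m_infty 1 /\ is_lim U p_infty 0.

(* Connection from Q^- = (1,0) to Q^+ = (0,0). *)
Definition heteroclinic_orbit (k eps c : R) (U V : R -> R) : Prop :=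
  (forall xi, continuous U xi /\ continuous V xi) /\
  (forall xi, U xi <> eps ->
     is_derive U xi (V xi) /\
     is_derive V xi
       (- c * V xi + k * U xi * V xi * Heaviside (U xi - eps)
        - U xi * (1 - U xi) * Heaviside (U xi - eps))) /\
  is_lim U m_infty 1 /\ is_lim V m_infty 0 /\
  is_lim U p_infty 0 /\ is_lim V p_infty 0.

(* For an orbit with limits Q^- and Q^+: the part xi <= xi0 lies in W^u(Q^-) and
   runs through {eps < U < 1, V < 0}; the part xi >= xi0 lies in W^s(Q^+), i.e. on
   the line V = - c U; they meet at (eps, - c eps). *)
Definition meets_at_cutoff (eps c : R) (U V : R -> R) : Prop :=
  exists xi0 : R,
    U xi0 = eps /\ V xi0 = - c * eps /\
    (forall xi, xi < xi0 -> eps < U xi < 1 /\ V xi < 0) /\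
    (forall xi, xi0 < xi -> 0 <= U xi < eps /\ V xi = - c * U xi).

Definition critical_front (k eps c : R) (u : R -> R -> R) : Prop :=
  front_solution k eps c u /\
  (0 < eps ->
     exists U V : R -> R,
       travelling_wave c U u /\
       heteroclinic_orbit k eps c U V /\ meets_at_cutoff eps c U V) /\
  (eps = 0 -> forall c' u', front_solution k 0 c' u' -> c <= c').

Definition c_crit (k : R) : R :=
  if Rle_dec k 2 then 2 else k / 2 + 2 / k.

Definition Delta_c_leading (k eps : R) : R :=
  if Rlt_dec k 2 then PI ^ 2 / (ln eps) ^ 2
  else if Req_dec_T k 2 then PI ^ 2 / (4 * (ln eps) ^ 2)
  else 2 / Rpower k (1 + 8 / k ^ 2)
       * (Rpower (k ^ 2 - 4) (4 / k ^ 2)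
          / (Gamma (1 + 4 / k ^ 2) * Gamma (1 - 4 / k ^ 2)))
       * Rpower eps (1 - 4 / k ^ 2).

(* Main.v *)
(* With x = 1 - U and p(x) = - V, the unstable manifold of (1, 0) is the graph of a
   solution p > 0 of p' = k (1 - x) - c + x (1 - x) / p on (0, 1) with p(0) = 0; it exists
   for every real c, because p' tends to infinity as p tends to 0.  The right-hand side
   decreases in p, so profiles are unique, decrease in c and are Lipschitz in c, and
   p_c(1 - eps) = c eps determines the critical speed.  For eps = 0 an energy and
   maximum-principle analysis puts every front on the profile, and a speed below c_crit
   is excluded because then p_c(1 - eps) > c eps for some eps, which makes the orbit
   cross U = 0.

   For k <= 2 put s = - ln U and z = - V / U: apart from terms of size exp(- s), z solves
   z z' = z^2 - c z + 1, whose passage through the bottleneck near z = 1 takes the time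
   pi / sqrt(1 - c^2 / 4), or half of it for k = 2, where z enters close to 1 instead of
   from below.  Equating this time with - ln eps gives Delta c.

   For k > 2 the profile at c_crit is (k / 2) x (1 - x).  The deviation D of the profile
   at speed c_crit - De satisfies D' = De - (2 / k) D / p exactly; where D is small it is
   De (U / x)^a B(x) with a = 4 / k^2 and B(x) the integral of (t / (1 - t))^a over (0, x),
   and D (D + (k / 2 - 2 / k) U)^(- a) is nearly constant where U is small.  Matching both
   yields the coefficient, with B(1) = Gamma(1 + a) Gamma(1 - a). *)

Require Import Defs.
From Stdlib Require Import Reals Lra Psatz ClassicalEpsilon.
From Coquelicot Require Import Coquelicot.
Open Scope R_scope.

(** * Real analysis and barrier arguments *)

(** The profile equation reads 0/0 at x = 0, so neither existence nor comparison can start from an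
    initial value there. Existence goes through a regularisation that shifts x (1 - x) by d > 0 and
    a monotone limit d -> 0; the condition p(0) = 0 is carried as a linear bound p <= m x, which is
    what the comparison arguments consume. Both asymptotic regimes are matched at a free
    intermediate point. For k <= 2 put w^2 = 1 - c^2 / 4. The matching time T satisfies exp (- T) =
    w^3 / 2: late enough for the exp (- s) terms to change the phase speed only by O(w), early
    enough for w T -> 0. With w = r^2 the logarithms of w are bounded by powers of r, and the limits
    reduce to continuity at r = 0 of explicit functions. For k > 2 the matching point is x = 1 - rho
    with rho = eps^((1 - a) / 4), chosen after the crude bound De = O(eps^(1 - a)), so that De /
    rho^2 and rho both vanish. The number B(1) is obtained as a Beta integral, by differentiating a
    truncated double Gamma integral in a scaling parameter. *)

Ltac smooth :=
  match goal with |- continuous ?f _ => apply (ex_derive_continuous f); auto_derive; trivial end.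

Lemma is_derive_continuity_pt (f : R -> R) (x l : R) :
  is_derive f x l -> continuity_pt f x.
Proof.
  intros H. apply continuity_pt_filterlim.
  apply (ex_derive_continuous f). exists l. exact H.
Qed.

Lemma continuous_eps (f : R -> R) (x : R) :
  continuous f x -> forall eta, 0 < eta ->
  exists d, 0 < d /\ forall y, Rabs (y - x) < d -> Rabs (f y - f x) < eta.
Proof.
  intros H eta He.
  destruct (proj1 (filterlim_locally f (f x)) H (mkposreal eta He)) as [d Hd].
  exists d. split. apply cond_pos. intros y Hy. apply (Hd y Hy).
Qed.

Lemma continuous_of_eps (f : R -> R) (x : R) :
  (forall eta, 0 < eta ->
     exists d, 0 < d /\ forall y, Rabs (y - x) < d -> Rabs (f y - f x) < eta) ->
  continuous f x.
Proof.
  intros H. apply filterlim_locally. intros eta.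
  destruct (H eta (cond_pos eta)) as [d [Hd H']].
  exists (mkposreal d Hd). intros y Hy. apply H'. exact Hy.
Qed.

Lemma is_lim_m_infty_iff (f : R -> R) (l : R) :
  is_lim f m_infty l <->
  forall eta, 0 < eta -> exists M, forall x, x < M -> Rabs (f x - l) < eta.
Proof.
  split.
  - intros H eta He. apply is_lim_spec in H. exact (H (mkposreal eta He)).
  - intros H. apply is_lim_spec. intros eta. exact (H eta (cond_pos eta)).
Qed.

Lemma is_lim_p_infty_iff (f : R -> R) (l : R) :
  is_lim f p_infty l <->
  forall eta, 0 < eta -> exists M, forall x, M < x -> Rabs (f x - l) < eta.
Proof.
  split.
  - intros H eta He. apply is_lim_spec in H. exact (H (mkposreal eta He)).
  - intros H. apply is_lim_spec. intros eta. exact (H eta (cond_pos eta)).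
Qed.

Lemma mvt (f df : R -> R) (a b : R) :
  a < b ->
  (forall x, a < x < b -> is_derive f x (df x)) ->
  (forall x, a <= x <= b -> continuous f x) ->
  exists x, a <= x <= b /\ f b - f a = df x * (b - a).
Proof.
  intros Hab Hd Hc.
  destruct (MVT_gen f a b df) as [x Hx].
  - rewrite Rmin_left, Rmax_right by lra. exact Hd.
  - rewrite Rmin_left, Rmax_right by lra.
    intros x Hx. apply continuity_pt_filterlim. now apply Hc.
  - rewrite Rmin_left, Rmax_right in Hx by lra. now exists x.
Qed.

(* [MVT_gen] only localises its witness in the closed interval. *)
Lemma mvt_open (f df : R -> R) (a b : R) :
  a < b ->
  (forall x, a < x < b -> is_derive f x (df x)) ->
  (forall x, a <= x <= b -> continuous f x) ->
  exists x, a < x < b /\ f b - f a = df x * (b - a).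
Proof.
  intros Hab Hd Hc.
  (* Off the open interval [df'] takes a value different from the mean slope, so the witness of
     [mvt] cannot be an endpoint. *)
  set (df' := fun x => if Rle_dec x a then (f b - f a) / (b - a) + 1
                       else if Rle_dec b x then (f b - f a) / (b - a) + 1 else df x).
  destruct (mvt f df' a b Hab) as [x [Hx E]]; [| exact Hc |].
  - intros x Hx. unfold df'.
    destruct (Rle_dec x a); [lra|]. destruct (Rle_dec b x); [lra|]. auto.
  - unfold df' in E.
    destruct (Rle_dec x a); [|destruct (Rle_dec b x)].
    + exfalso. assert ((f b - f a) / (b - a) * (b - a) = f b - f a) by (field; lra). lra.
    + exfalso. assert ((f b - f a) / (b - a) * (b - a) = f b - f a) by (field; lra). lra.
    + exists x. split; [lra | exact E].
Qed.

Lemma nonincreasing_of_derive (f df : R -> R) (a b : R) :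
  a <= b ->
  (forall x, a < x < b -> is_derive f x (df x)) ->
  (forall x, a <= x <= b -> continuous f x) ->
  (forall x, a < x < b -> df x <= 0) ->
  f b <= f a.
Proof.
  intros Hab Hd Hc Hn.
  destruct (Req_dec a b) as [-> | Hne]; [lra|].
  destruct (mvt_open f df a b) as [x [Hx E]]; auto; [lra|].
  specialize (Hn x Hx). nra.
Qed.

Lemma nondecreasing_of_derive (f df : R -> R) (a b : R) :
  a <= b ->
  (forall x, a < x < b -> is_derive f x (df x)) ->
  (forall x, a <= x <= b -> continuous f x) ->
  (forall x, a < x < b -> 0 <= df x) ->
  f a <= f b.
Proof.
  intros Hab Hd Hc Hn.
  destruct (Req_dec a b) as [-> | Hne]; [lra|].
  destruct (mvt_open f df a b) as [x [Hx E]]; auto; [lra|].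
  specialize (Hn x Hx). nra.
Qed.

Lemma continuous_of_derive (f : R -> R) (x l : R) :
  is_derive f x l -> continuous f x.
Proof. intros H. apply (ex_derive_continuous f). now exists l. Qed.

Lemma last_crossing (f : R -> R) (a b y : R) :
  a < b -> (forall x, a <= x <= b -> continuous f x) ->
  f a <= y -> y < f b ->
  exists x0, a <= x0 < b /\ f x0 = y /\ forall x, x0 < x <= b -> y < f x.
Proof.
  intros Hab Hc Ha Hb.
  set (E := fun x => a <= x <= b /\ f x <= y).
  destruct (completeness E) as [m [Hm1 Hm2]].
  { exists b. intros x [Hx _]. lra. }
  { exists a. unfold E. split; [lra | exact Ha]. }
  assert (Ham : a <= m) by (apply Hm1; unfold E; split; [lra|exact Ha]).
  assert (Hmb : m <= b) by (apply Hm2; intros x [Hx _]; lra).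
  assert (Habove : forall x, m < x <= b -> y < f x).
  { intros x Hx. destruct (Rlt_le_dec y (f x)); [assumption|].
    assert (x <= m) by (apply Hm1; unfold E; split; lra). lra. }
  assert (Hle : f m <= y).
  { destruct (Rle_lt_dec (f m) y) as [|Hgt]; [assumption|exfalso].
    destruct (continuous_eps f m (Hc m (conj Ham Hmb)) (f m - y)) as [d [Hd Hd']]; [lra|].
    assert (m <= m - d / 2); [|lra].
    apply Hm2. intros x [Hx1 Hx2].
    assert (x <= m) by (apply Hm1; split; assumption).
    destruct (Rle_lt_dec x (m - d / 2)); [assumption|].
    assert (Rabs (x - m) < d) by (apply Rabs_def1; lra).
    specialize (Hd' x H0). apply Rabs_def2 in Hd'. lra. }
  assert (Hlt : m < b) by (destruct Hmb as [|Heq]; [assumption|subst; lra]).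
  exists m. split; [lra|]. split; [|exact Habove].
  destruct (Rle_lt_dec y (f m)) as [|Hgt]; [lra|exfalso].
  destruct (continuous_eps f m (Hc m (conj Ham Hmb)) (y - f m)) as [d [Hd Hd']]; [lra|].
  set (x := Rmin b (m + d / 2)).
  assert (Hx : m < x <= b) by (unfold x; split; [apply Rmin_glb_lt; lra | apply Rmin_l]).
  assert (x <= m + d / 2) by apply Rmin_r.
  assert (Rabs (x - m) < d) by (apply Rabs_def1; lra).
  specialize (Hd' x H0). apply Rabs_def2 in Hd'.
  specialize (Habove x Hx). lra.
Qed.

Lemma first_crossing (f : R -> R) (a b y : R) :
  a < b -> (forall x, a <= x <= b -> continuous f x) ->
  f a < y -> y <= f b ->
  exists x0, a < x0 <= b /\ f x0 = y /\ forall x, a <= x < x0 -> f x < y.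
Proof.
  intros Hab Hc Ha Hb.
  destruct (last_crossing (fun x => - f (- x)) (- b) (- a) (- y)) as [x0 [H1 [H2 H3]]].
  - lra.
  - intros x Hx. apply (continuous_opp (fun x => f (- x))).
    apply (continuous_comp (fun x => - x) f).
    + apply (continuous_opp (fun x : R => x)). apply continuous_id.
    + apply Hc. lra.
  - rewrite Ropp_involutive. lra.
  - rewrite Ropp_involutive. lra.
  - exists (- x0). split; [lra|]. split; [lra|].
    intros x Hx. specialize (H3 (- x)). rewrite Ropp_involutive in H3. lra.
Qed.

(** After its last zero [f] would be positive and yet nonincreasing. The sign of [df] is asked only
    where [f] is positive, so a differential inequality has to be checked only on the wrong side of
    a barrier. *)
Lemma barrier_weak (f df : R -> R) (a b : R) :
  a <= b ->
  (forall x, a < x < b -> is_derive f x (df x)) ->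
  (forall x, a <= x <= b -> continuous f x) ->
  (forall x, a < x < b -> 0 < f x -> df x <= 0) ->
  f a <= 0 -> f b <= 0.
Proof.
  intros Hab Hd Hc Hn Ha.
  destruct (Rle_lt_dec (f b) 0) as [|Hb]; [assumption|exfalso].
  assert (a < b) by (destruct Hab as [|Heq]; [assumption|subst; lra]).
  destruct (last_crossing f a b 0) as [x0 [H1 [H2 H3]]]; auto.
  assert (f b <= f x0).
  { apply (nonincreasing_of_derive f df); try lra.
    - intros; apply Hd; lra.
    - intros; apply Hc; lra.
    - intros; apply Hn; [lra|]. apply H3; lra. }
  lra.
Qed.

(** At a first zero the derivative cannot be negative. The sign of [df] is asked only at zeros of
    [f], so the contact equation may be substituted into it. *)
Lemma barrier_strict (f df : R -> R) (a b : R) :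
  a <= b ->
  (forall x, a <= x <= b -> is_derive f x (df x)) ->
  (forall x, a < x <= b -> f x = 0 -> df x < 0) ->
  f a < 0 -> f b < 0.
Proof.
  intros Hab Hd Hn Ha.
  destruct (Rlt_le_dec (f b) 0) as [|Hb]; [assumption|exfalso].
  assert (a < b) by (destruct Hab as [|Heq]; [assumption|subst; lra]).
  destruct (first_crossing f a b 0) as [x0 [H1 [H2 H3]]]; auto.
  { intros x Hx. eapply continuous_of_derive. apply Hd; lra. }
  specialize (Hn x0 H1 H2).
  assert (Hx0 := Hd x0 (conj (Rlt_le _ _ (proj1 H1)) (proj2 H1))).
  apply is_derive_Reals in Hx0.
  destruct (Hx0 (- df x0)) as [d Hd']; [lra|].
  (* A negative increment: the difference quotient then looks at points before the first zero, where
     [f] is negative. *)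
  set (h := - Rmin (d / 2) ((x0 - a) / 2)).
  assert (Hdp := cond_pos d).
  assert (Hh : 0 < - h) by (unfold h; rewrite Ropp_involutive; apply Rmin_glb_lt; lra).
  assert (- h <= d / 2) by (unfold h; rewrite Ropp_involutive; apply Rmin_l).
  assert (- h <= (x0 - a) / 2) by (unfold h; rewrite Ropp_involutive; apply Rmin_r).
  specialize (Hd' h).
  assert (Hq : Rabs ((f (x0 + h) - f x0) / h - df x0) < - df x0).
  { apply Hd'; [lra|]. rewrite Rabs_left by lra. lra. }
  apply Rabs_def2 in Hq.
  assert (f (x0 + h) < 0) by (apply H3; lra).
  assert (0 < (f (x0 + h) - f x0) / h).
  { rewrite H2, Rminus_0_r. replace (f (x0 + h) / h) with (- f (x0 + h) * / - h) by (field; lra).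
    apply Rmult_lt_0_compat; [lra|]. apply Rinv_0_lt_compat; lra. }
  lra.
Qed.

(** A barrier argument starting at a singular endpoint. The initial value is replaced by points
    arbitrarily close to 0 where [f] is at most any prescribed positive number; subtracting half of
    a supposed positive value reduces it to [barrier_weak]. *)
Lemma barrier_from_zero (f df : R -> R) (b : R) :
  (forall x, 0 < x < b -> is_derive f x (df x)) ->
  (forall x, 0 < x < b -> 0 < f x -> df x <= 0) ->
  (forall eta r, 0 < eta -> 0 < r -> exists x, 0 < x < r /\ f x <= eta) ->
  forall x, 0 < x < b -> f x <= 0.
Proof.
  intros Hd Hn H0 x Hx.
  destruct (Rle_lt_dec (f x) 0) as [|Hpos]; [assumption|exfalso].
  destruct (H0 (f x / 2) x) as [x0 [Hx0 Hf0]]; try lra.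
  assert (f x - f x / 2 <= 0); [|lra].
  apply (barrier_weak (fun y => f y - f x / 2) df x0 x); try lra.
  - intros y Hy. replace (df y) with (df y - 0) by ring.
    apply (is_derive_minus f (fun _ => f x / 2)); [apply Hd; lra | apply @is_derive_const].
  - intros y Hy. apply (continuous_minus f (fun _ => f x / 2));
      [eapply continuous_of_derive; apply Hd; lra | apply continuous_const].
  - intros y Hy Hp. apply Hn; lra.
Qed.

(** * Picard iteration *)

(** Used as upper limit of integration in the Picard map, it makes every iterate continuous on the
    whole line, so continuity and integrability never depend on the position of x. *)
Definition clamp (x : R) : R := Rmax 0 (Rmin 1 x).

Lemma clamp_bounds (x : R) : 0 <= clamp x <= 1.
Proof.
  unfold clamp. split; [apply Rmax_l|]. apply Rmax_lub; [lra | apply Rmin_l].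
Qed.

Lemma clamp_id (x : R) : 0 <= x <= 1 -> clamp x = x.
Proof. intros H. unfold clamp. rewrite Rmin_right, Rmax_right; lra. Qed.

Lemma clamp_lipschitz (x y : R) : Rabs (clamp x - clamp y) <= Rabs (x - y).
Proof.
  unfold clamp, Rmin. destruct (Rle_dec 1 x), (Rle_dec 1 y); unfold Rmax;
  repeat match goal with |- context [Rle_dec ?a ?b] => destruct (Rle_dec a b) end;
  unfold Rabs; repeat match goal with |- context [Rcase_abs ?a] => destruct (Rcase_abs a) end; lra.
Qed.

Lemma continuous_of_lipschitz (f : R -> R) (K x : R) :
  0 < K -> (forall y, Rabs (f y - f x) <= K * Rabs (y - x)) -> continuous f x.
Proof.
  intros HK H. apply continuous_of_eps. intros eta He.
  exists (eta / K). split; [apply Rdiv_lt_0_compat; lra|].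
  intros y Hy. eapply Rle_lt_trans; [apply H|].
  apply Rlt_le_trans with (K * (eta / K)); [apply Rmult_lt_compat_l; lra|].
  right; field; lra.
Qed.

Lemma continuous_clamp (x : R) : continuous clamp x.
Proof.
  apply (continuous_of_lipschitz _ 1); [lra|].
  intros y. rewrite Rmult_1_l. apply clamp_lipschitz.
Qed.

Lemma ex_RInt_cont (g : R -> R) (a b : R) :
  (forall x, continuous g x) -> ex_RInt g a b.
Proof. intros H. apply (ex_RInt_continuous g). intros; apply H. Qed.

Lemma is_derive_primitive (g : R -> R) (a x : R) :
  (forall x, continuous g x) -> is_derive (RInt g a) x (g x).
Proof.
  intros H. apply (is_derive_RInt g (RInt g a) a x); [|apply H].
  exists (mkposreal 1 Rlt_0_1). intros y _. apply (RInt_correct g). now apply ex_RInt_cont.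
Qed.

Section Picard.
Variables (f : R -> R -> R) (L y0 : R).
Hypothesis HL : 0 < L.
(** Continuity of [f] enters only along continuous functions; in this form it is checked directly
    for right-hand sides built with [Rmax] and quotients. *)
Hypothesis f_cont : forall y : R -> R, (forall x, continuous y x) ->
  forall x, continuous (fun t => f t (y t)) x.
Hypothesis f_lip : forall t u v, 0 <= t <= 1 -> Rabs (f t u - f t v) <= L * Rabs (u - v).

Definition picard_step (y : R -> R) (x : R) : R :=
  y0 + RInt (fun t => f t (y t)) 0 (clamp x).

Fixpoint picard_iter (n : nat) : R -> R :=
  match n with O => fun _ => y0 | S n => picard_step (picard_iter n) end.

Lemma picard_step_continuous y :
  (forall x, continuous y x) -> forall x, continuous (picard_step y) x.
Proof.
  intros Hy x. unfold picard_step.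
  apply (continuous_plus (fun _ => y0) (fun x => RInt (fun t => f t (y t)) 0 (clamp x))).
  - apply continuous_const.
  - apply (continuous_comp clamp (RInt (fun t => f t (y t)) 0)).
    + apply continuous_clamp.
    + eapply continuous_of_derive. apply is_derive_primitive. now apply f_cont.
Qed.

Lemma picard_iter_continuous n x : continuous (picard_iter n) x.
Proof.
  revert x. induction n as [|n IH]; intros x; simpl.
  - apply continuous_const.
  - now apply picard_step_continuous.
Qed.

Lemma picard_step_diff (y z : R -> R) (g : R -> R) (x : R) :
  (forall x, continuous y x) -> (forall x, continuous z x) -> (forall x, continuous g x) ->
  (forall t, 0 <= t <= 1 -> Rabs (y t - z t) <= g t) ->
  Rabs (picard_step y x - picard_step z x) <= L * RInt g 0 (clamp x).
Proof.
  intros Hy Hz Hg H. unfold picard_step.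
  destruct (clamp_bounds x) as [H0 H1].
  assert (Ey := ex_RInt_cont _ 0 (clamp x) (f_cont y Hy)).
  assert (Ez := ex_RInt_cont _ 0 (clamp x) (f_cont z Hz)).
  assert (Eg := ex_RInt_cont _ 0 (clamp x) Hg).
  replace (y0 + RInt (fun t => f t (y t)) 0 (clamp x)
           - (y0 + RInt (fun t => f t (z t)) 0 (clamp x)))
    with (RInt (fun t => f t (y t)) 0 (clamp x) - RInt (fun t => f t (z t)) 0 (clamp x)) by ring.
  change (Rabs (minus (RInt (fun t => f t (y t)) 0 (clamp x)) (RInt (fun t => f t (z t)) 0 (clamp x)))
          <= scal L (RInt g 0 (clamp x))).
  rewrite <- (RInt_minus (fun t => f t (y t)) (fun t => f t (z t)) 0 (clamp x) Ey Ez).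
  rewrite <- (RInt_scal g 0 (clamp x) L Eg).
  eapply Rle_trans; [apply abs_RInt_le; auto|].
  { apply (ex_RInt_minus (fun t => f t (y t)) (fun t => f t (z t))); auto. }
  apply RInt_le; auto.
  - apply ex_RInt_cont. intros t.
    apply (continuous_comp (fun t => minus (f t (y t)) (f t (z t))) Rabs).
    + apply (continuous_minus (fun t => f t (y t)) (fun t => f t (z t))); now apply f_cont.
    + apply continuous_Rabs.
  - apply (ex_RInt_scal g); auto.
  - intros t Ht. change (Rabs (f t (y t) - f t (z t)) <= L * g t).
    eapply Rle_trans; [apply f_lip; lra|].
    apply Rmult_le_compat_l; [lra|]. apply H; lra.
Qed.

(** In the sup-norm weighted by exp (2 L x) the Picard map contracts by the factor 1/2 whatever the
    size of L, so one fixed-point argument covers all of [0, 1]. *)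
Lemma RInt_exp_le (A x : R) : 0 <= A -> 0 <= x ->
  L * RInt (fun t => A * exp (2 * L * t)) 0 x <= A / 2 * exp (2 * L * x).
Proof.
  intros HA Hx.
  assert (H : is_RInt (fun t => A * exp (2 * L * t)) 0 x
     (minus (A / (2 * L) * exp (2 * L * x)) (A / (2 * L) * exp (2 * L * 0)))).
  { apply (is_RInt_derive (fun t => A / (2 * L) * exp (2 * L * t))).
    - intros t _. auto_derive; [trivial|]. field. lra.
    - intros t _. smooth. }
  rewrite (is_RInt_unique _ _ _ _ H).
  change (L * (A / (2 * L) * exp (2 * L * x) - A / (2 * L) * exp (2 * L * 0)) <= A / 2 * exp (2 * L * x)).
  rewrite Rmult_0_r, exp_0.
  replace (L * (A / (2 * L) * exp (2 * L * x) - A / (2 * L) * 1))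
    with (A / 2 * exp (2 * L * x) - A / 2) by (field; lra). lra.
Qed.

Lemma picard_iter_step_bound :
  exists M, 0 <= M /\ forall n x,
    Rabs (picard_iter (S n) x - picard_iter n x) <= M / 2 ^ n * exp (2 * L * clamp x).
Proof.
  assert (Hc : forall x, continuous (fun t => Rabs (f t y0)) x).
  { intros x. apply (continuous_comp (fun t => f t y0) Rabs).
    - apply (f_cont (fun _ => y0)). intros; apply continuous_const.
    - apply continuous_Rabs. }
  destruct (continuity_ab_maj (fun t => Rabs (f t y0)) 0 1) as [m [Hm _]]; [lra| |].
  { intros x _. apply continuity_pt_filterlim. apply Hc. }
  set (M := Rabs (f m y0)). exists M. split; [apply Rabs_pos|].
  assert (Hexp : forall x, 1 <= exp (2 * L * clamp x)).
  { intros x. rewrite <- exp_0. destruct (clamp_bounds x).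
    destruct (Req_dec (clamp x) 0) as [E | E].
    - rewrite E, Rmult_0_r. lra.
    - left. apply exp_increasing. nra. }
  induction n as [|n IH]; intros x.
  - simpl. unfold picard_step.
    assert (Hring : forall u v : R, u + v - u = v) by (intros; ring).
    rewrite Hring.
    destruct (clamp_bounds x) as [H0 H1].
    assert (Ef : ex_RInt (fun t => f t y0) 0 (clamp x)).
    { apply ex_RInt_cont. apply (f_cont (fun _ => y0)). intros; apply continuous_const. }
    assert (HM : 0 <= M) by apply Rabs_pos.
    assert (Rabs (RInt (fun t => f t y0) 0 (clamp x)) <= (clamp x - 0) * M).
    { apply (norm_RInt_le_const (fun t => f t y0) 0 (clamp x)); auto.
      - intros t Ht. apply Hm. lra.
      - apply (RInt_correct (fun t => f t y0)). exact Ef. }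
    specialize (Hexp x). nra.
  - change (picard_iter (S (S n)) x) with (picard_step (picard_iter (S n)) x).
    change (picard_iter (S n) x) with (picard_step (picard_iter n) x).
    assert (HMn : 0 <= M / 2 ^ n) by (apply Rdiv_le_0_compat; [apply Rabs_pos | apply pow_lt; lra]).
    destruct (clamp_bounds x) as [H0 H1].
    eapply Rle_trans.
    + apply (picard_step_diff _ _ (fun t => M / 2 ^ n * exp (2 * L * t))).
      * apply picard_iter_continuous.
      * apply picard_iter_continuous.
      * intros t. smooth.
      * intros t Ht. specialize (IH t). rewrite clamp_id in IH by lra. exact IH.
    + eapply Rle_trans; [apply RInt_exp_le; auto|].
      simpl. right. field. apply pow_nonzero. lra.
Qed.

Lemma picard :
  exists y : R -> R, (forall x, continuous y x) /\ y 0 = y0 /\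
    forall x, 0 < x < 1 -> is_derive y x (f x (y x)).
Proof.
  destruct picard_iter_step_bound as [M [HM Hstep]].
  set (W := M * exp (2 * L)).
  assert (HW : 0 <= W) by (apply Rmult_le_pos; [lra | left; apply exp_pos]).
  assert (Hstep' : forall n x, Rabs (picard_iter (S n) x - picard_iter n x) <= W / 2 ^ n).
  { intros n x. eapply Rle_trans; [apply Hstep|].
    unfold W. unfold Rdiv. rewrite (Rmult_assoc M (exp _)), (Rmult_comm (exp _)), <- Rmult_assoc.
    apply Rmult_le_compat_l.
    - apply Rmult_le_pos; [lra|]. left. apply Rinv_0_lt_compat, pow_lt. lra.
    - destruct (clamp_bounds x). destruct (Req_dec (clamp x) 1) as [E|E].
      + rewrite E, Rmult_1_r. lra.
      + left. apply exp_increasing. nra. }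
  (* The subtracted tail makes the induction on [p] close exactly: each new term W / 2^(n+p) is the
     difference of two consecutive tails. *)
  assert (Hcauchy : forall p n x, Rabs (picard_iter (n + p)%nat x - picard_iter n x)
            <= 2 * (W / 2 ^ n) - 2 * (W / 2 ^ (n + p)%nat)).
  { induction p as [|p IH]; intros n x.
    - rewrite Nat.add_0_r. rewrite Rminus_diag, Rabs_R0. lra.
    - rewrite Nat.add_succ_r.
      replace (picard_iter (S (n + p)) x - picard_iter n x)
        with ((picard_iter (S (n + p)) x - picard_iter (n + p)%nat x)
              + (picard_iter (n + p)%nat x - picard_iter n x)) by ring.
      eapply Rle_trans; [apply Rabs_triang|].
      specialize (IH n x). assert (H1 := Hstep' (n + p)%nat x).
      assert (E : W / 2 ^ S (n + p) = W / 2 ^ (n + p) / 2).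
      { simpl. field. apply pow_nonzero; lra. }
      rewrite E. lra. }
  assert (Hpos : forall n, 0 <= W / 2 ^ n).
  { intros n. apply Rdiv_le_0_compat; [lra | apply pow_lt; lra]. }
  assert (Hsmall : forall eta, 0 < eta -> exists n, W / 2 ^ n < eta).
  { intros eta He.
    destruct (pow_lt_1_zero (/ 2)) with (y := eta / (W + 1)) as [N HN].
    - rewrite Rabs_right; lra.
    - apply Rdiv_lt_0_compat; lra.
    - exists N. specialize (HN N (le_n _)).
      rewrite Rabs_right in HN by (apply Rle_ge, pow_le; lra).
      unfold Rdiv. rewrite <- pow_inv.
      assert (0 <= (/ 2) ^ N) by (apply pow_le; lra).
      apply Rle_lt_trans with ((W + 1) * (/ 2) ^ N); [nra|].
      apply Rlt_le_trans with ((W + 1) * (eta / (W + 1))); [apply Rmult_lt_compat_l; lra|].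
      right. field. lra. }
  assert (Hex : forall x, ex_finite_lim_seq (fun n => picard_iter n x)).
  { intros x. apply ex_lim_seq_cauchy_corr. intros eta.
    destruct (Hsmall (eta / 4)) as [N HN]; [apply Rdiv_lt_0_compat; [apply cond_pos|lra]|].
    exists N. intros n m Hn Hm.
    assert (A1 := Hcauchy (n - N)%nat N x). assert (A2 := Hcauchy (m - N)%nat N x).
    replace (N + (n - N))%nat with n in A1 by lia.
    replace (N + (m - N))%nat with m in A2 by lia.
    assert (B1 := Hpos n). assert (B2 := Hpos m).
    replace (picard_iter n x - picard_iter m x)
      with ((picard_iter n x - picard_iter N x) - (picard_iter m x - picard_iter N x)) by ring.
    eapply Rle_lt_trans; [apply Rabs_triang|]. rewrite Rabs_Ropp.
    assert (0 < eta) by apply cond_pos. lra. }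
  set (y := fun x => real (Lim_seq (fun n => picard_iter n x))).
  assert (Hy : forall x, is_lim_seq (fun n => picard_iter n x) (y x)).
  { intros x. apply Lim_seq_correct'. apply Hex. }
  assert (Herr : forall n x, Rabs (y x - picard_iter n x) <= 2 * (W / 2 ^ n)).
  { intros n x.
    assert (H : is_lim_seq (fun p => Rabs (picard_iter (p + n)%nat x - picard_iter n x)) (Rabs (y x - picard_iter n x))).
    { apply (is_lim_seq_abs (fun p => picard_iter (p + n)%nat x - picard_iter n x) (Finite (y x - picard_iter n x))).
      apply is_lim_seq_minus'; [|apply is_lim_seq_const].
      apply (is_lim_seq_incr_n (fun p => picard_iter p x)). apply Hy. }
    assert (Hb : forall p, Rabs (picard_iter (p + n)%nat x - picard_iter n x) <= 2 * (W / 2 ^ n)).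
    { intros p. rewrite (Nat.add_comm p n).
      assert (A := Hcauchy p n x). assert (B := Hpos (n + p)%nat). lra. }
    assert (Hle := is_lim_seq_le _ (fun _ => 2 * (W / 2 ^ n)) _ (2 * (W / 2 ^ n))
       Hb H (is_lim_seq_const _)).
    exact Hle. }
  assert (Hyc : forall x, continuous y x).
  { intros x. apply continuous_of_eps. intros eta He.
    destruct (Hsmall (eta / 8)) as [N HN]; [lra|].
    destruct (continuous_eps _ _ (picard_iter_continuous N x) (eta / 4)) as [d [Hd Hd']]; [lra|].
    exists d. split; [assumption|]. intros z Hz. specialize (Hd' z Hz).
    assert (A1 := Herr N x). assert (A2 := Herr N z).
    replace (y z - y x) with ((y z - picard_iter N z) - (y x - picard_iter N x)
       + (picard_iter N z - picard_iter N x)) by ring.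
    eapply Rle_lt_trans; [apply Rabs_triang|].
    eapply Rle_lt_trans; [apply Rplus_le_compat_r, Rabs_triang|].
    rewrite Rabs_Ropp. lra. }
  (* The step map is Lipschitz for uniform distance on [0, 1], so the error of the n-th iterate
     bounds the defect of the limit. *)
  assert (Hfix : forall x, y x = picard_step y x).
  { intros x.
    assert (H : forall n, Rabs (y x - picard_step y x) <= (2 + 2 * L) * (W / 2 ^ n)).
    { intros n.
      replace (y x - picard_step y x) with ((y x - picard_iter (S n) x)
        + (picard_step (picard_iter n) x - picard_step y x)) by (simpl; ring).
      eapply Rle_trans; [apply Rabs_triang|].
      assert (A1 := Herr (S n) x).
      assert (A2 : Rabs (picard_step (picard_iter n) x - picard_step y x)
                   <= L * RInt (fun _ => 2 * (W / 2 ^ n)) 0 (clamp x)).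
      { apply picard_step_diff; auto.
        - apply picard_iter_continuous.
        - intros; apply continuous_const.
        - intros t _. rewrite Rabs_minus_sym. apply Herr. }
      rewrite RInt_const in A2.
      change (scal (clamp x - 0) (2 * (W / 2 ^ n))) with ((clamp x - 0) * (2 * (W / 2 ^ n))) in A2.
      destruct (clamp_bounds x). assert (P := Hpos n).
      assert (E : W / 2 ^ S n = W / 2 ^ n / 2) by (simpl; field; apply pow_nonzero; lra).
      rewrite E in A1.
      assert (L * ((clamp x - 0) * (2 * (W / 2 ^ n))) <= L * (2 * (W / 2 ^ n))).
      { apply Rmult_le_compat_l; [lra|]. nra. }
      lra. }
    destruct (Req_dec (y x) (picard_step y x)) as [|Hne]; [assumption|exfalso].
    assert (Hp : 0 < Rabs (y x - picard_step y x)) by (apply Rabs_pos_lt; lra).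
    destruct (Hsmall (Rabs (y x - picard_step y x) / (2 + 2 * L))) as [N HN].
    { apply Rdiv_lt_0_compat; lra. }
    specialize (H N).
    apply (Rmult_lt_compat_l (2 + 2 * L)) in HN; [|lra].
    replace ((2 + 2 * L) * (Rabs (y x - picard_step y x) / (2 + 2 * L)))
      with (Rabs (y x - picard_step y x)) in HN by (field; lra). lra. }
  exists y. split; [assumption|]. split.
  - rewrite Hfix. unfold picard_step. rewrite clamp_id by lra. rewrite RInt_point.
    change (y0 + 0 = y0). apply Rplus_0_r.
  - intros x Hx.
    assert (Hd : is_derive (fun x => y0 + RInt (fun t => f t (y t)) 0 x) x (0 + f x (y x))).
    { apply (is_derive_plus (fun _ => y0) (RInt (fun t => f t (y t)) 0) x 0 (f x (y x))).
      - exact (is_derive_const y0 x).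
      - exact (is_derive_primitive _ 0 x (f_cont y Hyc)). }
    rewrite Rplus_0_l in Hd.
    apply (is_derive_ext_loc (fun x => y0 + RInt (fun t => f t (y t)) 0 x)); [|exact Hd].
    assert (Hr : 0 < Rmin x (1 - x)) by (apply Rmin_glb_lt; lra).
    exists (mkposreal _ Hr). intros z Hz.
    change (Rabs (z - x) < Rmin x (1 - x)) in Hz. apply Rabs_def2 in Hz.
    assert (Rmin x (1 - x) <= x) by apply Rmin_l.
    assert (Rmin x (1 - x) <= 1 - x) by apply Rmin_r.
    rewrite Hfix. unfold picard_step. rewrite clamp_id by lra. reflexivity.
Qed.
End Picard.

(** * The unstable manifold as a profile *)

Lemma is_derive_of_quadratic (f : R -> R) (x g r K : R) :
  0 < r ->
  (forall y, Rabs (y - x) < r -> Rabs (f y - f x - g * (y - x)) <= K * (y - x) ^ 2) ->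
  is_derive f x g.
Proof.
  intros Hr H. apply is_derive_Reals. intros eta He.
  assert (HK : 0 < Rabs K + 1) by (pose proof (Rabs_pos K); lra).
  assert (Hd : 0 < Rmin r (eta / (Rabs K + 1))).
  { apply Rmin_glb_lt; [assumption|]. apply Rdiv_lt_0_compat; lra. }
  exists (mkposreal _ Hd). intros h Hh Hlt. simpl in Hlt.
  assert (Rmin r (eta / (Rabs K + 1)) <= r) by apply Rmin_l.
  assert (Rmin r (eta / (Rabs K + 1)) <= eta / (Rabs K + 1)) by apply Rmin_r.
  specialize (H (x + h)). replace (x + h - x) with h in H by ring.
  assert (H2 : Rabs (f (x + h) - f x - g * h) <= K * h ^ 2) by (apply H; lra).
  replace ((f (x + h) - f x) / h - g) with ((f (x + h) - f x - g * h) / h) by (field; auto).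
  unfold Rdiv. rewrite Rabs_mult, Rabs_inv.
  assert (Hp : 0 < Rabs h) by now apply Rabs_pos_lt.
  apply Rmult_lt_reg_r with (Rabs h); [assumption|].
  rewrite Rmult_assoc, Rinv_l, Rmult_1_r by lra.
  assert (E : h ^ 2 = Rabs h * Rabs h) by (rewrite <- pow2_abs; ring).
  rewrite E in H2. assert (K <= Rabs K) by apply Rle_abs.
  assert (Rabs h * (Rabs K + 1) < eta).
  { apply Rlt_le_trans with (eta / (Rabs K + 1) * (Rabs K + 1)).
    - apply Rmult_lt_compat_r; lra.
    - right; field; lra. }
  assert (K * (Rabs h * Rabs h) <= Rabs K * (Rabs h * Rabs h)) by (apply Rmult_le_compat_r; nra).
  nra.
Qed.

(** A Lipschitz constant for the derivatives that is uniform in n gives a quadratic Taylor remainder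
    uniform in n, and this inequality survives pointwise limits. *)
Lemma is_derive_limit (u G : nat -> R -> R) (f : R -> R) (x g r K : R) :
  0 < r ->
  (forall n y, Rabs (y - x) < r -> is_derive (u n) y (G n y)) ->
  (forall n y, Rabs (y - x) < r -> Rabs (G n y - G n x) <= K * Rabs (y - x)) ->
  (forall y, Rabs (y - x) < r -> is_lim_seq (fun n => u n y) (f y)) ->
  is_lim_seq (fun n => G n x) g ->
  is_derive f x g.
Proof.
  intros Hr Hd HL Hf Hg. apply (is_derive_of_quadratic f x g r K Hr).
  intros y Hy.
  assert (Hb : forall n, Rabs (u n y - u n x - G n x * (y - x)) <= K * (y - x) ^ 2).
  { intros n. destruct (MVT_gen (u n) x y (G n)) as [z [Hz E]].
    - intros z Hz. apply Hd. revert Hz Hy. unfold Rmin, Rmax, Rabs. 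
      destruct (Rle_dec x y), (Rcase_abs (y - x)), (Rcase_abs (z - x)); lra.
    - intros z Hz. eapply is_derive_continuity_pt. apply Hd. revert Hz Hy. unfold Rmin, Rmax, Rabs.
      destruct (Rle_dec x y), (Rcase_abs (y - x)), (Rcase_abs (z - x)); lra.
    - assert (Hzy : Rabs (z - x) <= Rabs (y - x)).
      { revert Hz. unfold Rmin, Rmax, Rabs.
        destruct (Rle_dec x y), (Rcase_abs (y - x)), (Rcase_abs (z - x)); lra. }
      rewrite E. replace (G n z * (y - x) - G n x * (y - x)) with ((G n z - G n x) * (y - x)) by ring.
      rewrite Rabs_mult. assert (A := HL n z (Rle_lt_trans _ _ _ Hzy Hy)).
      assert (A0 := HL n y Hy).
      assert (Hp := Rabs_pos (y - x)). assert (Hp2 := Rabs_pos (z - x)).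
      assert (Hp3 := Rabs_pos (G n y - G n x)).
      assert (E2 : (y - x) ^ 2 = Rabs (y - x) * Rabs (y - x)).
      { rewrite <- pow2_abs. ring. }
      rewrite E2.
      destruct (Req_dec (Rabs (y - x)) 0) as [Z | Z]; [rewrite Z; lra|].
      assert (0 <= K) by nra.
      assert (K * Rabs (z - x) <= K * Rabs (y - x)) by (apply Rmult_le_compat_l; lra).
      nra. }
  assert (Hx : Rabs (x - x) < r) by (rewrite Rminus_diag, Rabs_R0; lra).
  refine (is_lim_seq_le _ (fun _ => K * (y - x) ^ 2) (Finite _) (Finite _) Hb _ (is_lim_seq_const _)).
  apply (is_lim_seq_abs (fun n => u n y - u n x - G n x * (y - x)) (Finite (f y - f x - g * (y - x)))).
  apply is_lim_seq_minus'.
  - apply is_lim_seq_minus'; auto.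
  - apply is_lim_seq_mult'; auto. apply is_lim_seq_const.
Qed.

(** This is the slope dV/dU = V'/V of the orbit above the cut-off, rewritten with U = 1 - x and V =
    - p. *)
Definition profile_rhs (k c x p : R) : R := k * (1 - x) - c + x * (1 - x) / p.

(* With [x = 1 - U], the graph [V = - p x] of the unstable manifold of (1, 0). *)
Definition is_profile (k c : R) (p : R -> R) : Prop :=
  (forall x, 0 < x < 1 -> 0 < p x /\ is_derive p x (profile_rhs k c x (p x))) /\
  exists m, forall x, 0 < x < 1 -> p x <= m * x.

(* Raising [x (1 - x)] by [d] makes the equation regular at [x = 0], and
   [a (x (1 - x) + d)] is an exact subsolution. *)
Lemma regularised_profile (k c d : R) (hk : 0 < k) (hd : 0 < d) :
  let a := / (Rabs c + k + 1) in
  exists y : R -> R, (forall x, continuous y x) /\ y 0 = a * d /\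
    forall x, 0 < x < 1 ->
      a * (x * (1 - x) + d) <= y x /\
      is_derive y x (k * (1 - x) - c + (x * (1 - x) + d) / y x).
Proof.
  intros a.
  assert (HC : 0 < Rabs c + k + 1) by (pose proof (Rabs_pos c); lra).
  assert (Ha : 0 < a) by (apply Rinv_0_lt_compat; lra).
  assert (Ha1 : a * (Rabs c + k + 1) = 1) by (unfold a; field; lra).
  set (h := fun x => clamp x * (1 - clamp x) + d).
  assert (Hh : forall x, d <= h x).
  { intros x. unfold h. destruct (clamp_bounds x). nra. }
  assert (Hden : forall x u, 0 < a * h x <= Rmax u (a * h x)).
  { intros x u. split; [|apply Rmax_r]. specialize (Hh x). apply Rmult_lt_0_compat; lra. }
  (* The denominator is truncated at the subsolution a h, which makes [f] globally Lipschitz in y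
     with constant at most 1 / (a^2 d). The solution stays above a h, so on it the truncation is
     inactive. *)
  set (f := fun x y => k * (1 - x) - c + h x / Rmax y (a * h x)).
  assert (hc : forall x, continuous h x).
  { intros x. unfold h.
    apply (continuous_plus (fun x => clamp x * (1 - clamp x)) (fun _ => d)); [|apply continuous_const].
    apply (continuous_mult clamp (fun x => 1 - clamp x)); [apply continuous_clamp|].
    apply (continuous_minus (fun _ => 1) clamp); [apply continuous_const | apply continuous_clamp]. }
  destruct (picard f (/ (a ^ 2 * d)) (a * d)) as [y [Hy1 [Hy2 Hy3]]].
  - apply Rinv_0_lt_compat. apply Rmult_lt_0_compat; [apply pow_lt|]; assumption.
  - intros y Hy x. unfold f.
    apply (continuous_plus (fun x => k * (1 - x) - c) (fun x => h x / Rmax (y x) (a * h x))).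
    + smooth.
    + apply (continuous_mult h (fun x => / Rmax (y x) (a * h x))); [apply hc|].
      assert (Hm : continuous (fun x => Rmax (y x) (a * h x)) x).
      { assert (Emax : forall u v : R, (u + v + Rabs (u - v)) / 2 = Rmax u v).
        { intros u v. unfold Rmax. destruct (Rle_dec u v).
          - rewrite Rabs_left1 by lra. field.
          - rewrite Rabs_right by lra. field. }
        apply (continuous_ext (fun x => (y x + a * h x + Rabs (y x - a * h x)) / 2)).
        { intros t. apply Emax. }
        assert (Hah : continuous (fun x => a * h x) x).
        { apply (continuous_mult (fun _ => a) h); [apply continuous_const | apply hc]. }
        apply (continuous_mult (fun x => y x + a * h x + Rabs (y x - a * h x)) (fun _ => / 2));
          [|apply continuous_const].
        apply (continuous_plus (fun x => y x + a * h x) (fun x => Rabs (y x - a * h x))).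
        - apply (continuous_plus y (fun x => a * h x)); auto.
        - apply (continuous_comp (fun x => y x - a * h x) Rabs); [|apply continuous_Rabs].
          apply (continuous_minus y (fun x => a * h x)); auto. }
      apply (continuous_comp (fun x => Rmax (y x) (a * h x)) Rinv); [exact Hm|].
      apply (ex_derive_continuous Rinv). auto_derive. destruct (Hden x (y x)). lra.
  - intros t u v _. unfold f.
    replace (k * (1 - t) - c + h t / Rmax u (a * h t) - (k * (1 - t) - c + h t / Rmax v (a * h t)))
      with (h t / (Rmax u (a * h t) * Rmax v (a * h t)) * (Rmax v (a * h t) - Rmax u (a * h t))).
    2:{ destruct (Hden t u), (Hden t v). field. lra. }
    rewrite Rabs_mult.
    assert (Hq : 0 <= h t / (Rmax u (a * h t) * Rmax v (a * h t)) <= / (a ^ 2 * d)).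
    { destruct (Hden t u), (Hden t v). specialize (Hh t). split.
      - apply Rdiv_le_0_compat; [lra|]. apply Rmult_lt_0_compat; lra.
      - apply Rle_trans with (h t / ((a * h t) * (a * h t))).
        + apply Rmult_le_compat_l; [lra|]. apply Rinv_le_contravar; [nra|].
          apply Rmult_le_compat; lra.
        + replace (h t / (a * h t * (a * h t))) with (/ (a ^ 2 * h t)) by (field; lra).
          apply Rinv_le_contravar; [apply Rmult_lt_0_compat; [apply pow_lt|]; lra|].
          apply Rmult_le_compat_l; [apply pow_le; lra | lra]. }
    rewrite Rabs_right by lra.
    apply Rmult_le_compat; [lra | apply Rabs_pos | lra |].
    rewrite <- Rabs_Ropp. replace (- (Rmax v (a * h t) - Rmax u (a * h t)))
      with (Rmax u (a * h t) - Rmax v (a * h t)) by ring.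
    unfold Rmax. destruct (Rle_dec u (a * h t)), (Rle_dec v (a * h t));
    unfold Rabs; repeat match goal with |- context [Rcase_abs ?b] => destruct (Rcase_abs b) end; lra.
  (* Where y is below a h, the truncated quotient equals 1 / a = |c| + k + 1, so the slope of y is
     at least 1, while that of a h is at most a <= 1. *)
  - assert (Hsub : forall x, 0 <= x < 1 -> a * (x * (1 - x) + d) - y x <= 0).
    { intros x Hx.
      apply (barrier_weak (fun x => a * (x * (1 - x) + d) - y x)
               (fun x => a * (1 - 2 * x) - f x (y x)) 0 x); try lra.
      - intros t Ht.
        apply (is_derive_minus (fun x => a * (x * (1 - x) + d)) y t (a * (1 - 2 * t)) (f t (y t)));
          [|apply Hy3; lra].
        auto_derive; [trivial|]. ring.
      - intros t Ht. apply (continuous_minus (fun x => a * (x * (1 - x) + d)) y); auto.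
        smooth.
      - intros t Ht Hpos. unfold f.
        assert (Eh : h t = t * (1 - t) + d) by (unfold h; rewrite clamp_id; lra).
        rewrite <- Eh in Hpos. rewrite Rmax_right by lra.
        specialize (Hh t).
        replace (h t / (a * h t)) with (Rabs c + k + 1) by (unfold a; field; lra).
        assert (c <= Rabs c) by apply Rle_abs. pose proof (Rabs_pos c).
        assert (a <= 1) by (rewrite <- Ha1; nra). nra. }
    exists y. split; [assumption|]. split; [assumption|].
    intros x Hx. specialize (Hsub x (conj (Rlt_le _ _ (proj1 Hx)) (proj2 Hx))).
    split; [lra|]. specialize (Hy3 x Hx). unfold f in Hy3.
    assert (Eh : h x = x * (1 - x) + d) by (unfold h; rewrite clamp_id; lra).
    rewrite Eh, Rmax_left in Hy3 by lra. exact Hy3.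
Qed.

Lemma Rdiv_le_compat (a b c d : R) : 0 <= a <= b -> 0 < d <= c -> a / c <= b / d.
Proof.
  intros H1 H2. unfold Rdiv. apply Rmult_le_compat; try lra.
  - left; apply Rinv_0_lt_compat; lra.
  - apply Rinv_le_contravar; lra.
Qed.

(** The regularised solutions decrease as d decreases and stay above a x (1 - x), hence converge
    pointwise; bounds on their slopes that do not depend on d carry the equation to the limit and
    give the linear bound at 0. *)
Lemma profile_exists (k c : R) (hk : 0 < k) : exists p, is_profile k c p.
Proof.
  set (C := Rabs c + k). set (a := / (C + 1)).
  assert (HC : 0 < C) by (unfold C; pose proof (Rabs_pos c); lra).
  assert (Ha : 0 < a) by (apply Rinv_0_lt_compat; lra).
  assert (Hc1 : c <= Rabs c) by apply Rle_abs.
  assert (Hc2 : - Rabs c <= c) by (pose proof (Rle_abs (- c)); rewrite Rabs_Ropp in *; lra).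
  set (Q := fun d y => (forall x, continuous y x) /\ y 0 = a * d /\
    forall x, 0 < x < 1 -> a * (x * (1 - x) + d) <= y x /\
      is_derive y x (k * (1 - x) - c + (x * (1 - x) + d) / y x)).
  set (Y := fun d => epsilon (inhabits (fun _ : R => 0)) (Q d)).
  assert (HY : forall d, 0 < d -> Q d (Y d)).
  { intros d Hd. apply epsilon_spec. apply (regularised_profile k c d hk Hd). }
  assert (Hpos : forall d x, 0 < d -> 0 < x < 1 -> 0 < a * (x * (1 - x) + d)).
  { intros d x Hd Hx. apply Rmult_lt_0_compat; [assumption|]. nra. }
  set (G := fun d x => k * (1 - x) - c + (x * (1 - x) + d) / Y d x).
  (* The subsolution bounds the quotient by 1 / a = C + 1, uniformly in d; the remaining terms lie
     between - C and C. *)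
  assert (HG : forall d x, 0 < d -> 0 < x < 1 -> - C <= G d x <= 2 * C + 1).
  { intros d x Hd Hx. destruct (HY d Hd) as [_ [_ H]]. destruct (H x Hx) as [H1 _].
    specialize (Hpos d x Hd Hx). unfold G.
    assert (0 <= (x * (1 - x) + d) / Y d x <= C + 1).
    { split; [apply Rdiv_le_0_compat; nra|].
      apply Rle_trans with ((x * (1 - x) + d) / (a * (x * (1 - x) + d))).
      - apply Rdiv_le_compat; nra.
      - right. unfold a. field. split; nra. }
    unfold C in *. nra. }
  assert (Hder : forall d x, 0 < d -> 0 < x < 1 -> is_derive (Y d) x (G d x)).
  { intros d x Hd Hx. destruct (HY d Hd) as [_ [_ H]]. apply (H x Hx). }
  assert (Hcont : forall d x, 0 < d -> continuous (Y d) x).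
  { intros d x Hd. now apply (HY d Hd). }
  assert (Hmono : forall d e x, 0 < e <= d -> 0 < x < 1 -> Y e x <= Y d x).
  { intros d e x Hde Hx.
    assert (Y e x - Y d x <= 0); [|lra].
    apply (barrier_weak (fun x => Y e x - Y d x) (fun x => G e x - G d x) 0 x); try lra.
    - intros t Ht. apply (is_derive_minus (Y e) (Y d)); apply Hder; lra.
    - intros t Ht. apply (continuous_minus (Y e) (Y d)); apply Hcont; lra.
    - intros t Ht Hp. unfold G.
      destruct (HY d) as [_ [_ H]]; [lra|]. destruct (H t) as [H1 _]; [lra|].
      assert (H2 : 0 < a * (t * (1 - t) + d)) by (apply Hpos; lra).
      assert ((t * (1 - t) + e) / Y e t <= (t * (1 - t) + d) / Y d t)
        by (apply Rdiv_le_compat; [nra | lra]).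
      lra.
    - destruct (HY d) as [_ [E1 _]]; [lra|]. destruct (HY e) as [_ [E2 _]]; [lra|].
      rewrite E1, E2. nra. }
  set (dn := fun n : nat => / (INR n + 1)).
  assert (Hdn : forall n, 0 < dn n).
  { intros n. unfold dn. apply Rinv_0_lt_compat. pose proof (pos_INR n). lra. }
  assert (Hex : forall x, 0 < x < 1 -> ex_finite_lim_seq (fun n => Y (dn n) x)).
  { intros x Hx. apply (ex_finite_lim_seq_decr _ 0).
    - intros n. apply Hmono; [|assumption]. split; [apply Hdn|].
      unfold dn. apply Rinv_le_contravar; [pose proof (pos_INR n); lra|].
      rewrite S_INR. lra.
    - intros n. destruct (HY (dn n) (Hdn n)) as [_ [_ H]]. destruct (H x Hx) as [H1 _].
      specialize (Hpos (dn n) x (Hdn n) Hx). lra. }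
  assert (Hdlim : is_lim_seq dn 0).
  { apply (is_lim_seq_ext (fun n => / INR (S n))); [intros n; unfold dn; now rewrite S_INR|].
    apply (is_lim_seq_incr_1 (fun n => / INR n)).
    apply (is_lim_seq_inv INR p_infty); [apply is_lim_seq_INR | discriminate]. }
  set (p := fun x => real (Lim_seq (fun n => Y (dn n) x))).
  assert (Hp : forall x, 0 < x < 1 -> is_lim_seq (fun n => Y (dn n) x) (p x)).
  { intros x Hx. apply Lim_seq_correct'. now apply Hex. }
  assert (Hplow : forall x, 0 < x < 1 -> a * (x * (1 - x)) <= p x).
  { intros x Hx.
    refine (is_lim_seq_le (fun _ => a * (x * (1 - x))) _ (Finite _) (Finite _) _ (is_lim_seq_const _) (Hp x Hx)).
    intros n. destruct (HY (dn n) (Hdn n)) as [_ [_ H]]. destruct (H x Hx) as [H1 _].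
    specialize (Hdn n). nra. }
  exists p. split.
  - intros x Hx. assert (Hpx := Hplow x Hx).
    assert (Hxx : 0 < a * (x * (1 - x))) by (apply Rmult_lt_0_compat; nra).
    split; [lra|].
    (* On this radius y (1 - y) >= r^2, so all denominators are at least a r^2 and [G] has a
       Lipschitz constant that does not depend on n. *)
    set (r := Rmin x (1 - x) / 2).
    assert (Hr : 0 < r /\ r <= x / 2 /\ r <= (1 - x) / 2).
    { unfold r. split; [apply Rdiv_lt_0_compat; [apply Rmin_glb_lt|]; lra|].
      assert (Rmin x (1 - x) <= x) by apply Rmin_l.
      assert (Rmin x (1 - x) <= 1 - x) by apply Rmin_r. lra. }
    assert (Hlow : forall n y, Rabs (y - x) < r -> 0 < y < 1 /\ a * r ^ 2 <= Y (dn n) y).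
    { intros n y Hy. apply Rabs_def2 in Hy. assert (Hy1 : 0 < y < 1) by lra. split; [assumption|].
      destruct (HY (dn n) (Hdn n)) as [_ [_ H]]. destruct (H y Hy1) as [H1 _].
      specialize (Hdn n). apply Rle_trans with (a * (y * (1 - y) + dn n)); [|assumption].
      apply Rmult_le_compat_l; [lra|]. nra. }
    assert (Hr2 : 0 < a * r ^ 2) by (apply Rmult_lt_0_compat; [lra | apply pow_lt; lra]).
    apply (is_derive_limit (fun n => Y (dn n)) (fun n => G (dn n)) p x
             (profile_rhs k c x (p x)) r (k + (1 + (C + 1) * (2 * C + 1)) / (a * r ^ 2))); [lra| | | |].
    + intros n y Hy. apply Hder; [apply Hdn | apply (Hlow n y Hy)].
    + intros n y Hy. destruct (Hlow n y Hy) as [Hy1 Hy2].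
      destruct (Hlow n x) as [_ Hx2]; [rewrite Rminus_diag, Rabs_R0; lra|].
      assert (Hd := Hdn n). set (d := dn n) in *.
      assert (HLip : Rabs (Y d x - Y d y) <= (2 * C + 1) * Rabs (y - x)).
      { destruct (MVT_gen (Y d) y x (G d)) as [z [Hz E]].
        - intros z Hz. apply Hder; [assumption|].
          split; [apply Rle_lt_trans with (Rmin y x); [apply Rmin_glb|] | apply Rlt_le_trans with (Rmax y x); [|apply Rmax_lub]]; lra.
        - intros z _. apply continuity_pt_filterlim. now apply Hcont.
        - rewrite E, Rabs_mult, (Rabs_minus_sym x y).
          apply Rmult_le_compat_r; [apply Rabs_pos|].
          assert (0 < z < 1).
          { split; [apply Rlt_le_trans with (Rmin y x); [apply Rmin_glb_lt|] | apply Rle_lt_trans with (Rmax y x); [|apply Rmax_lub_lt]]; lra. }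
          assert (HGz := HG d z Hd H). apply Rabs_le. lra. }
      assert (Hhq : 0 <= (x * (1 - x) + d) / Y d x <= C + 1).
      { destruct (HY d Hd) as [_ [_ H]]. destruct (H x Hx) as [H1 _].
        split; [apply Rdiv_le_0_compat; nra|].
        apply Rle_trans with ((x * (1 - x) + d) / (a * (x * (1 - x) + d))).
        - apply Rdiv_le_compat; nra.
        - right. unfold a. field. split; nra. }
      unfold G.
      replace (k * (1 - y) - c + (y * (1 - y) + d) / Y d y - (k * (1 - x) - c + (x * (1 - x) + d) / Y d x))
        with (- k * (y - x) + ((1 - x - y) * (y - x) + (x * (1 - x) + d) / Y d x * (Y d x - Y d y)) * / Y d y)
        by (field; lra).
      eapply Rle_trans; [apply Rabs_triang|].
      rewrite !Rabs_mult, Rabs_Ropp, (Rabs_right k) by lra.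
      rewrite Rmult_plus_distr_r. apply Rplus_le_compat_l.
      rewrite Rabs_inv, (Rabs_right (Y d y)) by lra.
      replace ((1 + (C + 1) * (2 * C + 1)) / (a * r ^ 2) * Rabs (y - x))
        with (((1 + (C + 1) * (2 * C + 1)) * Rabs (y - x)) * / (a * r ^ 2)) by (field; lra).
      apply Rmult_le_compat; [apply Rabs_pos | left; apply Rinv_0_lt_compat; lra | | apply Rinv_le_contravar; lra].
      eapply Rle_trans; [apply Rabs_triang|].
      rewrite !Rabs_mult, (Rabs_right ((x * (1 - x) + d) / Y d x)) by lra.
      rewrite Rmult_plus_distr_r. apply Rplus_le_compat.
      * apply Rmult_le_compat_r; [apply Rabs_pos|]. apply Rabs_le. lra.
      * rewrite Rmult_assoc. apply Rmult_le_compat; try lra. apply Rabs_pos.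
    + intros y Hy. apply Hp. apply Rabs_def2 in Hy. lra.
    + unfold G, profile_rhs. apply is_lim_seq_plus'; [apply is_lim_seq_const|].
      apply is_lim_seq_div'; [|apply Hp; assumption|lra].
      replace (x * (1 - x)) with (x * (1 - x) + 0) at 1 by ring.
      apply is_lim_seq_plus'; [apply is_lim_seq_const | exact Hdlim].
  - exists (2 * C + 1). intros x Hx.
    assert (Hup : forall n, Y (dn n) x <= a * dn n + (2 * C + 1) * x).
    { intros n. assert (Hd := Hdn n).
      destruct (mvt_open (Y (dn n)) (G (dn n)) 0 x) as [z [Hz E]]; [lra| | |].
      - intros; apply Hder; lra.
      - intros; apply Hcont; lra.
      - destruct (HY (dn n) Hd) as [_ [E0 _]]. rewrite E0 in E.
        assert (HGz : G (dn n) z <= 2 * C + 1) by (apply HG; lra). nra. }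
    refine (is_lim_seq_le _ (fun n => a * dn n + (2 * C + 1) * x) (Finite _) (Finite _) Hup (Hp x Hx) _).
    replace ((2 * C + 1) * x) with (a * 0 + (2 * C + 1) * x) at 1 by ring.
    apply is_lim_seq_plus'; [|apply is_lim_seq_const].
    apply is_lim_seq_mult'; [apply is_lim_seq_const | exact Hdlim].
Qed.

Lemma profile_pos k c p x : is_profile k c p -> 0 < x < 1 -> 0 < p x.
Proof. intros [H _] Hx. apply (H x Hx). Qed.

Lemma profile_derive k c p x :
  is_profile k c p -> 0 < x < 1 -> is_derive p x (profile_rhs k c x (p x)).
Proof. intros [H _] Hx. apply (H x Hx). Qed.

Lemma small_of_linear_bound (f : R -> R) (m : R) :
  (forall x, 0 < x <= / 2 -> f x <= m * x) ->
  forall eta r, 0 < eta -> 0 < r -> exists x, 0 < x < r /\ f x <= eta.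
Proof.
  intros H eta r He Hr.
  set (M := Rabs m + 1). assert (HM : 0 < M) by (unfold M; pose proof (Rabs_pos m); lra).
  assert (0 < eta / M) by (apply Rdiv_lt_0_compat; lra).
  set (x := Rmin (Rmin (r / 2) (1 / 2)) (eta / M)).
  assert (Hx0 : 0 < x) by (unfold x; repeat apply Rmin_glb_lt; lra).
  assert (Hx1 : x <= Rmin (r / 2) (1 / 2)) by apply Rmin_l.
  assert (Hx2 : x <= eta / M) by apply Rmin_r.
  assert (Rmin (r / 2) (1 / 2) <= r / 2) by apply Rmin_l.
  assert (Rmin (r / 2) (1 / 2) <= 1 / 2) by apply Rmin_r.
  exists x. split; [lra|].
  eapply Rle_trans; [apply H; lra|].
  apply Rle_trans with (M * x).
  - apply Rmult_le_compat_r; [lra|]. unfold M. pose proof (Rle_abs m). lra.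
  - apply Rle_trans with (M * (eta / M)); [apply Rmult_le_compat_l; lra|]. right; field; lra.
Qed.

(* The right-hand side is decreasing in [p], so a profile lies below any supersolution. *)
Lemma profile_le_super (k c : R) (p q dq : R -> R) (b : R) :
  is_profile k c p -> b <= 1 ->
  (forall x, 0 < x < b -> 0 <= q x) ->
  (forall x, 0 < x < b -> is_derive q x (dq x)) ->
  (forall x, 0 < x < b -> q x < p x -> profile_rhs k c x (p x) <= dq x) ->
  forall x, 0 < x < b -> p x <= q x.
Proof.
  intros [Hp [m Hm]] Hb Hq Hdq Hs x Hx.
  assert (p x - q x <= 0); [|lra].
  apply (barrier_from_zero (fun x => p x - q x) (fun x => profile_rhs k c x (p x) - dq x) b); auto.
  - intros t Ht. apply (is_derive_minus p q); [apply Hp; lra | now apply Hdq].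
  - intros t Ht Hpos. specialize (Hs t Ht). lra.
  - intros eta r He Hr. assert (Hb0 : 0 < b) by lra.
    destruct (small_of_linear_bound p m (fun x Hx => Hm x ltac:(lra)) eta (Rmin r b) He) as [x0 [Hx0 H0]].
    { apply Rmin_glb_lt; lra. }
    assert (Rmin r b <= r) by apply Rmin_l. assert (Rmin r b <= b) by apply Rmin_r.
    exists x0. split; [lra|]. specialize (Hq x0). lra.
Qed.

Lemma profile_rhs_decr k c x p q :
  0 < x < 1 -> 0 < q <= p -> profile_rhs k c x p <= profile_rhs k c x q.
Proof.
  intros Hx Hq. unfold profile_rhs. apply Rplus_le_compat_l.
  apply Rdiv_le_compat; nra.
Qed.

(* Monotonicity in [k] serves to compare [k <= 2] with the explicit profile for [k = 2]. *)
Lemma profile_le k1 c1 p1 k2 c2 p2 :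
  k1 <= k2 -> c2 <= c1 -> is_profile k1 c1 p1 -> is_profile k2 c2 p2 ->
  forall x, 0 < x < 1 -> p1 x <= p2 x.
Proof.
  intros Hk Hc H1 H2.
  apply (profile_le_super k1 c1 p1 p2 (fun x => profile_rhs k2 c2 x (p2 x)) 1); auto; try lra.
  - intros x Hx. left. now apply (profile_pos k2 c2).
  - intros x Hx. now apply profile_derive.
  - intros x Hx Hlt. apply Rle_trans with (profile_rhs k1 c1 x (p2 x)).
    + apply profile_rhs_decr; auto. split; [now apply (profile_pos k2 c2) | lra].
    + unfold profile_rhs. nra.
Qed.

(** The speed enters the right-hand side only as - c, so adding (c2 - c1) x to [p2] supplies exactly
    the missing slope; the larger value only lowers the quotient, and the sum is a supersolution for
    [c1]. *)
Lemma profile_diff_le k c1 p1 c2 p2 :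
  c1 <= c2 -> is_profile k c1 p1 -> is_profile k c2 p2 ->
  forall x, 0 < x < 1 -> p1 x <= p2 x + (c2 - c1) * x.
Proof.
  intros Hc H1 H2.
  apply (profile_le_super k c1 p1 (fun x => p2 x + (c2 - c1) * x)
           (fun x => profile_rhs k c2 x (p2 x) + (c2 - c1)) 1); auto; try lra.
  - intros x Hx. assert (0 < p2 x) by now apply (profile_pos k c2). nra.
  - intros x Hx. apply (is_derive_plus p2 (fun x => (c2 - c1) * x)).
    + now apply profile_derive.
    + auto_derive; [trivial | ring].
  - intros x Hx Hlt. assert (0 < p2 x) by now apply (profile_pos k c2).
    apply Rle_trans with (profile_rhs k c1 x (p2 x)).
    + apply profile_rhs_decr; auto. nra.
    + unfold profile_rhs. lra.
Qed.

(** For a multiple of x (1 - x) the quotient in [profile_rhs] is constant, and comparing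
    coefficients fixes both the factor k / 2 and the speed. *)
Lemma profile_logistic (k : R) (hk : 0 < k) :
  is_profile k (k / 2 + 2 / k) (fun x => k / 2 * (x * (1 - x))).
Proof.
  split.
  - intros x Hx. assert (0 < x * (1 - x)) by nra. split; [nra|].
    unfold profile_rhs. auto_derive; [trivial|]. field. nra.
  - exists (k / 2). intros x Hx. nra.
Qed.

(** * The critical speed *)

Definition profile (k c : R) : R -> R := epsilon (inhabits (fun _ : R => 0)) (is_profile k c).

Lemma profile_spec k c : 0 < k -> is_profile k c (profile k c).
Proof. intros hk. unfold profile. apply epsilon_spec. now apply profile_exists. Qed.

Lemma c_crit_pos k : 0 < k -> 0 < c_crit k.
Proof.
  intros hk. unfold c_crit. destruct (Rle_dec k 2); [lra|].
  assert (0 < 2 / k) by (apply Rdiv_lt_0_compat; lra). lra.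
Qed.

Lemma profile_unique k c p q :
  is_profile k c p -> is_profile k c q -> forall x, 0 < x < 1 -> p x = q x.
Proof.
  intros Hp Hq x Hx. apply Rle_antisym; apply (profile_le k c _ k c _); auto; lra.
Qed.

Lemma profile_subcritical k : 0 < k <= 2 -> forall x, 0 < x < 1 -> profile k 2 x <= x * (1 - x).
Proof.
  intros hk x Hx.
  assert (H2 : is_profile 2 2 (fun x => 2 / 2 * (x * (1 - x)))).
  { replace 2 with (2 / 2 + 2 / 2) at 2 by lra. apply profile_logistic. lra. }
  assert (A := profile_le k 2 (profile k 2) 2 2 _ (proj2 hk) (Rle_refl 2)
                 (profile_spec k 2 (proj1 hk)) H2 x Hx). simpl in A. lra.
Qed.

Lemma profile_at_two : forall x, 0 < x < 1 -> profile 2 2 x = x * (1 - x).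
Proof.
  intros x Hx.
  assert (H2 : is_profile 2 2 (fun x => 2 / 2 * (x * (1 - x)))).
  { replace 2 with (2 / 2 + 2 / 2) at 2 by lra. apply profile_logistic. lra. }
  rewrite (profile_unique 2 2 (profile 2 2) _ (profile_spec 2 2 ltac:(lra)) H2 x Hx). lra.
Qed.

Lemma profile_supercritical k : 0 < k -> forall x, 0 < x < 1 ->
  profile k (k / 2 + 2 / k) x = k / 2 * (x * (1 - x)).
Proof.
  intros hk x Hx.
  apply (profile_unique k (k / 2 + 2 / k) _ _ (profile_spec k _ hk) (profile_logistic k hk) x Hx).
Qed.

(** At the critical speed the graph reaches U = 0 with slope at most C, strictly smaller than the
    slope of the line V = - c U; hence it meets that line for no cut-off in (0, 1). *)
Lemma profile_c_crit_le k : 0 < k ->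
  exists C, forall x, 0 < x < 1 -> profile k (c_crit k) x <= C * (x * (1 - x)) /\ C < c_crit k.
Proof.
  intros hk. unfold c_crit. destruct (Rle_dec k 2) as [H|H].
  - exists 1. intros x Hx. split; [|lra]. rewrite Rmult_1_l. now apply profile_subcritical.
  - exists (k / 2). intros x Hx. split; [now rewrite profile_supercritical; [lra| |]|].
    assert (0 < 2 / k) by (apply Rdiv_lt_0_compat; lra). lra.
Qed.

Lemma profile_c_crit_lt k eps : 0 < k -> 0 < eps < 1 ->
  profile k (c_crit k) (1 - eps) < c_crit k * eps.
Proof.
  intros hk He. destruct (profile_c_crit_le k hk) as [C HC].
  destruct (HC (1 - eps)) as [H1 H2]; [lra|].
  assert (0 < profile k (c_crit k) (1 - eps)).
  { apply (profile_pos k (c_crit k)); [now apply profile_spec | lra]. }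
  assert (0 < c_crit k) by now apply c_crit_pos.
  assert (H3 : (1 - eps) * (1 - (1 - eps)) < eps) by nra.
  assert (0 < (1 - eps) * (1 - (1 - eps))) by nra.
  assert (C * ((1 - eps) * (1 - (1 - eps))) < c_crit k * eps) by nra.
  lra.
Qed.

Lemma profile_gap_decr k c1 c2 eps : 0 < k -> 0 < eps < 1 -> c1 < c2 ->
  profile k c2 (1 - eps) - c2 * eps < profile k c1 (1 - eps) - c1 * eps.
Proof.
  intros hk He Hc.
  assert (profile k c2 (1 - eps) <= profile k c1 (1 - eps)).
  { apply (profile_le k c2 _ k c1 _); try lra; now apply profile_spec. }
  nra.
Qed.

Lemma profile_lipschitz_speed k c1 c2 x : 0 < k -> 0 < x < 1 ->
  Rabs (profile k c1 x - profile k c2 x) <= Rabs (c1 - c2).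
Proof.
  intros hk Hx.
  assert (H : forall c1 c2, c1 <= c2 -> Rabs (profile k c1 x - profile k c2 x) <= Rabs (c1 - c2)).
  { intros a b Hab.
    assert (A := profile_diff_le k a _ b _ Hab (profile_spec k a hk) (profile_spec k b hk) x Hx).
    assert (B := profile_le k b _ k a _ (Rle_refl k) Hab (profile_spec k b hk) (profile_spec k a hk) x Hx).
    rewrite Rabs_right by lra. rewrite Rabs_left1 by lra. nra. }
  destruct (Rle_dec c1 c2) as [Hc|Hc]; [now apply H|].
  rewrite Rabs_minus_sym, (Rabs_minus_sym c1). apply H. lra.
Qed.

(** The gap p_c(1 - eps) - c eps is continuous in c by the Lipschitz bound, positive at c = 0 and
    negative at [c_crit]. *)
Lemma cutoff_speed_exists k eps : 0 < k -> 0 < eps < 1 ->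
  exists c, 0 < c < c_crit k /\ profile k c (1 - eps) = c * eps.
Proof.
  intros hk He. assert (Hcp := c_crit_pos k hk).
  assert (P0 : 0 < profile k 0 (1 - eps)).
  { apply (profile_pos k 0); [now apply profile_spec | lra]. }
  assert (P1 := profile_c_crit_lt k eps hk He).
  destruct (IVT_gen (fun c => profile k c (1 - eps) - c * eps) 0 (c_crit k) 0) as [c [Hc E]].
  - intros c. apply continuity_pt_filterlim.
    apply (continuous_minus (fun c => profile k c (1 - eps)) (fun c => c * eps)).
    + apply (continuous_of_lipschitz _ 1); [lra|]. intros y. rewrite Rmult_1_l.
      apply profile_lipschitz_speed; lra.
    + smooth.
  - rewrite Rmin_right, Rmax_left by lra. lra.
  - rewrite Rmin_left, Rmax_right in Hc by lra.
    exists c. split; [|lra].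
    destruct (Req_dec c 0) as [->|N0]; [lra|].
    destruct (Req_dec c (c_crit k)) as [->|N1]; [lra|]. lra.
Qed.

(** The second branch sets the value at eps = 0 to the critical speed, where the matching condition
    does not select a speed. *)
Definition cutoff_speed (k eps : R) : R :=
  if Rlt_dec 0 eps
  then epsilon (inhabits 0) (fun c => 0 < c < c_crit k /\ profile k c (1 - eps) = c * eps)
  else c_crit k.

Lemma cutoff_speed_spec k eps : 0 < k -> 0 < eps < 1 ->
  0 < cutoff_speed k eps < c_crit k /\
  profile k (cutoff_speed k eps) (1 - eps) = cutoff_speed k eps * eps.
Proof.
  intros hk He. unfold cutoff_speed. destruct (Rlt_dec 0 eps); [|lra].
  apply (epsilon_spec (inhabits 0) (fun c => 0 < c < c_crit k /\ profile k c (1 - eps) = c * eps)).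
  now apply cutoff_speed_exists.
Qed.

Lemma cutoff_speed_unique k eps c : 0 < k -> 0 < eps < 1 ->
  profile k c (1 - eps) = c * eps -> c = cutoff_speed k eps.
Proof.
  intros hk He E. destruct (cutoff_speed_spec k eps hk He) as [_ E2].
  destruct (Rtotal_order c (cutoff_speed k eps)) as [H|[H|H]]; [|assumption|].
  - assert (A := profile_gap_decr k _ _ eps hk He H). lra.
  - assert (A := profile_gap_decr k _ _ eps hk He H). lra.
Qed.

(** * Orbits of scalar autonomous equations *)

Lemma expanding_lower (T dT : R -> R) (m : R) :
  (forall y, is_derive T y (dT y)) -> (forall y, m <= dT y) ->
  forall a b, a <= b -> m * (b - a) <= T b - T a.
Proof.
  intros Hd Hm a b Hab.
  destruct (Req_dec a b) as [->|Hne]; [lra|].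
  destruct (mvt T dT a b) as [x [Hx E]]; [lra| | |].
  - intros; apply Hd.
  - intros; eapply continuous_of_derive; apply Hd.
  - rewrite E. apply Rmult_le_compat_r; [lra | apply Hm].
Qed.

(** Slope at least m > 0 makes T grow at least linearly, so it is onto by the intermediate value
    theorem on [- r, r] with r = |xi - T 0| / m. The same bound makes the inverse Lipschitz with
    constant 1 / m, which controls the increment in the difference quotient of Y. *)
Lemma expanding_inverse (T dT : R -> R) (m : R) :
  0 < m -> (forall y, is_derive T y (dT y)) -> (forall y, m <= dT y) ->
  exists Y, (forall xi, T (Y xi) = xi) /\ forall xi, is_derive Y xi (/ dT (Y xi)).
Proof.
  intros Hm Hd Hl.
  assert (Hlow := expanding_lower T dT m Hd Hl).
  assert (Hsurj : forall xi, exists y, T y = xi).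
  { intros xi. set (r := Rabs (xi - T 0) / m).
    assert (Hr : 0 <= r) by (apply Rdiv_le_0_compat; [apply Rabs_pos | lra]).
    assert (Er : m * r = Rabs (xi - T 0)) by (unfold r; field; lra).
    destruct (IVT_gen T (- r) r xi) as [y [_ E]].
    - intros y. eapply is_derive_continuity_pt. apply Hd.
    - assert (A := Hlow (- r) 0 ltac:(lra)). assert (B := Hlow 0 r ltac:(lra)).
      pose proof (Rle_abs (xi - T 0)). pose proof (Rle_abs (- (xi - T 0))). rewrite Rabs_Ropp in *.
      rewrite Rmin_left, Rmax_right by lra. lra.
    - now exists y. }
  set (Y := fun xi => epsilon (inhabits 0) (fun y => T y = xi)).
  assert (HY : forall xi, T (Y xi) = xi).
  { intros xi. apply (epsilon_spec (inhabits 0) (fun y => T y = xi)). apply Hsurj. }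
  assert (Habs : forall a b, m * Rabs (b - a) <= Rabs (T b - T a)).
  { intros a b. destruct (Rle_dec a b).
    - assert (A := Hlow a b r). rewrite (Rabs_right (b - a)) by lra.
      eapply Rle_trans; [exact A | apply Rle_abs].
    - assert (A := Hlow b a ltac:(lra)). rewrite (Rabs_left (b - a)) by lra.
      rewrite Rabs_minus_sym. eapply Rle_trans; [|apply Rle_abs]. lra. }
  exists Y. split; [assumption|].
  intros xi. assert (Hp : 0 < dT (Y xi)) by (specialize (Hl (Y xi)); lra).
  apply is_derive_Reals. intros eta He.
  assert (Hdy := Hd (Y xi)). apply is_derive_Reals in Hdy.
  destruct (Hdy (eta * m * dT (Y xi) / 2)) as [d Hd'].
  { apply Rdiv_lt_0_compat; [|lra]. repeat apply Rmult_lt_0_compat; lra. }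
  assert (Hdp : 0 < m * d) by (apply Rmult_lt_0_compat; [assumption | apply cond_pos]).
  exists (mkposreal _ Hdp). intros h Hh Hhd. simpl in Hhd.
  set (g := Y (xi + h) - Y xi).
  assert (Hg : m * Rabs g <= Rabs h).
  { unfold g. assert (A := Habs (Y xi) (Y (xi + h))). rewrite !HY in A.
    now replace (xi + h - xi) with h in A by ring. }
  assert (Hg0 : g <> 0).
  { intros E. unfold g in E. assert (E2 : Y (xi + h) = Y xi) by lra.
    assert (E3 := HY (xi + h)). rewrite E2, HY in E3. lra. }
  assert (Hgd : Rabs g < d) by nra.
  specialize (Hd' g Hg0 Hgd).
  replace (Y xi + g) with (Y (xi + h)) in Hd' by (unfold g; ring).
  rewrite !HY in Hd'. replace (xi + h - xi) with h in Hd' by ring.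
  replace (g / h - / dT (Y xi)) with (- (g / h) * / dT (Y xi) * (h / g - dT (Y xi))) by (field; lra).
  rewrite !Rabs_mult, Rabs_Ropp.
  assert (Hgh : Rabs (g / h) <= / m).
  { unfold Rdiv. rewrite Rabs_mult, Rabs_inv. assert (0 < Rabs h) by now apply Rabs_pos_lt.
    apply Rmult_le_reg_r with (Rabs h); [assumption|]. rewrite Rmult_assoc, Rinv_l, Rmult_1_r by lra.
    apply Rmult_le_reg_l with m; [assumption|]. rewrite <- Rmult_assoc, Rinv_r, Rmult_1_l by lra. lra. }
  rewrite (Rabs_right (/ dT (Y xi))) by (left; now apply Rinv_0_lt_compat).
  apply Rle_lt_trans with (/ m * / dT (Y xi) * (eta * m * dT (Y xi) / 2)).
  - apply Rmult_le_compat; [|apply Rabs_pos| |lra].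
    + apply Rmult_le_pos; [apply Rabs_pos | left; now apply Rinv_0_lt_compat].
    + apply Rmult_le_compat_r; [left; now apply Rinv_0_lt_compat | assumption].
  - replace (/ m * / dT (Y xi) * (eta * m * dT (Y xi) / 2)) with (eta / 2) by (field; lra). lra.
Qed.

Lemma logistic_bounds y : 0 < / (1 + exp y) < 1.
Proof.
  pose proof (exp_pos y). split; [apply Rinv_0_lt_compat; lra|].
  rewrite <- Rinv_1. apply Rinv_lt_contravar; lra.
Qed.

(** Parametrise (0, 1) by U = 1 / (1 + exp y) and integrate the travel time along y. The bound by C
    u (1 - u) keeps dT/dy >= 1 / C, so T is onto: both ends are reached only in infinite time, and
    inverting T gives an orbit on the whole line. *)
Lemma decreasing_orbit_exists (f : R -> R) (C : R) :
  (forall u, 0 < u < 1 -> continuous f u /\ 0 < f u <= C * (u * (1 - u))) ->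
  exists U : R -> R,
    (forall xi, 0 < U xi < 1 /\ is_derive U xi (- f (U xi))) /\
    is_lim U m_infty 1 /\ is_lim U p_infty 0.
Proof.
  intros Hf.
  set (s := fun y => / (1 + exp y)).
  assert (Hs : forall y, 0 < s y < 1) by apply logistic_bounds.
  assert (Hss : forall y, 0 < s y * (1 - s y)) by (intros y; specialize (Hs y); nra).
  assert (Hsd : forall y, is_derive s y (- (s y * (1 - s y)))).
  { intros y. unfold s. pose proof (exp_pos y). auto_derive; [lra|]. field. lra. }
  set (dT := fun y => s y * (1 - s y) / f (s y)).
  assert (HC : 0 < C).
  { destruct (Hf (1 / 2)) as [_ H]; lra. }
  assert (HdT : forall y, / C <= dT y).
  { intros y. unfold dT. destruct (Hf (s y) (Hs y)) as [_ [H1 H2]].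
    apply Rmult_le_reg_r with (f (s y)); [assumption|].
    unfold Rdiv. rewrite Rmult_assoc, Rinv_l, Rmult_1_r by lra.
    apply Rmult_le_reg_l with C; [assumption|]. rewrite <- Rmult_assoc, Rinv_r, Rmult_1_l by lra. lra. }
  assert (HdTc : forall y, continuous dT y).
  { intros y. unfold dT.
    assert (Hsc : continuous s y) by (eapply continuous_of_derive; apply Hsd).
    apply (continuous_mult (fun y => s y * (1 - s y)) (fun y => / f (s y))).
    - apply (continuous_mult s (fun y => 1 - s y)); [assumption|].
      apply (continuous_minus (fun _ => 1) s); [apply continuous_const | assumption].
    - apply (continuous_comp (fun y => f (s y)) Rinv).
      + apply (continuous_comp s f); [assumption | now apply Hf].
      + apply (ex_derive_continuous Rinv). auto_derive.
        destruct (Hf (s y) (Hs y)) as [_ H]. lra. }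
  set (T := RInt dT 0).
  assert (HT : forall y, is_derive T y (dT y)) by (intros y; now apply is_derive_primitive).
  assert (HCi : 0 < / C) by now apply Rinv_0_lt_compat.
  destruct (expanding_inverse T dT (/ C) HCi HT HdT) as [Y [HY1 HY2]].
  assert (Hinc : forall a b, T a < T b -> a < b).
  { intros a b H. destruct (Rlt_le_dec a b); [assumption|].
    assert (A := expanding_lower T dT (/ C) HT HdT b a r). nra. }
  exists (fun xi => s (Y xi)). split; [|split].
  - intros xi. split; [apply Hs|].
    assert (Hd := is_derive_comp s Y xi _ _ (Hsd (Y xi)) (HY2 xi)).
    replace (- f (s (Y xi))) with (scal (/ dT (Y xi)) (- (s (Y xi) * (1 - s (Y xi))))); [exact Hd|].
    change (/ dT (Y xi) * - (s (Y xi) * (1 - s (Y xi))) = - f (s (Y xi))).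
    unfold dT. destruct (Hf (s (Y xi)) (Hs (Y xi))) as [_ [H1 H2]]. specialize (Hs (Y xi)). field. lra.
  - apply is_lim_m_infty_iff. intros eta He. exists (T (ln eta)). intros xi Hxi.
    assert (Hy : Y xi < ln eta) by (apply Hinc; now rewrite HY1).
    apply exp_increasing in Hy. rewrite exp_ln in Hy by assumption.
    assert (Hb := Hs (Y xi)). rewrite Rabs_left by lra.
    pose proof (exp_pos (Y xi)).
    assert (E : s (Y xi) * (1 + exp (Y xi)) = 1) by (unfold s; field; lra). nra.
  - apply is_lim_p_infty_iff. intros eta He. exists (T (ln (/ eta))). intros xi Hxi.
    assert (Hy : ln (/ eta) < Y xi) by (apply Hinc; now rewrite HY1).
    apply exp_increasing in Hy. rewrite exp_ln in Hy by (now apply Rinv_0_lt_compat).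
    assert (Hb := Hs (Y xi)). rewrite Rabs_right by lra.
    assert (E : s (Y xi) * (1 + exp (Y xi)) = 1) by (unfold s; pose proof (exp_pos (Y xi)); field; lra).
    assert (E2 : s (Y xi) * / eta < 1) by nra.
    apply (Rmult_lt_compat_r eta) in E2; [|assumption].
    rewrite Rmult_assoc, Rinv_l in E2 by lra. lra.
Qed.

(** The travel time T with T' = - 1 / f increases at unit rate along every orbit and is strictly
    monotone in u, so an orbit is determined by T at one point. *)
Lemma decreasing_orbit_unique (f : R -> R) (U1 U2 : R -> R) :
  (forall u, 0 < u < 1 -> continuous f u /\ 0 < f u) ->
  (forall xi, 0 < U1 xi < 1 /\ is_derive U1 xi (- f (U1 xi))) ->
  (forall xi, 0 < U2 xi < 1 /\ is_derive U2 xi (- f (U2 xi))) ->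
  exists h, forall xi, U2 xi = U1 (xi + h).
Proof.
  intros Hf H1 H2.
  set (g := fun u => - / f u).
  assert (Hg : forall u, 0 < u < 1 -> continuous g u).
  { intros u Hu. destruct (Hf u Hu) as [Hc Hp].
    apply (continuous_opp (fun u => / f u)). apply (continuous_comp f Rinv); [assumption|].
    apply (ex_derive_continuous Rinv). auto_derive. lra. }
  assert (Hex : forall a b, 0 < a < 1 -> 0 < b < 1 -> ex_RInt g a b).
  { intros a b Ha Hb. apply (ex_RInt_continuous g). intros z Hz. apply Hg.
    split; [apply Rlt_le_trans with (Rmin a b); [apply Rmin_glb_lt|] |
            apply Rle_lt_trans with (Rmax a b); [|apply Rmax_lub_lt]]; lra. }
  set (T := RInt g (1 / 2)).
  assert (HT : forall u, 0 < u < 1 -> is_derive T u (g u)).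
  { intros u Hu. apply (is_derive_RInt g T (1 / 2) u); [|now apply Hg].
    assert (Hr : 0 < Rmin u (1 - u)) by (apply Rmin_glb_lt; lra).
    exists (mkposreal _ Hr). intros z Hz.
    change (Rabs (z - u) < Rmin u (1 - u)) in Hz. apply Rabs_def2 in Hz.
    assert (Rmin u (1 - u) <= u) by apply Rmin_l.
    assert (Rmin u (1 - u) <= 1 - u) by apply Rmin_r.
    apply (RInt_correct g). apply Hex; lra. }
  assert (Hinj : forall a b, 0 < a < 1 -> 0 < b < 1 -> a < b -> T b < T a).
  { intros a b Ha Hb Hab. destruct (mvt T g a b Hab) as [x [Hx E]].
    - intros; apply HT; lra.
    - intros; eapply continuous_of_derive; apply HT; lra.
    - assert (g x < 0).
      { unfold g. destruct (Hf x) as [_ Hp]; [lra|]. apply Rinv_0_lt_compat in Hp. lra. }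
      nra. }
  assert (Hlin : forall U, (forall xi, 0 < U xi < 1 /\ is_derive U xi (- f (U xi))) ->
             forall xi, T (U xi) = T (U 0) + xi).
  { intros U HU xi.
    assert (Hd : forall t, is_derive (fun t => T (U t) - t) t 0).
    { intros t. destruct (HU t) as [Hb Hd].
      assert (A := is_derive_comp T U t _ _ (HT (U t) Hb) Hd).
      replace 0 with (scal (- f (U t)) (g (U t)) - 1).
      - apply (is_derive_minus (fun t => T (U t)) (fun t => t)); [exact A | apply @is_derive_id].
      - change (- f (U t) * g (U t) - 1 = 0). unfold g. destruct (Hf (U t) Hb). assert (Er : forall v : R, v <> 0 -> - v * - / v - 1 = 0) by (intros; field; assumption). apply Er. lra. }
    assert (E : T (U xi) - xi = T (U 0) - 0).
    { destruct (MVT_gen (fun t => T (U t) - t) 0 xi (fun _ => 0)) as [z [_ E]].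
      - intros; apply Hd.
      - intros; eapply is_derive_continuity_pt; apply Hd.
      - lra. }
    lra. }
  (* T inverts both orbits up to a shift. *)
  exists (T (U2 0) - T (U1 0)). intros xi.
  assert (E : T (U2 xi) = T (U1 (xi + (T (U2 0) - T (U1 0))))).
  { rewrite (Hlin U2 H2 xi), (Hlin U1 H1).
    assert (Er : forall a b c : R, a + c = b + (c + (a - b))) by (intros; ring). apply Er. }
  destruct (H2 xi) as [Hb2 _]. destruct (H1 (xi + (T (U2 0) - T (U1 0)))) as [Hb1 _].
  destruct (Rtotal_order (U2 xi) (U1 (xi + (T (U2 0) - T (U1 0))))) as [H|[H|H]]; [|assumption|].
  - assert (A := Hinj _ _ Hb2 Hb1 H). lra.
  - assert (A := Hinj _ _ Hb1 Hb2 H). lra.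
Qed.

(* The defect [V + p (1 - U)] solves a linear equation with nonpositive coefficient,
   so its square decreases along the orbit, starting from 0 at minus infinity. *)
Lemma orbit_on_profile (k c : R) (p U V : R -> R) (b : R) :
  is_profile k c p ->
  (forall xi, xi < b -> 0 < U xi < 1 /\ is_derive U xi (V xi) /\
     is_derive V xi (- c * V xi + k * U xi * V xi - U xi * (1 - U xi))) ->
  is_lim U m_infty 1 -> is_lim V m_infty 0 ->
  forall xi, xi < b -> V xi = - p (1 - U xi).
Proof.
  intros Hp Ho HU HV.
  set (D := fun t => V t + p (1 - U t)).
  assert (HD : forall t, t < b -> is_derive D t (- (U t * (1 - U t) / p (1 - U t)) * D t)).
  { intros t Ht. destruct (Ho t Ht) as [Hb [H1 H2]].
    assert (Hx : 0 < 1 - U t < 1) by lra.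
    assert (Hpp := profile_pos k c p _ Hp Hx).
    assert (Hdx : is_derive (fun t => 1 - U t) t (0 - V t)).
    { apply (is_derive_minus (fun _ => 1) U t 0 (V t)); [exact (is_derive_const 1 t) | assumption]. }
    assert (Hdp := is_derive_comp p (fun t => 1 - U t) t _ _ (profile_derive k c p _ Hp Hx) Hdx).
    replace (- (U t * (1 - U t) / p (1 - U t)) * D t)
      with (plus (- c * V t + k * U t * V t - U t * (1 - U t))
                 (scal (0 - V t) (profile_rhs k c (1 - U t) (p (1 - U t))))).
    - apply (is_derive_plus V (fun t => p (1 - U t))); assumption.
    - change (- c * V t + k * U t * V t - U t * (1 - U t)
                + (0 - V t) * profile_rhs k c (1 - U t) (p (1 - U t))
              = - (U t * (1 - U t) / p (1 - U t)) * D t).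
      unfold profile_rhs, D. field. lra. }
  assert (Hsq : forall s t, s <= t -> t < b -> D t ^ 2 <= D s ^ 2).
  { intros s t Hst Htb.
    apply (nonincreasing_of_derive (fun t => D t ^ 2)
             (fun t => 2 * (- (U t * (1 - U t) / p (1 - U t)) * D t) * D t) s t Hst).
    - intros y Hy. assert (A := is_derive_pow D 2 y _ (HD y ltac:(lra))). simpl in A.
      replace (2 * (- (U y * (1 - U y) / p (1 - U y)) * D y) * D y)
        with ((1 + 1) * (- (U y * (1 - U y) / p (1 - U y)) * D y) * (D y * 1)) by ring. exact A.
    - intros y Hy. eapply continuous_of_derive.
      exact (is_derive_pow D 2 y _ (HD y ltac:(lra))).
    - intros y Hy. destruct (Ho y ltac:(lra)) as [Hb _].
      assert (Hpp := profile_pos k c p (1 - U y) Hp ltac:(lra)).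
      assert (0 <= U y * (1 - U y) / p (1 - U y)) by (apply Rdiv_le_0_compat; nra). nra. }
  (* The linear bound p x <= m x turns U -> 1 into p (1 - U) -> 0. *)
  assert (HD0 : forall eta, 0 < eta -> exists M, forall t, t < M -> t < b -> Rabs (D t) < eta).
  { intros eta He. destruct Hp as [Hp [m Hm]].
    assert (HM : 0 < Rabs m + 1) by (pose proof (Rabs_pos m); lra).
    rewrite is_lim_m_infty_iff in HU, HV.
    destruct (HV (eta / 2)) as [M1 H1]; [lra|].
    destruct (HU (eta / 2 / (Rabs m + 1))) as [M2 H2]; [apply Rdiv_lt_0_compat; lra|].
    exists (Rmin M1 M2). intros t Ht Htb.
    assert (t < M1) by (eapply Rlt_le_trans; [exact Ht | apply Rmin_l]).
    assert (t < M2) by (eapply Rlt_le_trans; [exact Ht | apply Rmin_r]).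
    specialize (H1 t H). specialize (H2 t H0). rewrite Rminus_0_r in H1.
    destruct (Ho t Htb) as [Hb _]. unfold D.
    eapply Rle_lt_trans; [apply Rabs_triang|].
    assert (Hpb : 0 < p (1 - U t) <= m * (1 - U t)) by (split; [apply Hp | apply Hm]; lra).
    rewrite (Rabs_right (p (1 - U t))) by lra.
    rewrite Rabs_left in H2 by lra.
    assert ((Rabs m + 1) * (1 - U t) < eta / 2).
    { apply Rlt_le_trans with ((Rabs m + 1) * (eta / 2 / (Rabs m + 1))).
      - apply Rmult_lt_compat_l; lra.
      - right; field; lra. }
    assert (m * (1 - U t) <= (Rabs m + 1) * (1 - U t)).
    { apply Rmult_le_compat_r; [lra|]. pose proof (Rle_abs m). lra. }
    lra. }
  intros xi Hxi. assert (D xi = 0); [|unfold D in *; lra].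
  destruct (Req_dec (D xi) 0) as [|Hne]; [assumption|exfalso].
  destruct (HD0 (Rabs (D xi))) as [M HM]; [now apply Rabs_pos_lt|].
  set (t := Rmin xi (M - 1)).
  assert (t <= xi) by apply Rmin_l. assert (t <= M - 1) by apply Rmin_r.
  assert (A := HM t ltac:(lra) ltac:(lra)). assert (B := Hsq t xi ltac:(lra) Hxi).
  apply Rsqr_lt_abs_1 in A. unfold Rsqr in A. nra.
Qed.

(** * Travelling waves of the equation *)

Definition wave_rhs (k eps c u v : R) : R :=
  - c * v + k * u * v * Heaviside (u - eps) - u * (1 - u) * Heaviside (u - eps).

(** The travelling-wave system in the regularity that [solves_pde] provides: the slope exists and is
    continuous even where U = eps, and only the second derivative is confined to U different from
    eps. *)
Definition wave_profile (k eps c : R) (U V : R -> R) : Prop :=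
  (forall xi, is_derive U xi (V xi)) /\ (forall xi, continuous V xi) /\
  (forall xi, U xi <> eps -> is_derive V xi (wave_rhs k eps c (U xi) (V xi))).

Lemma is_derive_shift (f : R -> R) (a x l : R) :
  is_derive f (x + a) l -> is_derive (fun y => f (y + a)) x l.
Proof.
  intros H. assert (Hs : is_derive (fun y : R => y + a) x (1 + 0)).
  { apply (is_derive_plus (fun y => y) (fun _ => a) x 1 0).
    - exact (is_derive_id x).
    - exact (is_derive_const a x). }
  assert (A := is_derive_comp f (fun y => y + a) x _ _ H Hs).
  replace l with (scal (1 + 0) l); [exact A|].
  change ((1 + 0) * l = l). ring.
Qed.

Lemma is_derive_in_time (f : R -> R) (x c t l : R) :
  is_derive f (x - c * t) l -> is_derive (fun s => f (x - c * s)) t (- c * l).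
Proof.
  intros H. assert (Hs : is_derive (fun s => x - c * s) t (- c)).
  { auto_derive; [trivial | ring]. }
  exact (is_derive_comp f (fun s => x - c * s) t _ _ H Hs).
Qed.

Lemma wave_solves_pde k eps c U V :
  wave_profile k eps c U V -> solves_pde k eps (fun x t => U (x - c * t)).
Proof.
  intros [HU [HVc HV]].
  assert (Hx : forall t x, is_derive (fun y => U (y - c * t)) x (V (x - c * t))).
  { intros t x. apply (is_derive_shift U (- (c * t))). apply HU. }
  assert (HxD : forall t x, Derive (fun y => U (y - c * t)) x = V (x - c * t)).
  { intros t x. apply is_derive_unique. apply Hx. }
  split.
  - intros x t _. split; [eexists; apply Hx|].
    apply (continuous_ext (fun x => V (x - c * t))); [intros y; symmetry; apply HxD|].
    apply (continuous_comp (fun x => x - c * t) V); [|apply HVc].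
    smooth.
  - intros x t _ Hne.
    assert (Ht : is_derive (fun s => U (x - c * s)) t (- c * V (x - c * t))).
    { apply is_derive_in_time. apply HU. }
    assert (Hxx : is_derive (Derive (fun y => U (y - c * t))) x
                    (wave_rhs k eps c (U (x - c * t)) (V (x - c * t)))).
    { apply (is_derive_ext (fun x => V (x - c * t))); [intros y; symmetry; apply HxD|].
      apply (is_derive_shift V (- (c * t))). now apply HV. }
    split; [eexists; exact Ht|]. split; [eexists; exact Hxx|].
    assert (Et : Derive (fun s : R => U (x - c * s)) t = - c * V (x - c * t))
      by (apply is_derive_unique; exact Ht).
    assert (Exx : Derive (Derive (fun y : R => U (y - c * t))) x
                  = wave_rhs k eps c (U (x - c * t)) (V (x - c * t)))
      by (apply is_derive_unique; exact Hxx).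
    cbv beta. rewrite Et, Exx, HxD.
    unfold wave_rhs. ring.
Qed.

(** Regularity in space is available from t = 0 on, where u equals U. The equation itself holds only
    for t > 0, so it is read off at t = 1 and shifted back by c. *)
Lemma pde_gives_wave_profile k eps c u U :
  solves_pde k eps u -> travelling_wave c U u -> wave_profile k eps c U (Derive U).
Proof.
  intros [H1 H2] Hw.
  assert (E0 : forall y, u y 0 = U y).
  { intros y. rewrite (Hw y 0 (Rle_refl 0)). f_equal. ring. }
  assert (HD0 : forall y, Derive (fun y => u y 0) y = Derive U y).
  { intros y. apply Derive_ext. exact E0. }
  assert (HU : forall xi, is_derive U xi (Derive U xi)).
  { intros xi. apply Derive_correct. destruct (H1 xi 0 (Rle_refl 0)) as [A _].
    apply (ex_derive_ext (fun y => u y 0)); [exact E0 | exact A]. }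
  split; [exact HU|]. split.
  - intros xi. destruct (H1 xi 0 (Rle_refl 0)) as [_ A].
    apply (continuous_ext (Derive (fun y => u y 0))); [exact HD0 | exact A].
  - intros xi Hne. set (x := xi + c * 1).
    assert (Ex : x - c * 1 = xi) by (unfold x; ring).
    assert (E1 : forall y, u y 1 = U (y + - (c * 1))).
    { intros y. apply Hw. lra. }
    destruct (H2 x 1 Rlt_0_1) as [A1 [A2 A3]].
    { rewrite E1. unfold Rminus in Ex. now rewrite Ex. }
    assert (Hx : forall y, Derive (fun y => u y 1) y = Derive U (y + - (c * 1))).
    { intros y. apply is_derive_unique.
      apply (is_derive_ext (fun y => U (y + - (c * 1)))); [intros; symmetry; apply E1|].
      apply is_derive_shift. apply HU. }
    assert (Ht : is_derive (fun s => u x s) 1 (- c * Derive U xi)).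
    { apply (is_derive_ext_loc (fun s => U (x - c * s))).
      - exists (mkposreal 1 Rlt_0_1). intros s Hs. symmetry. apply Hw.
        change (Rabs (s - 1) < 1) in Hs. apply Rabs_def2 in Hs. lra.
      - apply is_derive_in_time. rewrite Ex. apply HU. }
    assert (Hxx : is_derive (Derive U) xi (Derive (Derive (fun y => u y 1)) x)).
    { apply Derive_correct in A2.
      apply (is_derive_ext (fun y => Derive (fun z => u z 1) (y + c * 1))).
      - intros y. rewrite Hx. f_equal. ring.
      - apply is_derive_shift. exact A2. }
    assert (Et : Derive (fun s : R => u x s) 1 = - c * Derive U xi)
      by (apply is_derive_unique; exact Ht).
    rewrite Et, Hx, E1 in A3.
    unfold Rminus in Ex. rewrite Ex in A3.
    replace (wave_rhs k eps c (U xi) (Derive U xi)) with (Derive (Derive (fun y => u y 1)) x);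
      [exact Hxx|].
    unfold wave_rhs. lra.
Qed.

(* The vector field of the orbit, including the half-line V = - c U below the cut-off. *)
Definition cutoff_field (k eps c u : R) : R :=
  if Rle_dec eps u then profile k c (1 - u) else c * u.

Lemma cutoff_field_above k eps c u : eps <= u -> cutoff_field k eps c u = profile k c (1 - u).
Proof. intros H. unfold cutoff_field. destruct (Rle_dec eps u); [reflexivity | lra]. Qed.

Lemma cutoff_field_below k eps c u : u < eps -> cutoff_field k eps c u = c * u.
Proof. intros H. unfold cutoff_field. destruct (Rle_dec eps u); [lra | reflexivity]. Qed.

Lemma profile_reflect_derive k c u : 0 < k -> 0 < u < 1 ->
  is_derive (fun u => profile k c (1 - u)) u (- profile_rhs k c (1 - u) (profile k c (1 - u))).
Proof.
  intros hk Hu.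
  assert (Hs : is_derive (fun u => 1 - u) u (- 1)) by (auto_derive; [trivial | ring]).
  assert (Hx : 0 < 1 - u < 1) by lra.
  assert (A := is_derive_comp (profile k c) (fun u => 1 - u) u _ _
                 (profile_derive k c _ _ (profile_spec k c hk) Hx) Hs).
  replace (- profile_rhs k c (1 - u) (profile k c (1 - u)))
    with (scal (- 1) (profile_rhs k c (1 - u) (profile k c (1 - u)))); [exact A|].
  change (- 1 * profile_rhs k c (1 - u) (profile k c (1 - u))
          = - profile_rhs k c (1 - u) (profile k c (1 - u))). ring.
Qed.

Lemma near_lt (a b : R) : a < b -> exists d : posreal, forall z, Rabs (z - a) < d -> z < b.
Proof.
  intros H. assert (Hd : 0 < b - a) by lra. exists (mkposreal _ Hd).
  intros z Hz. simpl in Hz. apply Rabs_def2 in Hz. lra.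
Qed.

Lemma near_gt (a b : R) : b < a -> exists d : posreal, forall z, Rabs (z - a) < d -> b < z.
Proof.
  intros H. assert (Hd : 0 < a - b) by lra. exists (mkposreal _ Hd).
  intros z Hz. simpl in Hz. apply Rabs_def2 in Hz. lra.
Qed.

Lemma cutoff_field_derive k eps c u : 0 < k -> 0 < u < 1 -> u <> eps ->
  is_derive (cutoff_field k eps c) u
    (if Rle_dec eps u then - profile_rhs k c (1 - u) (profile k c (1 - u)) else c).
Proof.
  intros hk Hu Hne. destruct (Rle_dec eps u) as [H|H].
  - apply (is_derive_ext_loc (fun u => profile k c (1 - u))); [|now apply profile_reflect_derive].
    destruct (near_gt u eps) as [d Hd]; [lra|]. exists d. intros z Hz.
    symmetry. apply cutoff_field_above. left. now apply Hd.
  - apply (is_derive_ext_loc (fun u => c * u)); [|auto_derive; [trivial | ring]].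
    destruct (near_lt u eps) as [d Hd]; [lra|]. exists d. intros z Hz.
    symmetry. apply cutoff_field_below. now apply Hd.
Qed.

Lemma cutoff_field_continuous k eps c u : 0 < k -> 0 < u < 1 ->
  (0 < eps -> profile k c (1 - eps) = c * eps) -> continuous (cutoff_field k eps c) u.
Proof.
  intros hk Hu Hm.
  destruct (Req_dec u eps) as [->|Hne].
  - assert (C1 : continuous (fun u => profile k c (1 - u)) eps).
    { eapply continuous_of_derive. now apply profile_reflect_derive. }
    apply continuous_of_eps. intros eta He.
    destruct (continuous_eps _ _ C1 eta He) as [d1 [Hd1 H1]].
    assert (C2 : continuous (fun u => c * u) eps).
    { smooth. }
    destruct (continuous_eps _ _ C2 eta He) as [d2 [Hd2 H2]].
    exists (Rmin d1 d2). split; [now apply Rmin_glb_lt|].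
    intros y Hy. rewrite (cutoff_field_above k eps c eps) by lra.
    destruct (Rle_lt_dec eps y).
    + rewrite cutoff_field_above by assumption. apply H1.
      eapply Rlt_le_trans; [exact Hy | apply Rmin_l].
    + rewrite cutoff_field_below by assumption. rewrite Hm by lra. apply H2.
      eapply Rlt_le_trans; [exact Hy | apply Rmin_r].
  - eapply continuous_of_derive. now apply cutoff_field_derive.
Qed.

Lemma cutoff_field_wave k eps c U : 0 < k ->
  (0 < eps -> profile k c (1 - eps) = c * eps) ->
  (forall xi, 0 < U xi < 1 /\ is_derive U xi (- cutoff_field k eps c (U xi))) ->
  wave_profile k eps c U (fun xi => - cutoff_field k eps c (U xi)).
Proof.
  intros hk Hm HU. split; [apply HU|]. split.
  - intros xi. apply (continuous_opp (fun xi => cutoff_field k eps c (U xi))).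
    apply (continuous_comp U (cutoff_field k eps c)).
    + eapply continuous_of_derive. apply HU.
    + apply cutoff_field_continuous; auto. apply HU.
  - intros xi Hne. destruct (HU xi) as [Hb Hd].
    assert (A := is_derive_comp _ U xi _ _ (cutoff_field_derive k eps c (U xi) hk Hb Hne) Hd).
    apply (is_derive_opp (fun xi => cutoff_field k eps c (U xi))) in A.
    eapply eq_rect; [exact A|].
    change (- (- cutoff_field k eps c (U xi)
               * (if Rle_dec eps (U xi)
                  then - profile_rhs k c (1 - U xi) (profile k c (1 - U xi)) else c))
            = wave_rhs k eps c (U xi) (- cutoff_field k eps c (U xi))).
    unfold wave_rhs, Heaviside. destruct (Rle_dec eps (U xi)), (Rlt_dec 0 (U xi - eps)); try lra.
    + rewrite cutoff_field_above by assumption. unfold profile_rhs.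
      assert (0 < profile k c (1 - U xi)).
      { apply (profile_pos k c); [now apply profile_spec | lra]. }
      field. lra.
Qed.

(** * Fronts without cut-off *)

Lemma gronwall_forward (N dN : R -> R) (K a b : R) :
  a <= b -> (forall x, a < x < b -> is_derive N x (dN x)) ->
  (forall x, a <= x <= b -> continuous N x) ->
  (forall x, a < x < b -> dN x <= K * N x) -> N b <= N a * exp (K * (b - a)).
Proof.
  intros Hab Hd Hc Hn.
  assert (H : N b * exp (- K * b) <= N a * exp (- K * a)).
  { apply (nonincreasing_of_derive (fun x => N x * exp (- K * x))
             (fun x => dN x * exp (- K * x) + N x * (- K * exp (- K * x))) a b Hab).
    - intros x Hx. apply (is_derive_mult N (fun x => exp (- K * x))); [now apply Hd| |].
      + auto_derive; [trivial | ring].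
      + intros u v. apply Rmult_comm.
    - intros x Hx. apply (continuous_mult N (fun x => exp (- K * x))); [now apply Hc|].
      smooth.
    - intros x Hx. specialize (Hn x Hx). pose proof (exp_pos (- K * x)). nra. }
  apply Rmult_le_reg_r with (exp (- K * b)); [apply exp_pos|].
  rewrite Rmult_assoc, <- exp_plus. now replace (K * (b - a) + - K * b) with (- K * a) by ring.
Qed.

Lemma gronwall_backward (N dN : R -> R) (K a b : R) :
  a <= b -> (forall x, a < x < b -> is_derive N x (dN x)) ->
  (forall x, a <= x <= b -> continuous N x) ->
  (forall x, a < x < b -> - K * N x <= dN x) -> N a <= N b * exp (K * (b - a)).
Proof.
  intros Hab Hd Hc Hn.
  assert (H := gronwall_forward (fun x => N (- x)) (fun x => - dN (- x)) K (- b) (- a)).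
  cbv beta in H. rewrite !Ropp_involutive in H.
  replace (- a - - b) with (b - a) in H by ring. apply H.
  - lra.
  - intros x Hx. assert (Ho : is_derive (fun x : R => - x) x (- 1)) by (auto_derive; [trivial | ring]).
    assert (A := is_derive_comp N (fun x => - x) x _ _ (Hd (- x) ltac:(lra)) Ho).
    replace (- dN (- x)) with (scal (- 1) (dN (- x))); [exact A|].
    change (- 1 * dN (- x) = - dN (- x)). ring.
  - intros x Hx. apply (continuous_comp (fun x => - x) N); [|apply Hc; lra].
    apply (continuous_opp (fun x : R => x)). apply continuous_id.
  - intros x Hx. specialize (Hn (- x) ltac:(lra)). lra.
Qed.

Lemma is_derive_pos_right (f : R -> R) (x l : R) :
  is_derive f x l -> 0 < l -> exists d, 0 < d /\ forall h, 0 < h < d -> f x < f (x + h).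
Proof.
  intros H Hl. apply is_derive_Reals in H. destruct (H l Hl) as [d Hd].
  exists d. split; [apply cond_pos|]. intros h Hh.
  specialize (Hd h ltac:(lra)). rewrite Rabs_right in Hd by lra.
  specialize (Hd ltac:(lra)). apply Rabs_def2 in Hd.
  assert (0 < (f (x + h) - f x) / h) by lra.
  apply Rmult_lt_compat_r with (r := h) in H0; [|lra].
  unfold Rdiv in H0. rewrite Rmult_assoc, Rinv_l in H0 by lra. lra.
Qed.

Lemma is_derive_max (f : R -> R) (x l : R) :
  is_derive f x l -> (forall y, f y <= f x) -> l = 0.
Proof.
  intros H Hm. destruct (Rtotal_order l 0) as [Hl|[Hl|Hl]]; [exfalso|assumption|exfalso].
  - assert (Hr : is_derive (fun y => f (- y)) (- x) (- l)).
    { assert (Ho : is_derive (fun x : R => - x) (- x) (- 1)) by (auto_derive; [trivial | ring]).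
      rewrite <- (Ropp_involutive x) in H.
      assert (A := is_derive_comp f (fun x => - x) (- x) _ _ H Ho).
      replace (- l) with (scal (- 1) l); [exact A|]. change (- 1 * l = - l). ring. }
    destruct (is_derive_pos_right _ _ _ Hr) as [d [Hd H']]; [lra|].
    specialize (H' (d / 2) ltac:(lra)). rewrite Ropp_involutive in H'.
    specialize (Hm (- (- x + d / 2))). lra.
  - destruct (is_derive_pos_right _ _ _ H Hl) as [d [Hd H']].
    specialize (H' (d / 2) ltac:(lra)). specialize (Hm (x + d / 2)). lra.
Qed.

Lemma Rabs_mult_le_sq a b : 2 * Rabs (a * b) <= a ^ 2 + b ^ 2.
Proof.
  unfold Rabs. destruct (Rcase_abs (a * b)).
  - pose proof (pow2_ge_0 (a + b)). nra.
  - pose proof (pow2_ge_0 (a - b)). nra.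
Qed.

Lemma le_mult_bound r K m : Rabs r <= K -> 0 <= m -> - (K * m) <= r * m <= K * m.
Proof.
  intros H Hm. pose proof (Rle_abs r). pose proof (Rle_abs (- r)). rewrite Rabs_Ropp in *.
  split; nra.
Qed.

Section NoCutoff.
Variables (k c : R) (U V : R -> R).
Hypothesis hk : 0 < k.
Hypothesis HW : wave_profile k 0 c U V.
Hypothesis Hm : is_lim U m_infty 1.
Hypothesis Hp : is_lim U p_infty 0.

Lemma front_derive xi : is_derive U xi (V xi).
Proof. apply HW. Qed.

Lemma front_continuous xi : continuous U xi.
Proof. eapply continuous_of_derive. apply front_derive. Qed.

Lemma front_far_left b : exists a, a < b /\ 1 / 2 < U a.
Proof.
  assert (Hm' := proj1 (is_lim_m_infty_iff U 1) Hm). destruct (Hm' (1 / 2)) as [M HM]; [lra|].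
  exists (Rmin b M - 1). assert (Rmin b M <= b) by apply Rmin_l. assert (Rmin b M <= M) by apply Rmin_r.
  split; [lra|]. specialize (HM (Rmin b M - 1) ltac:(lra)). apply Rabs_def2 in HM. lra.
Qed.

(* Below 0 the quantity [V exp (c xi)] is conserved, so a front crossing 0 would never return. *)
Lemma front_nonneg xi : 0 <= U xi.
Proof.
  destruct (Rle_lt_dec 0 (U xi)) as [|Hneg]; [assumption|exfalso].
  destruct (front_far_left xi) as [a [Ha HUa]].
  destruct (last_crossing (fun x => - U x) a xi 0) as [al [Hal [E Hgt]]]; try lra.
  { intros x _. apply (continuous_opp U). apply front_continuous. }
  destruct (mvt_open U V al xi) as [eta [Heta Em]]; [lra| | |].
  { intros; apply front_derive. }
  { intros; apply front_continuous. }
  assert (HVe : V eta < 0).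
  { assert (U al = 0) by lra. assert (V eta * (xi - al) < 0) by lra. nra. }
  assert (HUe : U eta < 0) by (specialize (Hgt eta ltac:(lra)); lra).
  (* While U < 0 the slope keeps the sign it has at [eta], so U decreases and cannot climb back to
     half of its value there. *)
  assert (Hstay : forall z, eta < z -> U z < U eta / 2).
  { intros z Hz. destruct (Rlt_le_dec (U z) (U eta / 2)) as [|Hge]; [assumption|exfalso].
    destruct (first_crossing U eta z (U eta / 2)) as [be [Hbe [E2 Hlt]]]; try lra.
    { intros; apply front_continuous. }
    assert (Hcons : forall y, eta <= y <= be -> V y * exp (c * y) = V eta * exp (c * eta)).
    { intros y Hy. destruct (Req_dec eta y) as [->|Hne]; [reflexivity|].
      destruct (mvt_open (fun y => V y * exp (c * y)) (fun _ => 0) eta y) as [w [_ Ew]]; [lra| | |lra].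
      - intros w Hw. assert (HUw : U w < 0) by (specialize (Hlt w ltac:(lra)); lra).
        assert (HVw : is_derive V w (wave_rhs k 0 c (U w) (V w))) by (apply HW; lra).
        assert (Hexp : is_derive (fun y => exp (c * y)) w (c * exp (c * w)))
          by (auto_derive; [trivial | ring]).
        assert (A := is_derive_mult V (fun y => exp (c * y)) w _ _ HVw Hexp Rmult_comm).
        replace 0 with (plus (mult (wave_rhs k 0 c (U w) (V w)) (exp (c * w)))
                             (mult (V w) (c * exp (c * w)))); [exact A|].
        change (wave_rhs k 0 c (U w) (V w) * exp (c * w) + V w * (c * exp (c * w)) = 0).
        unfold wave_rhs, Heaviside. destruct (Rlt_dec 0 (U w - 0)); [lra|]. ring.
      - intros w _. apply (continuous_mult V (fun y => exp (c * y))); [apply HW|].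
        smooth. }
    assert (U be <= U eta); [|lra].
    apply (nonincreasing_of_derive U V eta be); [lra| | |].
    - intros; apply front_derive.
    - intros; apply front_continuous.
    - intros y Hy. specialize (Hcons y ltac:(lra)).
      pose proof (exp_pos (c * y)). pose proof (exp_pos (c * eta)). nra. }
  assert (Hp' := proj1 (is_lim_p_infty_iff U 0) Hp). destruct (Hp' (- U eta / 2)) as [M HM]; [lra|].
  assert (Rmax eta M >= eta) by (apply Rle_ge, Rmax_l).
  assert (Rmax eta M >= M) by (apply Rle_ge, Rmax_r).
  specialize (HM (Rmax eta M + 1) ltac:(lra)). specialize (Hstay (Rmax eta M + 1) ltac:(lra)).
  apply Rabs_def2 in HM. lra.
Qed.

Lemma front_bounded_on a b : a <= b -> exists B, 0 < B /\ forall x, a <= x <= b -> U x <= B.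
Proof.
  intros Hab. destruct (continuity_ab_maj U a b Hab) as [m [HM _]].
  { intros x _. apply continuity_pt_filterlim. apply front_continuous. }
  exists (U m + 1). split; [pose proof (front_nonneg m); lra|].
  intros x Hx. specialize (HM x Hx). lra.
Qed.

Lemma front_rhs_pos xi : 0 < U xi ->
  is_derive V xi (- c * V xi + k * U xi * V xi - U xi * (1 - U xi)).
Proof.
  intros H. assert (A : is_derive V xi (wave_rhs k 0 c (U xi) (V xi))) by (apply HW; lra).
  unfold wave_rhs, Heaviside in A. destruct (Rlt_dec 0 (U xi - 0)); [|lra].
  now rewrite !Rmult_1_r in A.
Qed.

Lemma is_derive_sq (f : R -> R) (x l : R) : is_derive f x l -> is_derive (fun y => f y ^ 2) x (2 * f x * l).
Proof.
  intros H. assert (A := is_derive_pow f 2 x l H). simpl in A.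
  replace (2 * f x * l) with ((1 + 1) * l * (f x * 1)) by ring. exact A.
Qed.

(** At a zero U has a minimum, so V vanishes too. Before the first zero the full equation holds, and
    backward Gronwall for U^2 + V^2 would force this quantity to vanish earlier as well, although U
    exceeds 1/2 far to the left. *)
Lemma front_pos xi : 0 < U xi.
Proof.
  destruct (front_nonneg xi) as [|E]; [assumption|exfalso]. symmetry in E.
  destruct (front_far_left xi) as [a [Ha HUa]].
  destruct (first_crossing (fun x => - U x) a xi 0) as [b [Hb [Eb Hlt]]]; try lra.
  { intros x _. apply (continuous_opp U). apply front_continuous. }
  assert (HVb : V b = 0).
  { assert (Hd : is_derive (fun x => - U x) b (- V b)) by (apply (is_derive_opp U); apply front_derive).
    apply is_derive_max in Hd; [lra|]. intros y. pose proof (front_nonneg y). lra. }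
  destruct (front_bounded_on a b) as [B [HB HUB]]; [lra|].
  set (N := fun x => U x ^ 2 + V x ^ 2).
  set (K := B + 2 * (k * B + Rabs c)).
  assert (A : N a <= N b * exp (K * (b - a))).
  { apply (gronwall_backward N (fun x => 2 * U x * V x
            + 2 * V x * (- c * V x + k * U x * V x - U x * (1 - U x))) K a b); [lra| | |].
    - intros x Hx. apply (is_derive_plus (fun x => U x ^ 2) (fun x => V x ^ 2)).
      + apply is_derive_sq. apply front_derive.
      + apply is_derive_sq. apply front_rhs_pos. specialize (Hlt x ltac:(lra)). lra.
    - intros x Hx. unfold N.
      apply (continuous_plus (fun x => U x ^ 2) (fun x => V x ^ 2)).
      + apply (continuous_comp U (fun y => y ^ 2)); [apply front_continuous|].
        smooth.
      + apply (continuous_comp V (fun y => y ^ 2)); [apply HW|].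
        smooth.
    - intros x Hx. specialize (HUB x ltac:(lra)). specialize (Hlt x ltac:(lra)).
      replace (2 * U x * V x + 2 * V x * (- c * V x + k * U x * V x - U x * (1 - U x)))
        with (U x * (2 * (U x * V x)) + 2 * (k * U x - c) * V x ^ 2) by ring.
      assert (M1 := Rabs_mult_le_sq (U x) (V x)).
      assert (M2 := Rle_abs (- (U x * V x))). rewrite Rabs_Ropp in M2.
      assert (M3 : - (B * N x) <= U x * (2 * (U x * V x))).
      { unfold N. assert (- (U x ^ 2 + V x ^ 2) <= 2 * (U x * V x)) by lra.
        pose proof (pow2_ge_0 (U x)). pose proof (pow2_ge_0 (V x)). nra. }
      assert (M4 : - ((k * B + Rabs c) * V x ^ 2) <= (k * U x - c) * V x ^ 2).
      { apply le_mult_bound; [|apply pow2_ge_0].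
        unfold Rminus. eapply Rle_trans; [apply Rabs_triang|]. rewrite Rabs_Ropp.
        apply Rplus_le_compat_r. rewrite Rabs_right by nra. nra. }
      assert (M5 : V x ^ 2 <= N x) by (unfold N; pose proof (pow2_ge_0 (U x)); lra).
      assert (0 <= k * B + Rabs c) by (pose proof (Rabs_pos c); nra).
      unfold K. nra. }
  assert (EN : N b = 0) by (unfold N; rewrite HVb; replace (U b) with 0 by lra; ring).
  rewrite EN, Rmult_0_l in A. unfold N in A. pose proof (pow2_ge_0 (V a)). nra.
Qed.

(** Convergence of U gives a point with small slope in every unit interval far to the left, and
    Gronwall carries the smallness over the rest of that interval. *)
Lemma front_slope_left : is_lim V m_infty 0.
Proof.
  apply is_lim_m_infty_iff. intros eta He.
  set (K := 4 * k + 2 * Rabs c + 1).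
  assert (HK : 1 <= K) by (unfold K; pose proof (Rabs_pos c); lra).
  set (d := Rmin 1 (eta / (4 * exp K))).
  pose proof (exp_pos K) as HeK.
  assert (Hd : 0 < d) by (apply Rmin_glb_lt; [lra | apply Rdiv_lt_0_compat; lra]).
  assert (Hd1 : d <= 1) by apply Rmin_l.
  assert (Hd2 : d * (4 * exp K) <= eta).
  { assert (d <= eta / (4 * exp K)) by apply Rmin_r.
    apply Rmult_le_compat_r with (r := 4 * exp K) in H; [|lra].
    replace (eta / (4 * exp K) * (4 * exp K)) with eta in H by (field; lra). exact H. }
  assert (Hm' := proj1 (is_lim_m_infty_iff U 1) Hm). destruct (Hm' d Hd) as [M HM].
  exists M. intros xi Hxi. rewrite Rminus_0_r.
  destruct (mvt_open U V (xi - 1) xi) as [z [Hz Ez]]; [lra| | |].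
  { intros; apply front_derive. }
  { intros; apply front_continuous. }
  replace (V z * (xi - (xi - 1))) with (V z) in Ez by ring.
  assert (HVz : Rabs (V z) <= 2 * d).
  { rewrite <- Ez. assert (A := HM xi Hxi). assert (B := HM (xi - 1) ltac:(lra)).
    apply Rabs_def2 in A. apply Rabs_def2 in B. apply Rabs_le. lra. }
  (* The forcing U (1 - U) is at most 2 d in absolute value; the added constant absorbs its square
     and makes the inequality homogeneous. *)
  set (S := fun x => V x ^ 2 + 4 * d ^ 2).
  assert (A : S xi <= S z * exp (K * (xi - z))).
  { apply (gronwall_forward S (fun x => 2 * V x * (- c * V x + k * U x * V x - U x * (1 - U x)) + 0) K z xi); [lra| | |].
    - intros x _. apply (is_derive_plus (fun x => V x ^ 2) (fun _ => 4 * d ^ 2)).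
      + apply is_derive_sq. apply front_rhs_pos. apply front_pos.
      + exact (is_derive_const (4 * d ^ 2) x).
    - intros x _. apply (continuous_plus (fun x => V x ^ 2) (fun _ => 4 * d ^ 2)); [|apply continuous_const].
      apply (continuous_comp V (fun y => y ^ 2)); [apply HW|].
      smooth.
    - intros x Hx. assert (B := HM x ltac:(lra)). apply Rabs_def2 in B.
      pose proof (front_pos x).
      assert (M4 : (k * U x - c) * V x ^ 2 <= (2 * k + Rabs c) * V x ^ 2).
      { apply le_mult_bound; [|apply pow2_ge_0].
        unfold Rminus. eapply Rle_trans; [apply Rabs_triang|]. rewrite Rabs_Ropp.
        apply Rplus_le_compat_r. rewrite Rabs_right by nra. nra. }
      set (g := U x * (1 - U x)).
      assert (Hg : g ^ 2 <= 4 * d ^ 2).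
      { replace (4 * d ^ 2) with ((2 * d) ^ 2) by ring. rewrite <- (pow2_abs g).
        apply pow_incr. split; [apply Rabs_pos|]. unfold g. rewrite Rabs_mult.
        rewrite (Rabs_right (U x)) by lra.
        assert (Rabs (1 - U x) <= d) by (apply Rabs_le; lra).
        pose proof (Rabs_pos (1 - U x)). nra. }
      assert (M1 := Rabs_mult_le_sq (V x) g).
      assert (M2 := Rle_abs (- (V x * g))). rewrite Rabs_Ropp in M2.
      assert (0 <= d ^ 2) by apply pow2_ge_0.
      replace (2 * V x * (- c * V x + k * U x * V x - U x * (1 - U x)) + 0)
        with (2 * ((k * U x - c) * V x ^ 2) + 2 * (- (V x * g))) by (unfold g; ring).
      assert (M6 : 1 * (4 * d ^ 2) <= K * (4 * d ^ 2)) by (apply Rmult_le_compat_r; lra).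
      unfold S. rewrite Rmult_plus_distr_l.
      assert (M7 : K * V x ^ 2 = 2 * ((2 * k + Rabs c) * V x ^ 2) + V x ^ 2) by (unfold K; ring).
      lra. }
  assert (HSz : S z <= 8 * d ^ 2).
  { unfold S. rewrite <- (pow2_abs (V z)). pose proof (Rabs_pos (V z)). nra. }
  assert (HSz0 : 0 <= S z) by (unfold S; pose proof (pow2_ge_0 (V z)); pose proof (pow2_ge_0 d); lra).
  assert (Hexp : exp (K * (xi - z)) <= exp K).
  { destruct (Req_dec (K * (xi - z)) K) as [->|Hne]; [lra|]. left. apply exp_increasing. nra. }
  assert (HS : S xi <= 8 * d ^ 2 * exp K).
  { eapply Rle_trans; [exact A|]. apply Rmult_le_compat; auto. left. apply exp_pos. }
  assert (Hexp1 : 1 <= exp K) by (pose proof (exp_ineq1_le K); lra).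
  assert (HVxi : V xi ^ 2 < eta ^ 2).
  { assert (0 < d ^ 2) by (apply pow_lt; lra).
    assert (E1 : (d * (4 * exp K)) ^ 2 <= eta ^ 2) by (apply pow_incr; split; [nra|lra]).
    unfold S in HS.
    assert (E2 : 8 * d ^ 2 * exp K <= (d * (4 * exp K)) ^ 2).
    { replace ((d * (4 * exp K)) ^ 2) with (16 * d ^ 2 * exp K * exp K) by ring. nra. }
    lra. }
  rewrite <- (Rabs_right eta) by lra. apply Rsqr_lt_abs_0. unfold Rsqr. nra.
Qed.

Lemma front_max_attained x0 : 1 < U x0 -> exists xm, forall y, U y <= U xm.
Proof.
  intros H. assert (Hm' := proj1 (is_lim_m_infty_iff U 1) Hm). assert (Hp' := proj1 (is_lim_p_infty_iff U 0) Hp).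
  destruct (Hm' (U x0 - 1)) as [M1 H1]; [lra|]. destruct (Hp' 1) as [M2 H2]; [lra|].
  set (a := Rmin M1 x0). set (b := Rmax M2 x0).
  assert (a <= M1) by apply Rmin_l. assert (a <= x0) by apply Rmin_r.
  assert (M2 <= b) by apply Rmax_l. assert (x0 <= b) by apply Rmax_r.
  destruct (continuity_ab_maj U a b) as [xm [HM _]]; [lra| |].
  { intros x _. apply continuity_pt_filterlim. apply front_continuous. }
  exists xm. assert (Hx0 := HM x0 ltac:(lra)). intros y.
  destruct (Rlt_dec y a) as [Ha|Ha].
  - specialize (H1 y ltac:(lra)). apply Rabs_def2 in H1. lra.
  - destruct (Rlt_dec b y) as [Hb|Hb].
    + specialize (H2 y ltac:(lra)). apply Rabs_def2 in H2. lra.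
    + apply HM. lra.
Qed.

(** At a maximum above 1 one has V = 0 and V' = - U (1 - U) > 0, so U would still increase just
    after it. *)
Lemma front_le_one xi : U xi <= 1.
Proof.
  destruct (Rle_lt_dec (U xi) 1) as [|H]; [assumption|exfalso].
  destruct (front_max_attained xi H) as [xm Hmax].
  assert (Hxm := Hmax xi).
  assert (HV : V xm = 0) by (apply (is_derive_max U xm); [apply front_derive | assumption]).
  assert (Hd := front_rhs_pos xm (front_pos xm)). rewrite HV in Hd.
  destruct (is_derive_pos_right V xm _ Hd) as [d [Hd0 Hpos]]; [nra|].
  destruct (mvt_open U V xm (xm + d / 2)) as [z [Hz Ez]]; [lra| | |].
  { intros; apply front_derive. }
  { intros; apply front_continuous. }
  specialize (Hpos (z - xm) ltac:(lra)). replace (xm + (z - xm)) with z in Hpos by ring.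
  specialize (Hmax (xm + d / 2)). nra.
Qed.

(** Touching 1 is a maximum, so the orbit would sit at the rest state (1, 0); forward Gronwall for
    (1 - U)^2 + V^2 keeps it there, against the limit 0. *)
Lemma front_lt_one xi : U xi < 1.
Proof.
  destruct (front_le_one xi) as [|E]; [assumption|exfalso].
  assert (HV : V xi = 0).
  { apply (is_derive_max U xi); [apply front_derive|]. intros y. rewrite E. apply front_le_one. }
  assert (Hp' := proj1 (is_lim_p_infty_iff U 0) Hp). destruct (Hp' 1) as [M HM]; [lra|].
  set (b := Rmax xi M + 1).
  assert (xi <= Rmax xi M) by apply Rmax_l. assert (M <= Rmax xi M) by apply Rmax_r.
  set (N := fun x => (1 - U x) ^ 2 + V x ^ 2).
  set (K := 2 + 2 * (k + Rabs c)).
  assert (A : N b <= N xi * exp (K * (b - xi))).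
  { apply (gronwall_forward N (fun x => 2 * (1 - U x) * (0 - V x)
            + 2 * V x * (- c * V x + k * U x * V x - U x * (1 - U x))) K xi b); [unfold b; lra| | |].
    - intros x _. apply (is_derive_plus (fun x => (1 - U x) ^ 2) (fun x => V x ^ 2)).
      + apply (is_derive_sq (fun x => 1 - U x)).
        apply (is_derive_minus (fun _ => 1) U x 0 (V x)); [exact (is_derive_const 1 x) | apply front_derive].
      + apply is_derive_sq. apply front_rhs_pos. apply front_pos.
    - intros x _. unfold N. apply (continuous_plus (fun x => (1 - U x) ^ 2) (fun x => V x ^ 2)).
      + apply (continuous_comp U (fun y => (1 - y) ^ 2)); [apply front_continuous|].
        smooth.
      + apply (continuous_comp V (fun y => y ^ 2)); [apply HW|].
        smooth.
    - intros x _. pose proof (front_pos x). pose proof (front_le_one x).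
      replace (2 * (1 - U x) * (0 - V x) + 2 * V x * (- c * V x + k * U x * V x - U x * (1 - U x)))
        with (- (1 + U x) * (2 * ((1 - U x) * V x)) + 2 * ((k * U x - c) * V x ^ 2)) by ring.
      assert (M1 := Rabs_mult_le_sq (1 - U x) (V x)).
      assert (M2 := Rle_abs (- ((1 - U x) * V x))). rewrite Rabs_Ropp in M2.
      assert (M3 : - (1 + U x) * (2 * ((1 - U x) * V x)) <= 2 * N x).
      { unfold N. pose proof (pow2_ge_0 (1 - U x)). pose proof (pow2_ge_0 (V x)).
        assert (- (2 * ((1 - U x) * V x)) <= (1 - U x) ^ 2 + V x ^ 2) by lra. nra. }
      assert (M4 : (k * U x - c) * V x ^ 2 <= (k + Rabs c) * V x ^ 2).
      { apply le_mult_bound; [|apply pow2_ge_0].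
        unfold Rminus. eapply Rle_trans; [apply Rabs_triang|]. rewrite Rabs_Ropp.
        apply Rplus_le_compat_r. rewrite Rabs_right by nra. nra. }
      assert (M5 : V x ^ 2 <= N x) by (unfold N; pose proof (pow2_ge_0 (1 - U x)); lra).
      assert (0 <= k + Rabs c) by (pose proof (Rabs_pos c); lra).
      unfold K. nra. }
  assert (EN : N xi = 0) by (unfold N; rewrite HV, E; ring).
  rewrite EN, Rmult_0_l in A. unfold N in A. pose proof (pow2_ge_0 (V b)).
  specialize (HM b ltac:(unfold b; lra)). apply Rabs_def2 in HM. nra.
Qed.

Lemma front_on_profile xi : V xi = - profile k c (1 - U xi).
Proof.
  apply (orbit_on_profile k c (profile k c) U V (xi + 1)).
  - now apply profile_spec.
  - intros x _. split; [split; [apply front_pos | apply front_lt_one]|].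
    split; [apply front_derive | apply front_rhs_pos, front_pos].
  - exact Hm.
  - apply front_slope_left.
  - lra.
Qed.

(* Once [p > c U], the gap [p - c U] grows towards [U = 0]: the orbit would reach
   [U = 0] with nonzero slope. *)
Lemma front_below_cutoff_line eps : 0 < eps < 1 -> profile k c (1 - eps) <= c * eps.
Proof.
  intros He. destruct (Rle_lt_dec (profile k c (1 - eps)) (c * eps)) as [|Hgt]; [assumption|exfalso].
  set (g := profile k c (1 - eps) - c * eps).
  (* The derivative of p x + c x is k (1 - x) + x (1 - x) / p, which is nonnegative, so the gap at u
     is at least the gap at eps. *)
  assert (Hgap : forall u, 0 < u <= eps -> g + c * u <= profile k c (1 - u)).
  { intros u Hu.
    assert (A : profile k c (1 - eps) + c * (1 - eps) <= profile k c (1 - u) + c * (1 - u)); [|unfold g; lra].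
    assert (Hd : forall x, 0 < x < 1 ->
      is_derive (fun x => profile k c x + c * x) x (profile_rhs k c x (profile k c x) + c)).
    { intros x Hx. apply (is_derive_plus (profile k c) (fun x => c * x)).
      - apply (profile_derive k c); [now apply profile_spec | assumption].
      - auto_derive; [trivial | ring]. }
    apply (nondecreasing_of_derive (fun x => profile k c x + c * x)
             (fun x => profile_rhs k c x (profile k c x) + c)); [lra| | |].
    - intros; apply Hd; lra.
    - intros; eapply continuous_of_derive; apply Hd; lra.
    - intros x Hx. unfold profile_rhs.
      assert (0 < profile k c x) by (apply (profile_pos k c); [now apply profile_spec | lra]).
      assert (0 <= x * (1 - x) / profile k c x) by (apply Rdiv_le_0_compat; nra). nra. }
  assert (Hg : 0 < g) by (unfold g; lra).
  assert (Hp' := proj1 (is_lim_p_infty_iff U 0) Hp).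
  (* For U < r the term |c| U is at most g / 2, so the slope stays below - g / 2. Over a length 2 (r
     + 1) / g this lowers U by at least r + 1, from a value below r. *)
  set (r := Rmin eps (g / 2 / (Rabs c + 1))).
  assert (HC : 0 < Rabs c + 1) by (pose proof (Rabs_pos c); lra).
  assert (Hr : 0 < r) by (apply Rmin_glb_lt; [lra | repeat apply Rdiv_lt_0_compat; lra]).
  assert (Hr1 : r <= eps) by apply Rmin_l.
  assert (Hr2 : r * (Rabs c + 1) <= g / 2).
  { assert (r <= g / 2 / (Rabs c + 1)) by apply Rmin_r.
    apply Rmult_le_compat_r with (r := Rabs c + 1) in H; [|lra].
    replace (g / 2 / (Rabs c + 1) * (Rabs c + 1)) with (g / 2) in H by (field; lra). exact H. }
  destruct (Hp' r Hr) as [M HM].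
  assert (Hdec : forall x, M < x -> V x <= - (g / 2)).
  { intros x Hx. rewrite front_on_profile. specialize (HM x Hx). pose proof (front_pos x).
    apply Rabs_def2 in HM. assert (A := Hgap (U x) ltac:(lra)).
    assert (- (Rabs c * U x) <= c * U x).
    { pose proof (Rle_abs (- c)). rewrite Rabs_Ropp in *. nra. }
    pose proof (Rabs_pos c). nra. }
  set (a := M + 1). set (b := a + 2 * (r + 1) / g).
  assert (Hab : 0 < 2 * (r + 1) / g) by (apply Rdiv_lt_0_compat; lra).
  destruct (mvt U V a b) as [z [Hz Ez]]; [unfold b; lra| | |].
  { intros; apply front_derive. }
  { intros; apply front_continuous. }
  assert (HUa : U a < r) by (specialize (HM a ltac:(unfold a; lra)); apply Rabs_def2 in HM; lra).
  assert (HUb := front_pos b).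
  specialize (Hdec z ltac:(unfold a in *; lra)).
  assert (V z * (b - a) <= - (g / 2) * (b - a)) by (apply Rmult_le_compat_r; unfold b; lra).
  replace (- (g / 2) * (b - a)) with (- (r + 1)) in H by (unfold b; field; lra). lra.
Qed.
End NoCutoff.

(** * Pulled fronts: k <= 2 *)

(* The logarithmic coordinates [s = - ln U], [slope = - V / U]. *)
Definition slope (k c s : R) : R := profile k c (1 - exp (- s)) * exp s.

Lemma exp_neg_bounds s : 0 < s -> 0 < exp (- s) < 1.
Proof.
  intros H. split; [apply exp_pos|]. rewrite <- exp_0. apply exp_increasing. lra.
Qed.

Lemma exp_neg_mul s : exp (- s) * exp s = 1.
Proof. rewrite <- exp_plus. replace (- s + s) with 0 by ring. apply exp_0. Qed.

Lemma slope_pos k c s : 0 < k -> 0 < s -> 0 < slope k c s.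
Proof.
  intros hk Hs. apply exp_neg_bounds in Hs. apply Rmult_lt_0_compat; [|apply exp_pos].
  apply (profile_pos k c); [now apply profile_spec | lra].
Qed.

Definition slope_rhs (k c s z : R) : R := z - c + k * exp (- s) + (1 - exp (- s)) / z.

Lemma slope_derive k c s : 0 < k -> 0 < s ->
  is_derive (slope k c) s (slope_rhs k c s (slope k c s)).
Proof.
  intros hk Hs. assert (Hb := exp_neg_bounds s Hs).
  assert (Hx : 0 < 1 - exp (- s) < 1) by lra.
  assert (Hp := profile_derive k c _ _ (profile_spec k c hk) Hx).
  assert (Hpos : 0 < profile k c (1 - exp (- s))).
  { apply (profile_pos k c); [now apply profile_spec | lra]. }
  assert (Hi : is_derive (fun s => 1 - exp (- s)) s (exp (- s))) by (auto_derive; [trivial | ring]).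
  assert (He : is_derive exp s (exp s)) by (auto_derive; [trivial | ring]).
  assert (A := is_derive_mult _ _ s _ _ (is_derive_comp _ _ s _ _ Hp Hi) He Rmult_comm).
  eapply eq_rect; [exact A|].
  change (exp (- s) * profile_rhs k c (1 - exp (- s)) (profile k c (1 - exp (- s))) * exp s
          + profile k c (1 - exp (- s)) * exp s = slope_rhs k c s (slope k c s)).
  unfold profile_rhs, slope_rhs, slope. set (p := profile k c (1 - exp (- s))) in *.
  assert (E := exp_neg_mul s). set (u := exp (- s)) in *.
  assert (Ee : exp s = / u) by (apply Rmult_eq_reg_l with u; [rewrite E; field|]; lra).
  rewrite Ee. field. lra.
Qed.

Lemma slope_at_neg_ln k c eps : 0 < eps -> slope k c (- ln eps) = profile k c (1 - eps) / eps.
Proof.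
  intros He. unfold slope. rewrite Ropp_involutive, exp_ln, exp_Ropp, exp_ln by assumption. reflexivity.
Qed.

Definition quad (c z : R) : R := z ^ 2 - c * z + 1.

(* An antiderivative of [z / (z^2 - c z + 1)], where [w^2 = 1 - c^2 / 4]. *)
Definition phase (c w z : R) : R := / 2 * ln (quad c z) + c / (2 * w) * atan ((z - c / 2) / w).

Lemma quad_ge_sq c w z : w ^ 2 = 1 - c ^ 2 / 4 -> w ^ 2 <= quad c z.
Proof. intros H. rewrite H. unfold quad. pose proof (pow2_ge_0 (z - c / 2)). lra. Qed.

(** The square completed the other way: [quad c] is self-reciprocal, so it is also bounded below
    relative to z^2. This is the bound that matters for large z. *)
Lemma quad_ge_sq_mul c w z : w ^ 2 = 1 - c ^ 2 / 4 -> w ^ 2 * z ^ 2 <= quad c z.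
Proof. intros H. rewrite H. unfold quad. pose proof (pow2_ge_0 (1 - c * z / 2)). lra. Qed.

Lemma phase_derive c w z : 0 < w -> w ^ 2 = 1 - c ^ 2 / 4 ->
  is_derive (phase c w) z (z / quad c z).
Proof.
  intros Hw E. assert (Hq := quad_ge_sq c w z E). assert (0 < w ^ 2) by (apply pow_lt; lra).
  assert (Hd1 : is_derive (fun z => / 2 * ln (quad c z)) z (/ 2 * ((2 * z - c) / quad c z))).
  { unfold quad in *. auto_derive; [lra|]. field. lra. }
  assert (Hat : is_derive (fun z => atan ((z - c / 2) / w)) z (scal (/ w) (/ (1 + Rsqr ((z - c / 2) / w))))).
  { apply (is_derive_comp atan (fun z => (z - c / 2) / w)).
    - apply is_derive_atan.
    - auto_derive; [trivial|]. field. lra. }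
  assert (Hd2 := is_derive_scal _ z (c / (2 * w)) _ Hat).
  assert (A := is_derive_plus _ _ z _ _ Hd1 Hd2).
  eapply eq_rect; [exact A|].
  change (/ 2 * ((2 * z - c) / quad c z) + c / (2 * w) * (/ w * / (1 + Rsqr ((z - c / 2) / w)))
          = z / quad c z).
  assert (Eq : 1 + Rsqr ((z - c / 2) / w) = quad c z / w ^ 2).
  { unfold Rsqr. replace (quad c z) with (w ^ 2 + (z - c / 2) ^ 2) by (rewrite E; unfold quad; field).
    field. lra. }
  rewrite Eq. field. split; lra.
Qed.

Lemma phase_mono c w z1 z2 : 0 < w -> w ^ 2 = 1 - c ^ 2 / 4 -> 0 <= z1 <= z2 ->
  phase c w z1 <= phase c w z2.
Proof.
  intros Hw E Hz. apply (nondecreasing_of_derive (phase c w) (fun z => z / quad c z)); [lra| | |].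
  - intros; now apply phase_derive.
  - intros; eapply continuous_of_derive; now apply phase_derive.
  - intros x Hx. assert (Hq := quad_ge_sq c w x E). assert (0 < w ^ 2) by (apply pow_lt; lra).
    apply Rdiv_le_0_compat; lra.
Qed.

Lemma phase_slope_derive k c w s : 0 < k -> 0 < w -> w ^ 2 = 1 - c ^ 2 / 4 -> 0 < s ->
  is_derive (fun s => phase c w (slope k c s)) s
    (1 + exp (- s) * (k * slope k c s - 1) / quad c (slope k c s)).
Proof.
  intros hk Hw E Hs. assert (Hz := slope_pos k c s hk Hs).
  assert (A := is_derive_comp _ _ s _ _ (phase_derive c w (slope k c s) Hw E) (slope_derive k c s hk Hs)).
  eapply eq_rect; [exact A|]. set (z := slope k c s) in *.
  change (slope_rhs k c s z * (z / quad c z) = 1 + exp (- s) * (k * z - 1) / quad c z).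
  assert (Hq := quad_ge_sq c w z E). assert (0 < w ^ 2) by (apply pow_lt; lra).
  unfold slope_rhs, quad in *. field. lra.
Qed.

(** The phase advances at unit rate up to the error exp (- s) (k z - 1) / quad. The two lower bounds
    on quad combine to quad >= w^2 z, so exp (- s) <= w^3 / 2 makes this error O(w) uniformly in
    z. *)
Lemma phase_growth k c w s1 s2 : 0 < k -> 0 < w -> w ^ 2 = 1 - c ^ 2 / 4 ->
  0 < s1 <= s2 -> exp (- s1) <= w ^ 3 / 2 ->
  (1 - w / 2) * (s2 - s1) <= phase c w (slope k c s2) - phase c w (slope k c s1)
     <= (1 + k * w) * (s2 - s1).
Proof.
  intros hk Hw E Hs He.
  destruct (Req_dec s1 s2) as [->|Hne]; [lra|].
  destruct (mvt (fun s => phase c w (slope k c s))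
     (fun s => 1 + exp (- s) * (k * slope k c s - 1) / quad c (slope k c s)) s1 s2) as [s [Hss Em]]; [lra| | |].
  { intros; apply phase_slope_derive; auto; lra. }
  { intros; eapply continuous_of_derive; apply phase_slope_derive; auto; lra. }
  rewrite Em. set (z := slope k c s). assert (Hz : 0 < z) by (apply slope_pos; lra).
  assert (Hq1 := quad_ge_sq c w z E). assert (Hq2 := quad_ge_sq_mul c w z E).
  assert (Hw2 : 0 < w ^ 2) by (apply pow_lt; lra).
  assert (Hu : 0 < exp (- s) <= w ^ 3 / 2).
  { split; [apply exp_pos|]. eapply Rle_trans; [|exact He].
    destruct (Req_dec s1 s) as [->|]; [lra|]. left. apply exp_increasing. lra. }
  assert (Hz2 : z * w ^ 2 <= quad c z).
  { assert (z <= (1 + z ^ 2) / 2) by (pose proof (pow2_ge_0 (z - 1)); lra). nra. }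
  assert (Hquot : - (w / 2) <= exp (- s) * (k * z - 1) / quad c z <= k * w).
  { assert (Ew : w ^ 3 / 2 = w / 2 * w ^ 2) by field.
    split.
    - apply Rmult_le_reg_r with (quad c z); [lra|].
      unfold Rdiv. rewrite (Rmult_assoc _ (/ quad c z)), Rinv_l, Rmult_1_r by lra.
      assert (- exp (- s) <= exp (- s) * (k * z - 1)).
      { assert (0 <= exp (- s) * (k * z)) by (apply Rmult_le_pos; nra). lra. }
      assert (w / 2 * w ^ 2 <= w / 2 * quad c z) by (apply Rmult_le_compat_l; lra). lra.
    - apply Rmult_le_reg_r with (quad c z); [lra|].
      unfold Rdiv. rewrite (Rmult_assoc _ (/ quad c z)), Rinv_l, Rmult_1_r by lra.
      assert (exp (- s) * (k * z - 1) <= exp (- s) * (k * z)) by (apply Rmult_le_compat_l; lra).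
      assert (0 < k * z) by (apply Rmult_lt_0_compat; lra).
      assert (exp (- s) * (k * z) <= w / 2 * w ^ 2 * (k * z)) by (apply Rmult_le_compat_r; lra).
      assert (0 <= k * w) by (apply Rmult_le_pos; lra).
      assert (w / 2 * w ^ 2 * (k * z) = k * w / 2 * (z * w ^ 2)) by field.
      assert (k * w / 2 * (z * w ^ 2) <= k * w / 2 * quad c z) by (apply Rmult_le_compat_l; lra).
      assert (0 <= k * w * quad c z) by (apply Rmult_le_pos; lra). lra. }
  split; apply Rmult_le_compat_r; lra.
Qed.

(** Solves exp (- T) = w^3 / 2, the smallness required by [phase_growth]; being only logarithmic in
    w, it is negligible against the bottleneck time of order 1 / w. *)
Definition entry_time (w : R) : R := ln 2 - 3 * ln w.

Lemma ln_le_sub_one x : 0 < x -> ln x <= x - 1.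
Proof.
  intros H. pose proof (exp_ineq1_le (ln x)). rewrite exp_ln in H0 by assumption. lra.
Qed.

(** Read with w = r^2: the logarithm of w costs at most a factor 1 / r, so w ln w is O(r). *)
Lemma neg_ln_le_sqrt r : 0 < r -> - ln (r ^ 2) * r <= 2.
Proof.
  intros H. assert (A := ln_le_sub_one (/ r) (Rinv_0_lt_compat r H)).
  rewrite ln_Rinv in A by assumption.
  replace (r ^ 2) with (r * r) by ring. rewrite ln_mult by assumption.
  assert (- ln r * r <= (/ r - 1) * r) by (apply Rmult_le_compat_r; lra).
  replace ((/ r - 1) * r) with (1 - r) in H0 by (field; lra). lra.
Qed.

Lemma ln2_bounds : 0 < ln 2 <= 1.
Proof.
  split; [rewrite <- ln_1; apply ln_increasing; lra|].
  pose proof (ln_le_sub_one 2). lra.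
Qed.

Lemma entry_time_exp w : 0 < w -> exp (- entry_time w) = w ^ 3 / 2.
Proof.
  intros H. unfold entry_time. replace (- (ln 2 - 3 * ln w)) with (ln w + ln w + ln w + - ln 2) by ring.
  rewrite !exp_plus, exp_Ropp, !exp_ln by lra. field.
Qed.

Lemma entry_time_pos w : 0 < w <= 1 -> 0 < entry_time w.
Proof.
  intros H. unfold entry_time. pose proof ln2_bounds. pose proof (ln_le_sub_one w). lra.
Qed.

(** The 7 is 1 from ln 2 plus 3 times the 2 of [neg_ln_le_sqrt]. *)
Lemma entry_time_bound r : 0 < r <= 1 -> r * entry_time (r ^ 2) <= 7.
Proof.
  intros H. unfold entry_time. pose proof ln2_bounds. pose proof (neg_ln_le_sqrt r). nra.
Qed.

Lemma atan_bounds x : - (PI / 2) < atan x < PI / 2.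
Proof. pose proof (atan_bound x). lra. Qed.

Lemma atan_le x : 0 <= x -> atan x <= x.
Proof.
  intros H. assert (atan x - x <= atan 0 - 0).
  { apply (nonincreasing_of_derive (fun x => atan x - x) (fun x => / (1 + Rsqr x) - 1)); [lra| | |].
    - intros y _. apply (is_derive_minus atan (fun x => x)); [apply is_derive_atan | apply @is_derive_id].
    - intros y _. eapply continuous_of_derive.
      apply (is_derive_minus atan (fun x => x)); [apply is_derive_atan | apply @is_derive_id].
    - intros y _. assert (/ (1 + Rsqr y) <= / 1); [|lra].
      apply Rinv_le_contravar; [lra|]. pose proof (Rle_0_sqr y). lra. }
  rewrite atan_0 in H0. lra.
Qed.

Lemma atan_ge_pos x : 0 < x -> PI / 2 - / x <= atan x.
Proof.
  intros H. assert (A := atan_inv x H). assert (B := atan_le (/ x)).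
  assert (0 < / x) by now apply Rinv_0_lt_compat. lra.
Qed.

Lemma atan_le_compat x y : x <= y -> atan x <= atan y.
Proof. intros [H| ->]; [left; now apply atan_increasing | lra]. Qed.

(* [S] is the time at which the orbit reaches the line [V = - c U]. *)
Lemma arrival_time_upper k c w S X : 0 < k -> 0 < c -> 0 < w -> w ^ 2 = 1 - c ^ 2 / 4 ->
  entry_time w <= S -> slope k c S <= c -> X <= (slope k c (entry_time w) - c / 2) / w ->
  (1 - w / 2) * (w * S - w * entry_time w) <= PI / 2 - atan X - w * ln w.
Proof.
  intros hk Hc Hw E HS HzS HX.
  assert (Hw1 : w <= 1) by nra.
  assert (Hc1 : c <= 2) by nra.
  assert (He := entry_time_pos w (conj Hw Hw1)).
  destruct (phase_growth k c w (entry_time w) S hk Hw E) as [G _]; [lra| |].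
  { rewrite entry_time_exp by assumption. lra. }
  assert (P1 : phase c w (slope k c S) <= phase c w c).
  { apply phase_mono; auto. split; [|assumption]. left. apply slope_pos; lra. }
  (* At z = c the polynomial takes the value 1, so the logarithmic part of the phase disappears at
     arrival. *)
  assert (P2 : phase c w c = c / (2 * w) * atan (c / 2 / w)).
  { unfold phase, quad. replace (c ^ 2 - c * c + 1) with 1 by ring. rewrite ln_1.
    replace (c - c / 2) with (c / 2) by field. ring. }
  set (z1 := slope k c (entry_time w)) in *.
  (* At entry quad is only known to be at least w^2; this costs ln w, which after multiplication by
     w still vanishes. *)
  assert (P3 : ln w + c / (2 * w) * atan X <= phase c w z1).
  { unfold phase. apply Rplus_le_compat.
    - assert (Hq := quad_ge_sq c w z1 E).
      assert (A : ln (w ^ 2) <= ln (quad c z1)).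
      { destruct Hq as [Hq| ->]; [|lra]. left. apply ln_increasing; [apply pow_lt; lra | assumption]. }
      replace (w ^ 2) with (w * w) in A by ring. rewrite ln_mult in A by assumption. lra.
    - apply Rmult_le_compat_l; [apply Rdiv_le_0_compat; lra|]. now apply atan_le_compat. }
  assert (G2 : (1 - w / 2) * (S - entry_time w) * w
     <= (c / (2 * w) * (atan (c / 2 / w) - atan X) - ln w) * w) by (apply Rmult_le_compat_r; lra).
  replace ((c / (2 * w) * (atan (c / 2 / w) - atan X) - ln w) * w)
    with (c / 2 * (atan (c / 2 / w) - atan X) - w * ln w) in G2 by (field; lra).
  pose proof (atan_bounds (c / 2 / w)). pose proof (atan_bounds X).
  assert (c / 2 * (atan (c / 2 / w) - atan X) <= c / 2 * (PI / 2 - atan X)) by (apply Rmult_le_compat_l; lra).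
  assert (c / 2 * (PI / 2 - atan X) <= 1 * (PI / 2 - atan X)) by (apply Rmult_le_compat_r; lra).
  lra.
Qed.

(** At entry z lies in (0, c] with c <= 2, so quad is bounded and its logarithm costs a constant,
    hence 2 w after scaling. The factor c / 2 is replaced by its lower bound 1 - w. *)
Lemma arrival_time_lower k c w S X : 0 < k -> 0 < c -> 0 < w -> w ^ 2 = 1 - c ^ 2 / 4 ->
  entry_time w <= S -> slope k c S = c -> slope k c (entry_time w) <= c ->
  (slope k c (entry_time w) - c / 2) / w <= X -> X <= c / 2 / w ->
  (1 - w) * (atan ((1 - w) / w) - atan X) - 2 * w <= (1 + k * w) * (w * S).
Proof.
  intros hk Hc Hw E HS HzS Hz1c HX HXc.
  assert (Hw1 : w <= 1) by nra.
  assert (Hc1 : c <= 2) by nra.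
  assert (Hcw : 1 - w <= c / 2) by nra.
  assert (He := entry_time_pos w (conj Hw Hw1)).
  destruct (phase_growth k c w (entry_time w) S hk Hw E) as [_ G]; [lra| |].
  { rewrite entry_time_exp by assumption. lra. }
  rewrite HzS in G.
  assert (P2 : phase c w c = c / (2 * w) * atan (c / 2 / w)).
  { unfold phase, quad. replace (c ^ 2 - c * c + 1) with 1 by ring. rewrite ln_1.
    replace (c - c / 2) with (c / 2) by field. ring. }
  assert (Hz1 : 0 < slope k c (entry_time w)) by (apply slope_pos; lra).
  set (z1 := slope k c (entry_time w)) in *.
  assert (P3 : phase c w z1 <= 2 + c / (2 * w) * atan X).
  { unfold phase. apply Rplus_le_compat.
    - assert (Hq : 0 < quad c z1 <= 5).
      { assert (Hq := quad_ge_sq c w z1 E). assert (0 < w ^ 2) by (apply pow_lt; lra).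
        split; [lra|]. unfold quad. nra. }
      pose proof (ln_le_sub_one (quad c z1)). lra.
    - apply Rmult_le_compat_l; [apply Rdiv_le_0_compat; lra|]. now apply atan_le_compat. }
  assert (G2 : (c / (2 * w) * (atan (c / 2 / w) - atan X) - 2) * w
     <= (1 + k * w) * (S - entry_time w) * w) by (apply Rmult_le_compat_r; lra).
  replace ((c / (2 * w) * (atan (c / 2 / w) - atan X) - 2) * w)
    with (c / 2 * (atan (c / 2 / w) - atan X) - 2 * w) in G2 by (field; lra).
  assert (HXat := atan_le_compat X (c / 2 / w) HXc).
  assert (Ha : atan ((1 - w) / w) <= atan (c / 2 / w)).
  { apply atan_le_compat. apply Rmult_le_compat_r; [left; now apply Rinv_0_lt_compat | lra]. }
  assert ((1 - w) * (atan ((1 - w) / w) - atan X) <= (1 - w) * (atan (c / 2 / w) - atan X)).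
  { apply Rmult_le_compat_l; lra. }
  assert ((1 - w) * (atan (c / 2 / w) - atan X) <= c / 2 * (atan (c / 2 / w) - atan X)).
  { apply Rmult_le_compat_r; lra. }
  assert (0 <= (1 + k * w) * w * entry_time w) by (repeat apply Rmult_le_pos; nra).
  nra.
Qed.

(** * Pulled fronts: slopes at speed 2 and their perturbation *)

Lemma slope_two_le k s : 0 < k <= 2 -> 0 < s -> slope k 2 s <= 1 - exp (- s).
Proof.
  intros hk Hs. assert (Hb := exp_neg_bounds s Hs). unfold slope.
  assert (A := profile_subcritical k hk (1 - exp (- s)) ltac:(lra)).
  replace (1 - (1 - exp (- s))) with (exp (- s)) in A by ring.
  apply Rmult_le_compat_r with (r := exp s) in A; [|left; apply exp_pos].
  rewrite Rmult_assoc, exp_neg_mul in A. lra.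
Qed.

Lemma slope_two_two s : 0 < s -> slope 2 2 s = 1 - exp (- s).
Proof.
  intros Hs. assert (Hb := exp_neg_bounds s Hs). unfold slope.
  rewrite profile_at_two by lra.
  replace (1 - (1 - exp (- s))) with (exp (- s)) by ring.
  rewrite Rmult_assoc, exp_neg_mul. ring.
Qed.

Lemma slope_mono_speed k c1 c2 s : 0 < k -> c1 <= c2 -> 0 < s -> slope k c2 s <= slope k c1 s.
Proof.
  intros hk Hc Hs. assert (Hb := exp_neg_bounds s Hs). unfold slope.
  apply Rmult_le_compat_r; [left; apply exp_pos|].
  apply (profile_le k c2 _ k c1 _); try lra; now apply profile_spec.
Qed.

(* The difference [e] of the slopes for [c] and 2 satisfies [e' <= d + e^2], [d = 2 - c]. *)
Lemma slope_perturbation k c s : 0 < k <= 2 -> c < 2 -> / 2 <= s -> 4 * (2 - c) * s ^ 2 < 1 ->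
  slope k c s < slope k 2 s + 2 * (2 - c) * s.
Proof.
  intros hk Hc Hs Hsmall. set (d := 2 - c) in *. assert (Hd : 0 < d) by (unfold d; lra).
  assert (slope k c s - slope k 2 s - 2 * d * s < 0); [|lra].
  apply (barrier_strict (fun s => slope k c s - slope k 2 s - 2 * d * s)
    (fun s => slope_rhs k c s (slope k c s) - slope_rhs k 2 s (slope k 2 s) - 2 * d) (/ 2) s); [assumption| | |].
  - intros t Ht.
    apply (is_derive_minus (fun s => slope k c s - slope k 2 s) (fun s => 2 * d * s)).
    + apply (is_derive_minus (slope k c) (slope k 2)); apply slope_derive; lra.
    + auto_derive; [trivial | ring].
  - intros t Ht Heq.
    assert (H2 := slope_two_le k t hk ltac:(lra)).
    assert (Hb := exp_neg_bounds t ltac:(lra)).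
    assert (Hz2 := slope_pos k 2 t (proj1 hk) ltac:(lra)).
    set (z2 := slope k 2 t) in *. set (z := slope k c t) in *. set (e := 2 * d * t) in *.
    assert (He : 0 < e) by (unfold e; apply Rmult_lt_0_compat; lra).
    assert (Ez : z = z2 + e) by lra.
    assert (E : slope_rhs k c t z - slope_rhs k 2 t z2 - 2 * d
                = e * (1 - (1 - exp (- t)) / (z * z2)) - d).
    { unfold slope_rhs. replace c with (2 - d) by (unfold d; ring). rewrite Ez. field. lra. }
    rewrite E.
    (* As z2 <= 1 - exp (- t), the damping coefficient is at least 1 / z >= 1 - e, so the growth of
       the difference is at most e^2. *)
    assert (Hq : / z <= (1 - exp (- t)) / (z * z2)).
    { apply Rmult_le_reg_r with (z * z2); [nra|].
      replace (/ z * (z * z2)) with z2 by (field; lra).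
      replace ((1 - exp (- t)) / (z * z2) * (z * z2)) with (1 - exp (- t)) by (field; lra). assumption. }
    assert (Hq2 : 1 - e <= / z).
    { apply Rmult_le_reg_r with z; [lra|]. rewrite Rinv_l by lra. nra. }
    assert (Hee : e * (1 - (1 - exp (- t)) / (z * z2)) <= e * e) by (apply Rmult_le_compat_l; lra).
    (* On contact e = 2 d t, hence e^2 = d (4 d t^2) < d: the barrier rises faster than the
       difference. *)
    assert (Hts : 4 * d * t ^ 2 < 1).
    { eapply Rle_lt_trans; [|exact Hsmall]. apply Rmult_le_compat_l; [lra|]. apply pow_incr. lra. }
    assert (e * e = d * (4 * d * t ^ 2)) by (unfold e; ring). nra.
  (* At s = 1/2 the difference is at most d (exp (1/2) - 1), which is below d = 2 d s because exp
     (1/2) < 2. *)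
  - set (h := / 2).
    assert (Hh : h = 1 / 2) by (unfold h; lra). assert (Hb := exp_neg_bounds h ltac:(lra)).
    assert (A := profile_diff_le k c _ 2 _ ltac:(unfold d in *; lra) (profile_spec k c (proj1 hk))
                    (profile_spec k 2 (proj1 hk)) (1 - exp (- h)) ltac:(lra)).
    fold d in A. unfold slope.
    apply Rmult_le_compat_r with (r := exp h) in A; [|left; apply exp_pos].
    rewrite Rmult_plus_distr_r, (Rmult_assoc d), (Rmult_minus_distr_r 1), exp_neg_mul in A.
    assert (Hexp : exp h < 2).
    { assert (Hsq : exp h * exp h <= 3).
      { rewrite <- exp_plus. replace (h + h) with 1 by lra. apply exp_le_3. }
      pose proof (exp_pos h). nra. }
    rewrite Hh in *. nra.
Qed.

Lemma is_derive_pos_left (f : R -> R) (x l : R) :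
  is_derive f x l -> 0 < l -> exists d, 0 < d /\ forall h, 0 < h < d -> f (x - h) < f x.
Proof.
  intros H Hl.
  assert (Hr : is_derive (fun y => - f (- y)) (- x) l).
  { assert (Ho : is_derive (fun x : R => - x) (- x) (- 1)) by (auto_derive; [trivial | ring]).
    rewrite <- (Ropp_involutive x) in H.
    assert (A := is_derive_opp _ _ _ (is_derive_comp f (fun x => - x) (- x) _ _ H Ho)).
    eapply eq_rect; [exact A|]. change (- (- 1 * l) = l). ring. }
  destruct (is_derive_pos_right _ _ _ Hr Hl) as [d [Hd H']].
  exists d. split; [assumption|]. intros h Hh. specialize (H' h Hh).
  rewrite Ropp_involutive in H'. replace (- (- x + h)) with (x - h) in H' by ring. lra.
Qed.

(** The gap is measured from 1 - exp (- s), the exact slope for k = 2. The source (2 - k) exp (- s)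
    vanishes there and is what keeps the gap positive for k < 2. *)
Lemma slope_gap_derive k s : 0 < k -> 0 < s ->
  is_derive (fun s => 1 - exp (- s) - slope k 2 s) s
    ((2 - k) * exp (- s)
      - (1 - exp (- s) - slope k 2 s) * (1 - slope k 2 s) / slope k 2 s).
Proof.
  intros hk Hs. assert (Hz := slope_pos k 2 s hk Hs).
  assert (Hi : is_derive (fun s => 1 - exp (- s)) s (exp (- s))) by (auto_derive; [trivial | ring]).
  assert (A := is_derive_minus _ _ s _ _ Hi (slope_derive k 2 s hk Hs)).
  eapply eq_rect; [exact A|]. set (z := slope k 2 s) in *.
  change (exp (- s) - slope_rhs k 2 s z
          = (2 - k) * exp (- s) - (1 - exp (- s) - z) * (1 - z) / z).
  unfold slope_rhs. field. lra.
Qed.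

(* For k < 2 the approach to the double root 1 at speed 2 is only algebraic. *)
Lemma slope_two_gap k : 0 < k < 2 ->
  exists b, 0 < b /\ forall s, 2 <= s -> slope k 2 s <= 1 - b / (1 + s).
Proof.
  intros hk. set (y := fun s => 1 - exp (- s) - slope k 2 s).
  assert (Hy0 : forall s, 0 < s -> 0 <= y s).
  { intros s Hs. unfold y. pose proof (slope_two_le k s ltac:(lra) Hs). lra. }
  (* If the gap vanished at 2, its derivative there would be the positive source, and the gap would
     be negative just before. *)
  assert (Hy2 : 0 < y 2).
  { destruct (Hy0 2 ltac:(lra)) as [|E]; [assumption|exfalso].
    assert (A := slope_gap_derive k 2 (proj1 hk) ltac:(lra)).
    unfold y in E. rewrite <- E, Rmult_0_l in A. unfold Rdiv in A. rewrite Rmult_0_l, Rminus_0_r in A.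
    destruct (is_derive_pos_left _ _ _ A) as [d [Hd H]].
    { apply Rmult_lt_0_compat; [lra | apply exp_pos]. }
    set (h := Rmin (d / 2) 1). assert (h <= d / 2) by apply Rmin_l. assert (h <= 1) by apply Rmin_r.
    assert (0 < h) by (apply Rmin_glb_lt; lra).
    specialize (H h ltac:(lra)). specialize (Hy0 (2 - h) ltac:(lra)). unfold y in Hy0. lra. }
  (* The bound 1/4 gives z >= 1/2 and 2 b^2 m^2 <= b m^2, with m = 1 / (1 + t); (2 - k) / 2 lets the
     source absorb the mixed term 2 v u; y 2 gives the inequality at s = 2. *)
  set (b := Rmin (Rmin (/ 4) ((2 - k) / 2)) (y 2)).
  assert (Hb : 0 < b) by (unfold b; repeat apply Rmin_glb_lt; lra).
  assert (Hb1 : b <= Rmin (/ 4) ((2 - k) / 2)) by apply Rmin_l.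
  assert (Hb2 : b <= y 2) by apply Rmin_r.
  assert (Hb3 : Rmin (/ 4) ((2 - k) / 2) <= / 4) by apply Rmin_l.
  assert (Hb4 : Rmin (/ 4) ((2 - k) / 2) <= (2 - k) / 2) by apply Rmin_r.
  exists b. split; [assumption|]. intros s Hs.
  assert (b / (1 + s) - y s <= 0).
  { assert (Hder : forall t, 2 <= t -> is_derive (fun s => b / (1 + s) - y s) t
       (- b / (1 + t) ^ 2 - ((2 - k) * exp (- t)
          - (1 - exp (- t) - slope k 2 t) * (1 - slope k 2 t) / slope k 2 t))).
    { intros t Ht. apply (is_derive_minus (fun s => b / (1 + s)) y).
      - auto_derive; [lra|]. field. lra.
      - apply slope_gap_derive; lra. }
    apply (barrier_weak (fun s => b / (1 + s) - y s)
      (fun t => - b / (1 + t) ^ 2 - ((2 - k) * exp (- t)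
          - (1 - exp (- t) - slope k 2 t) * (1 - slope k 2 t) / slope k 2 t)) 2 s); [lra| | | |].
    - intros t Ht. apply Hder. lra.
    - intros t Ht. eapply continuous_of_derive. apply Hder. lra.
    - intros t Ht Hpos. assert (Hyt := Hy0 t ltac:(lra)). unfold y in Hpos, Hyt.
      set (u := exp (- t)) in *. set (z := slope k 2 t) in *.
      assert (Hu : 0 < u <= / 4).
      { split; [apply exp_pos|]. unfold u. rewrite exp_Ropp. apply Rinv_le_contravar; [lra|].
        assert (2 < exp 1) by (pose proof (exp_ineq1 1); lra).
        assert (exp 2 = exp 1 * exp 1) by (rewrite <- exp_plus; f_equal; lra).
        assert (exp 2 < exp t) by (apply exp_increasing; lra). nra. }
      set (m := / (1 + t)).
      assert (Hm : 0 < m <= 1).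
      { unfold m. split; [apply Rinv_0_lt_compat; lra|]. rewrite <- Rinv_1. apply Rinv_le_contravar; lra. }
      replace (b / (1 + t)) with (b * m) in Hpos by reflexivity.
      replace (- b / (1 + t) ^ 2) with (- b * m ^ 2) by (unfold m; field; lra).
      set (v := 1 - u - z) in *.
      assert (Hv : 0 <= v <= b * m) by lra.
      assert (Hvb : v <= b) by nra.
      assert (Hz : / 2 <= z) by (unfold v in *; lra).
      assert (Hfrac : v * (1 - z) / z <= 2 * (v * (u + v))).
      { replace (1 - z) with (u + v) by (unfold v; ring).
        apply Rmult_le_reg_r with z; [lra|].
        unfold Rdiv. rewrite Rmult_assoc, Rinv_l, Rmult_1_r by lra.
        assert (0 <= v * (u + v)) by (apply Rmult_le_pos; lra).
        assert (v * (u + v) * 1 <= v * (u + v) * (2 * z)) by (apply Rmult_le_compat_l; lra). lra. }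
      assert (2 * (v * u) <= (2 - k) * u).
      { rewrite <- Rmult_assoc. apply Rmult_le_compat_r; lra. }
      assert (v * v <= (b * m) * (b * m)) by (apply Rmult_le_compat; lra).
      assert (2 * ((b * m) * (b * m)) <= b * m ^ 2).
      { replace (2 * ((b * m) * (b * m))) with (b * m ^ 2 * (2 * b)) by ring.
        assert (0 <= b * m ^ 2) by (apply Rmult_le_pos; [lra | apply pow_le; lra]). nra. }
      lra.
    - cbv beta. replace (b / (1 + 2)) with (b / 3) by (field; lra). lra. }
  unfold y in H. pose proof (exp_pos (- s)). lra.
Qed.

(* [half_gap ^ 4 = 1 - c^2 / 4]: error terms below are rational functions of it. *)
Definition half_gap (k eps : R) : R := sqrt (sqrt (1 - cutoff_speed k eps ^ 2 / 4)).

Lemma half_gap_spec k eps : 0 < k <= 2 -> 0 < eps < 1 ->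
  0 < half_gap k eps <= 1 /\ (half_gap k eps ^ 2) ^ 2 = 1 - cutoff_speed k eps ^ 2 / 4.
Proof.
  intros hk He. destruct (cutoff_speed_spec k eps (proj1 hk) He) as [Hc _].
  unfold c_crit in Hc. destruct (Rle_dec k 2) as [_|]; [|lra].
  set (c := cutoff_speed k eps) in *. unfold half_gap. fold c.
  assert (H : 0 < 1 - c ^ 2 / 4 <= 1).
  { pose proof (pow2_ge_0 c). assert (0 < (2 - c) * (2 + c)) by (apply Rmult_lt_0_compat; lra). lra. }
  split; [split|].
  - now repeat apply sqrt_lt_R0.
  -
  assert (Hs : forall x, x <= 1 -> sqrt x <= 1).
  { intros x Hx. apply sqrt_le_1_alt in Hx. now rewrite sqrt_1 in Hx. }
    apply Hs, Hs. lra.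
  - rewrite !pow2_sqrt; [reflexivity | lra | apply sqrt_pos].
Qed.

Lemma slope_at_cutoff k eps : 0 < k -> 0 < eps < 1 ->
  slope k (cutoff_speed k eps) (- ln eps) = cutoff_speed k eps.
Proof.
  intros hk He. rewrite slope_at_neg_ln by lra.
  destruct (cutoff_speed_spec k eps hk He) as [_ ->]. field. lra.
Qed.

(** [X] is any lower bound for the entry position (z - c / 2) / w. With w = r^2 the time before
    entry contributes 7 r and the term - w ln w contributes 2 r; if the cut-off is reached before
    entry, the first term alone suffices. *)
Lemma cutoff_time_upper k eps r X : 0 < k <= 2 -> 0 < eps < 1 -> r = half_gap k eps ->
  X <= (slope k (cutoff_speed k eps) (entry_time (r ^ 2)) - cutoff_speed k eps / 2) / r ^ 2 ->
  r ^ 2 * - ln eps <= 7 * r + (PI / 2 - atan X + 2 * r) / (1 - r ^ 2 / 2).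
Proof.
  intros hk He -> HX. destruct (half_gap_spec k eps hk He) as [Hr E].
  destruct (cutoff_speed_spec k eps (proj1 hk) He) as [Hc _].
  assert (Hz := slope_at_cutoff k eps (proj1 hk) He).
  set (r := half_gap k eps) in *. set (c := cutoff_speed k eps) in *. set (S := - ln eps) in *.
  assert (HT := entry_time_bound r Hr). pose proof (atan_bounds X).
  assert (Hw : 0 < r ^ 2 <= 1) by nra.
  assert (Hden : 0 < 1 - r ^ 2 / 2) by lra.
  assert (HwT : r ^ 2 * entry_time (r ^ 2) <= 7 * r) by nra.
  destruct (Rle_lt_dec (entry_time (r ^ 2)) S) as [HS|HS].
  - assert (A := arrival_time_upper k c (r ^ 2) S X (proj1 hk) (proj1 Hc) (proj1 Hw) E HS
                   (Req_le _ _ Hz) HX).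
    assert (B := neg_ln_le_sqrt r (proj1 Hr)).
    assert (A2 : (r ^ 2 * S - r ^ 2 * entry_time (r ^ 2)) * (1 - r ^ 2 / 2) <= PI / 2 - atan X + 2 * r) by nra.
    assert (r ^ 2 * S - r ^ 2 * entry_time (r ^ 2) <= (PI / 2 - atan X + 2 * r) / (1 - r ^ 2 / 2)).
    { apply Rmult_le_reg_r with (1 - r ^ 2 / 2); [assumption|].
      unfold Rdiv at 2. rewrite (Rmult_assoc _ (/ _)), Rinv_l, Rmult_1_r by lra. exact A2. }
    lra.
  - assert (0 <= (PI / 2 - atan X + 2 * r) / (1 - r ^ 2 / 2)) by (apply Rdiv_le_0_compat; lra).
    assert (r ^ 2 * S <= r ^ 2 * entry_time (r ^ 2)) by (apply Rmult_le_compat_l; lra). lra.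
Qed.

(** Whatever the entry position, the arctangent is bounded, so [cutoff_time_upper] bounds r^2 |ln
    eps| by an absolute constant; 25 is a crude one. *)
Lemma half_gap_vanishes k : 0 < k <= 2 -> filterlim (half_gap k) (at_right 0) (locally 0).
Proof.
  intros hk. apply filterlim_locally. intros eta.
  assert (Hd : 0 < Rmin 1 (exp (- (25 / eta ^ 2)))) by (apply Rmin_glb_lt; [lra | apply exp_pos]).
  exists (mkposreal _ Hd). intros eps Heps Hpos.
  change (Rabs (eps - 0) < Rmin 1 (exp (- (25 / eta ^ 2)))) in Heps.
  rewrite Rminus_0_r, Rabs_right in Heps by lra.
  assert (H1 : eps < 1) by (eapply Rlt_le_trans; [exact Heps | apply Rmin_l]).
  assert (H2 : eps < exp (- (25 / eta ^ 2))) by (eapply Rlt_le_trans; [exact Heps | apply Rmin_r]).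
  assert (He : 0 < eps < 1) by lra.
  destruct (half_gap_spec k eps hk He) as [Hr _].
  assert (A := cutoff_time_upper k eps _ _ hk He eq_refl (Rle_refl _)).
  set (X := (slope k (cutoff_speed k eps) (entry_time (half_gap k eps ^ 2))
             - cutoff_speed k eps / 2) / half_gap k eps ^ 2) in *.
  pose proof (atan_bounds X). pose proof PI_4.
  set (r := half_gap k eps) in *. clearbody X.
  change (Rabs (r - 0) < eta). rewrite Rminus_0_r, Rabs_right by lra.
  assert (HS : 25 / eta ^ 2 < - ln eps).
  { apply ln_increasing in H2; [|lra]. rewrite ln_exp in H2. lra. }
  assert (Heta := cond_pos eta).
  assert (HB : r ^ 2 * - ln eps <= 25).
  { assert ((PI / 2 - atan X + 2 * r) / (1 - r ^ 2 / 2) <= 12); [|lra].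
    assert (Hw : 0 < r ^ 2 <= 1) by nra.
    apply Rmult_le_reg_r with (1 - r ^ 2 / 2); [lra|].
    unfold Rdiv at 1. rewrite (Rmult_assoc _ (/ _)), Rinv_l, Rmult_1_r by lra. nra. }
  destruct (Rlt_le_dec r eta) as [|Hge]; [assumption|exfalso].
  assert (H25 : 25 / eta ^ 2 * eta ^ 2 = 25) by (field; lra).
  assert (0 < eta ^ 2) by (apply pow_lt; lra).
  assert (eta ^ 2 <= r ^ 2) by (apply pow_incr; lra).
  assert (0 < 25 / eta ^ 2) by (apply Rdiv_lt_0_compat; lra). nra.
Qed.

(** The entry slope is compared with that of speed 2: the perturbation 2 (2 - c) T is at most 4 r^4
    T <= 28 r^3, and r^4 bounds 1 - c / 2. Together with w < 1/400, the bound 100 on [X] keeps it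
    below c / (2 w). *)
Lemma cutoff_time_lower k eps r X : 0 < k <= 2 -> 0 < eps < 1 -> r = half_gap k eps -> r < / 20 ->
  / 2 <= - ln eps ->
  (slope k 2 (entry_time (r ^ 2)) + 28 * r ^ 3 + r ^ 4 - 1) / r ^ 2 <= X -> X <= 100 ->
  ((1 - r ^ 2) * (PI / 2 - r ^ 2 / (1 - r ^ 2) - atan X) - 2 * r ^ 2) / (1 + k * r ^ 2) <= r ^ 2 * - ln eps.
Proof.
  intros hk He -> Hr20 HS2 HX HX100. destruct (half_gap_spec k eps hk He) as [Hr E].
  destruct (cutoff_speed_spec k eps (proj1 hk) He) as [Hc _].
  unfold c_crit in Hc. destruct (Rle_dec k 2) as [_|]; [|lra].
  assert (Hz := slope_at_cutoff k eps (proj1 hk) He).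
  set (r := half_gap k eps) in *. set (c := cutoff_speed k eps) in *. set (S := - ln eps) in *.
  assert (HT := entry_time_bound r Hr).
  assert (Hw : 0 < r ^ 2 < / 400) by (split; [apply pow_lt; lra | nra]).
  assert (HT1 : / 2 <= entry_time (r ^ 2)).
  { unfold entry_time. pose proof ln2_bounds. pose proof (ln_le_sub_one (r ^ 2) (proj1 Hw)). lra. }
  set (T := entry_time (r ^ 2)) in *.
  assert (Hdelta : 2 - c <= 2 * (r ^ 2) ^ 2) by nra.
  assert (Hchalf : 1 - r ^ 2 <= c / 2) by nra.
  assert (HrT : (r ^ 2) ^ 2 * T <= 7 * r ^ 3).
  { replace ((r ^ 2) ^ 2 * T) with (r ^ 3 * (r * T)) by ring.
    rewrite (Rmult_comm 7). apply Rmult_le_compat_l; [apply pow_le; lra | lra]. }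
  assert (Hsm : 4 * (2 - c) * T ^ 2 < 1).
  { apply Rle_lt_trans with (4 * (2 * (r ^ 2) ^ 2) * T ^ 2).
    - apply Rmult_le_compat_r; [apply pow2_ge_0 | lra].
    - replace (4 * (2 * (r ^ 2) ^ 2) * T ^ 2) with (8 * r ^ 2 * (r * T) ^ 2) by ring.
      assert ((r * T) ^ 2 <= 7 ^ 2) by (apply pow_incr; split; [apply Rmult_le_pos; lra | lra]).
      nra. }
  assert (Hr3 : 28 * r ^ 3 <= / 100).
  { assert (r ^ 3 <= r * / 400) by nra. nra. }
  (* An earlier arrival would occur while the slope is still below 1 plus a small perturbation,
     whereas arrival means slope c, close to 2. *)
  assert (HTS : T <= S).
  { destruct (Rle_lt_dec T S) as [|Hlt]; [assumption|exfalso].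
    assert (A := slope_perturbation k c S hk (proj2 Hc) HS2).
    rewrite Hz in A.
    assert (HS' : 4 * (2 - c) * S ^ 2 < 1).
    { eapply Rle_lt_trans; [|exact Hsm]. apply Rmult_le_compat_l; [lra|]. apply pow_incr. lra. }
    specialize (A HS'). assert (B := slope_two_le k S hk ltac:(lra)).
    pose proof (exp_pos (- S)).
    assert ((2 - c) * S <= 2 * (r ^ 2) ^ 2 * T) by (apply Rmult_le_compat; lra). lra. }
  assert (A := slope_perturbation k c T hk (proj2 Hc) HT1 Hsm).
  assert (B := slope_two_le k T hk ltac:(lra)). pose proof (exp_pos (- T)).
  assert (HdT : (2 - c) * T <= 2 * (r ^ 2) ^ 2 * T) by (apply Rmult_le_compat_r; lra).
  assert (Hz1 : slope k c T <= slope k 2 T + 28 * r ^ 3) by lra.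
  assert (Hz1c : slope k c T <= c) by lra.
  assert (Hgoal : (1 - r ^ 2) * (atan ((1 - r ^ 2) / r ^ 2) - atan X) - 2 * r ^ 2 <= (1 + k * r ^ 2) * (r ^ 2 * S)).
  { apply (arrival_time_lower k c (r ^ 2) S X); try assumption; try lra.
    - eapply Rle_trans; [|exact HX]. fold T.
      apply Rmult_le_compat_r; [left; apply Rinv_0_lt_compat; lra|].
      replace (r ^ 4) with ((r ^ 2) ^ 2) by ring. lra.
    - apply Rle_trans with 100; [assumption|].
      apply Rmult_le_reg_r with (r ^ 2); [lra|].
      unfold Rdiv at 1. rewrite (Rmult_assoc _ (/ _)), Rinv_l, Rmult_1_r by lra. lra. }
  assert (Hat : PI / 2 - r ^ 2 / (1 - r ^ 2) <= atan ((1 - r ^ 2) / r ^ 2)).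
  { replace (r ^ 2 / (1 - r ^ 2)) with (/ ((1 - r ^ 2) / r ^ 2)) by (field; lra).
    apply atan_ge_pos. apply Rdiv_lt_0_compat; lra. }
  assert (Hk : 0 < 1 + k * r ^ 2) by nra.
  apply Rmult_le_reg_r with (1 + k * r ^ 2); [assumption|].
  unfold Rdiv at 1. rewrite (Rmult_assoc _ (/ _)), Rinv_l, Rmult_1_r by lra. nra.
Qed.

Lemma filterlim_half_gap_comp k (f : R -> R) : 0 < k <= 2 -> continuous f 0 ->
  filterlim (fun eps => f (half_gap k eps)) (at_right 0) (locally (f 0)).
Proof.
  intros hk Hf. apply (filterlim_comp _ _ _ (half_gap k) f _ (locally 0)); [|exact Hf].
  now apply half_gap_vanishes.
Qed.

Lemma eventually_half_gap_lt k m : 0 < k <= 2 -> 0 < m ->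
  at_right 0 (fun eps => 0 < eps < 1 /\ / 2 <= - ln eps /\ half_gap k eps < m).
Proof.
  intros hk Hm.
  assert (A := half_gap_vanishes k hk). rewrite filterlim_locally in A.
  destruct (A (mkposreal m Hm)) as [d Hd].
  assert (Hd' : 0 < Rmin d (exp (- / 2))) by (apply Rmin_glb_lt; [apply cond_pos | apply exp_pos]).
  exists (mkposreal _ Hd'). intros eps Heps Hpos.
  assert (Hb : Rabs (eps - 0) < Rmin d (exp (- / 2))) by exact Heps.
  rewrite Rminus_0_r, Rabs_right in Hb by lra.
  assert (H1 : eps < d) by (eapply Rlt_le_trans; [exact Hb | apply Rmin_l]).
  assert (H2 : eps < exp (- / 2)) by (eapply Rlt_le_trans; [exact Hb | apply Rmin_r]).
  assert (exp (- / 2) < 1) by (rewrite <- exp_0; apply exp_increasing; lra).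
  assert (H3 : eps < 1) by lra.
  apply ln_increasing in H2; [|assumption]. rewrite ln_exp in H2.
  split; [lra|]. split; [lra|].
  specialize (Hd eps). simpl in Hd.
  assert (B : Rabs (half_gap k eps - 0) < m).
  { apply Hd; [|assumption]. change (Rabs (eps - 0) < d). rewrite Rminus_0_r, Rabs_right; lra. }
  apply Rabs_def2 in B. lra.
Qed.

Lemma filterlim_squeeze (F : (R -> Prop) -> Prop) {FF : Filter F} (f g h : R -> R) (l : R) :
  F (fun x => f x <= g x <= h x) ->
  filterlim f F (locally l) -> filterlim h F (locally l) -> filterlim g F (locally l).
Proof. intros H1 H2 H3. exact (filterlim_le_le f g h (Finite l) H1 H2 H3). Qed.

(** For k < 2 the slope at entry is below 1 by a quantity of order r at least, far more than w =
    r^2. The entry arctangent therefore tends to - PI / 2, and the passage takes the full angle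
    PI. *)
Lemma scaled_time_limit_lt k : 0 < k < 2 ->
  filterlim (fun eps => half_gap k eps ^ 2 * - ln eps) (at_right 0) (locally PI).
Proof.
  intros hk. assert (hk2 : 0 < k <= 2) by lra.
  destruct (slope_two_gap k hk) as [b [Hb Hgap]].
  set (lo := fun r => ((1 - r ^ 2) * (PI / 2 - r ^ 2 / (1 - r ^ 2)
               + (PI / 2 - r * (r + 7) / (b - 29 * r ^ 2 * (r + 7)))) - 2 * r ^ 2) / (1 + k * r ^ 2)).
  set (hi := fun r => 7 * r + (PI + 2 * r) / (1 - r ^ 2 / 2)).
  assert (Hlo : filterlim (fun eps => lo (half_gap k eps)) (at_right 0) (locally (lo 0))).
  { apply filterlim_half_gap_comp; [assumption|]. apply (ex_derive_continuous lo).
    unfold lo. auto_derive. repeat split; lra. }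
  assert (Hhi : filterlim (fun eps => hi (half_gap k eps)) (at_right 0) (locally (hi 0))).
  { apply filterlim_half_gap_comp; [assumption|]. apply (ex_derive_continuous hi).
    unfold hi. auto_derive. lra. }
  replace (lo 0) with PI in Hlo by (unfold lo; field; lra).
  replace (hi 0) with PI in Hhi by (unfold hi; field).
  refine (filterlim_squeeze _ _ _ _ _ _ Hlo Hhi).
  assert (Hm : 0 < Rmin (/ 20) (b / 300)) by (apply Rmin_glb_lt; lra).
  apply (filter_imp (fun eps => 0 < eps < 1 /\ / 2 <= - ln eps /\ half_gap k eps < Rmin (/ 20) (b / 300)));
    [|now apply eventually_half_gap_lt].
  intros eps [He [HS Hr]].
  assert (Hr1 : half_gap k eps < / 20) by (eapply Rlt_le_trans; [exact Hr | apply Rmin_l]).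
  assert (Hr2 : half_gap k eps < b / 300) by (eapply Rlt_le_trans; [exact Hr | apply Rmin_r]).
  destruct (half_gap_spec k eps hk2 He) as [Hr0 _].
  split.
  - set (r := half_gap k eps) in *.
    assert (Hw : 0 < r ^ 2 < / 400) by (split; [apply pow_lt; lra | nra]).
    (* [- Y] bounds the entry position from above: the gap b / (1 + T) with 1 + T <= (r + 7) / r,
       divided by r^2, against the perturbation 28 r + r^2 <= 29 r. *)
    set (Y := b / (r * (r + 7)) - 29 * r).
    assert (HD : 0 < b - 29 * r ^ 2 * (r + 7)).
    { assert (29 * r ^ 2 * (r + 7) <= 29 * (r * / 20) * 8) by (apply Rmult_le_compat; nra). lra. }
    assert (HY : Y = (b - 29 * r ^ 2 * (r + 7)) / (r * (r + 7))) by (unfold Y; field; lra).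
    assert (HY0 : 0 < Y) by (rewrite HY; apply Rdiv_lt_0_compat; [assumption | nra]).
    assert (HatY : PI / 2 - r * (r + 7) / (b - 29 * r ^ 2 * (r + 7)) <= - atan (- Y)).
    { rewrite atan_opp, Ropp_involutive.
      replace (r * (r + 7) / (b - 29 * r ^ 2 * (r + 7))) with (/ Y) by (rewrite HY; field; lra).
      now apply atan_ge_pos. }
    apply Rle_trans with (((1 - r ^ 2) * (PI / 2 - r ^ 2 / (1 - r ^ 2) - atan (- Y)) - 2 * r ^ 2) / (1 + k * r ^ 2)).
    + unfold lo. apply Rmult_le_compat_r; [left; apply Rinv_0_lt_compat; nra|].
      apply Rplus_le_compat_r. apply Rmult_le_compat_l; lra.
    + apply cutoff_time_lower; auto; try lra. fold r.
      assert (HT : 2 <= entry_time (r ^ 2)).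
      { unfold entry_time. pose proof ln2_bounds. pose proof (ln_le_sub_one (r ^ 2) (proj1 Hw)). lra. }
      assert (HrT := entry_time_bound r Hr0).
      assert (G := Hgap _ HT). set (T := entry_time (r ^ 2)) in *.
      assert (HbT : b * (r / (r + 7)) <= b / (1 + T)).
      { apply Rmult_le_compat_l; [lra|].
        apply Rmult_le_reg_r with (1 + T); [lra|]. rewrite Rinv_l by lra.
        apply Rmult_le_reg_r with (r + 7); [lra|].
        replace (r / (r + 7) * (1 + T) * (r + 7)) with (r + r * T) by (field; lra). lra. }
      apply Rle_trans with ((- (b * (r / (r + 7))) + 28 * r ^ 3 + r ^ 4) / r ^ 2).
      * apply Rmult_le_compat_r; [left; apply Rinv_0_lt_compat; lra | lra].
      * replace ((- (b * (r / (r + 7))) + 28 * r ^ 3 + r ^ 4) / r ^ 2)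
          with (- (b / (r * (r + 7))) + 28 * r + r ^ 2) by (field; lra).
        unfold Y. nra.
  - assert (A := cutoff_time_upper k eps _ _ hk2 He eq_refl (Rle_refl _)).
    set (X := (slope k (cutoff_speed k eps) (entry_time (half_gap k eps ^ 2))
             - cutoff_speed k eps / 2) / half_gap k eps ^ 2) in *.
    pose proof (atan_bounds X). eapply Rle_trans; [exact A|]. unfold hi.
    apply Rplus_le_compat_l. apply Rmult_le_compat_r; [|lra].
    left. apply Rinv_0_lt_compat. nra.
Qed.

(** For k = 2 the slope at speed 2 misses 1 at entry only by exp (- T) = w^3 / 2, negligible against
    w. The entry arctangent lies between those of - r and 29 r, and only half of the full angle
    remains. *)
Lemma scaled_time_limit_eq :
  filterlim (fun eps => half_gap 2 eps ^ 2 * - ln eps) (at_right 0) (locally (PI / 2)).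
Proof.
  assert (hk2 : 0 < 2 <= 2) by lra.
  set (lo := fun r => ((1 - r ^ 2) * (PI / 2 - r ^ 2 / (1 - r ^ 2) - 29 * r) - 2 * r ^ 2) / (1 + 2 * r ^ 2)).
  set (hi := fun r => 7 * r + (PI / 2 + 3 * r) / (1 - r ^ 2 / 2)).
  assert (Hlo : filterlim (fun eps => lo (half_gap 2 eps)) (at_right 0) (locally (lo 0))).
  { apply filterlim_half_gap_comp; [assumption|]. apply (ex_derive_continuous lo).
    unfold lo. auto_derive. repeat split; lra. }
  assert (Hhi : filterlim (fun eps => hi (half_gap 2 eps)) (at_right 0) (locally (hi 0))).
  { apply filterlim_half_gap_comp; [assumption|]. apply (ex_derive_continuous hi).
    unfold hi. auto_derive. lra. }
  replace (lo 0) with (PI / 2) in Hlo by (unfold lo; field; lra).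
  replace (hi 0) with (PI / 2) in Hhi by (unfold hi; field).
  refine (filterlim_squeeze _ _ _ _ _ _ Hlo Hhi).
  apply (filter_imp (fun eps => 0 < eps < 1 /\ / 2 <= - ln eps /\ half_gap 2 eps < / 20));
    [|apply eventually_half_gap_lt; lra].
  intros eps [He [HS Hr]].
  destruct (half_gap_spec 2 eps hk2 He) as [Hr0 E]. destruct (cutoff_speed_spec 2 eps ltac:(lra) He) as [Hc _].
  set (r := half_gap 2 eps) in *.
  assert (Hw : 0 < r ^ 2 < / 400) by (split; [apply pow_lt; lra | nra]).
  assert (HT := entry_time_pos (r ^ 2) ltac:(lra)).
  assert (Hexp := entry_time_exp (r ^ 2) ltac:(lra)).
  split.
  - apply Rle_trans with (((1 - r ^ 2) * (PI / 2 - r ^ 2 / (1 - r ^ 2) - atan (29 * r)) - 2 * r ^ 2) / (1 + 2 * r ^ 2)).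
    + unfold lo. apply Rmult_le_compat_r; [left; apply Rinv_0_lt_compat; nra|].
      pose proof (atan_le (29 * r)).
      apply Rplus_le_compat_r. apply Rmult_le_compat_l; lra.
    + apply cutoff_time_lower; auto; try lra. fold r.
      rewrite slope_two_two by assumption. rewrite Hexp.
      apply Rmult_le_reg_r with (r ^ 2); [lra|].
      unfold Rdiv at 1. rewrite (Rmult_assoc _ (/ _)), Rinv_l, Rmult_1_r by lra.
      assert (0 < (r ^ 2) ^ 3) by (apply pow_lt; lra). 
      assert (r ^ 4 <= r ^ 3) by (assert (0 < r ^ 3) by (apply pow_lt; lra); nra).
      replace (29 * r * r ^ 2) with (29 * r ^ 3) by ring. lra.
  - assert (A : r ^ 2 * - ln eps <= 7 * r + (PI / 2 - atan (- r) + 2 * r) / (1 - r ^ 2 / 2)).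
    { apply (cutoff_time_upper 2 eps r (- r) hk2 He eq_refl).
      unfold c_crit in Hc. destruct (Rle_dec 2 2) as [_|]; [|lra].
      assert (B := slope_mono_speed 2 (cutoff_speed 2 eps) 2 (entry_time (r ^ 2)) ltac:(lra) ltac:(lra) HT).
      rewrite slope_two_two, Hexp in B by assumption.
      apply Rmult_le_reg_r with (r ^ 2); [lra|].
      unfold Rdiv at 1. rewrite (Rmult_assoc _ (/ _)), Rinv_l, Rmult_1_r by lra.
      assert ((r ^ 2) ^ 3 / 2 <= r * r ^ 2).
      { replace ((r ^ 2) ^ 3 / 2) with (r * r ^ 2 * (r ^ 3 / 2)) by field.
        assert (0 < r * r ^ 2) by (apply Rmult_lt_0_compat; lra).
        assert (r ^ 3 <= 1) by (replace 1 with (1 ^ 3) by ring; apply pow_incr; lra). nra. }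
      lra. }
    eapply Rle_trans; [exact A|]. unfold hi.
    apply Rplus_le_compat_l. apply Rmult_le_compat_r; [left; apply Rinv_0_lt_compat; lra|].
    rewrite atan_opp. pose proof (atan_le r). lra.
Qed.

Lemma cutoff_speed_limit_le k : 0 < k <= 2 -> filterlim (cutoff_speed k) (at_right 0) (locally 2).
Proof.
  intros hk.
  assert (Hlo : filterlim (fun eps => 2 - 2 * half_gap k eps ^ 4) (at_right 0) (locally (2 - 2 * 0 ^ 4))).
  { apply (filterlim_half_gap_comp k (fun r => 2 - 2 * r ^ 4)); [assumption|].
    smooth. }
  replace (2 - 2 * 0 ^ 4) with 2 in Hlo by ring.
  refine (filterlim_squeeze _ _ _ _ _ _ Hlo (filterlim_const 2)).
  apply (filter_imp (fun eps => 0 < eps < 1 /\ / 2 <= - ln eps /\ half_gap k eps < 1));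
    [|apply eventually_half_gap_lt; lra].
  intros eps [He _]. destruct (half_gap_spec k eps hk He) as [_ E].
  destruct (cutoff_speed_spec k eps (proj1 hk) He) as [Hc _].
  unfold c_crit in Hc. destruct (Rle_dec k 2) as [_|]; [|lra].
  replace (half_gap k eps ^ 4) with ((half_gap k eps ^ 2) ^ 2) by ring. rewrite E. nra.
Qed.

(** From w^2 = (2 - c) (2 + c) / 4 the gap is 4 w^2 / (2 + c); the hypothesis says that w |ln eps|
    tends to L, and c tends to 2. *)
Lemma speed_gap_limit_le k L : 0 < k <= 2 -> 0 < L ->
  filterlim (fun eps => half_gap k eps ^ 2 * - ln eps) (at_right 0) (locally L) ->
  filterlim (fun eps => (2 - cutoff_speed k eps) / (L ^ 2 / ln eps ^ 2)) (at_right 0) (locally 1).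
Proof.
  intros hk HL Hlim.
  set (f := fun eps => half_gap k eps ^ 2 * - ln eps).
  apply (filterlim_ext_loc (fun eps => 4 / (2 + cutoff_speed k eps) * ((f eps / L) ^ 2))).
  { apply (filter_imp (fun eps => 0 < eps < 1 /\ / 2 <= - ln eps /\ half_gap k eps < 1));
    [|apply eventually_half_gap_lt; lra].
    intros eps [He [HS _]]. destruct (half_gap_spec k eps hk He) as [_ E].
    destruct (cutoff_speed_spec k eps (proj1 hk) He) as [Hc _].
    unfold f. replace ((half_gap k eps ^ 2 * - ln eps / L) ^ 2)
      with ((half_gap k eps ^ 2) ^ 2 * (ln eps / L) ^ 2) by (field; lra).
    rewrite E. field. split; [|split]; lra. }
  replace 1 with (4 / (2 + 2) * (L / L) ^ 2) by (field; lra).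
  apply (filterlim_comp_2 (G := locally (4 / (2 + 2))) (H := locally ((L / L) ^ 2))
           (fun eps => 4 / (2 + cutoff_speed k eps)) (fun eps => (f eps / L) ^ 2) Rmult).
  - apply (filterlim_comp _ _ _ (cutoff_speed k) (fun c => 4 / (2 + c)) _ (locally 2)).
    + now apply cutoff_speed_limit_le.
    + apply (ex_derive_continuous (fun c => 4 / (2 + c))). auto_derive. lra.
  - apply (filterlim_comp _ _ _ f (fun y => (y / L) ^ 2) _ (locally L)); [exact Hlim|].
    apply (ex_derive_continuous (fun y => (y / L) ^ 2)). auto_derive. trivial.
  - apply (filterlim_mult (4 / (2 + 2)) ((L / L) ^ 2)).
Qed.

(** * The product Gamma (1 + a) Gamma (1 - a) *)

Lemma Rpower_pos x a : 0 < Rpower x a.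
Proof. apply exp_pos. Qed.

Lemma Rpower_le_one_plus t a : 0 < t -> 0 <= a <= 1 -> Rpower t a <= 1 + t.
Proof.
  intros Ht Ha. unfold Rpower.
  destruct (Rle_lt_dec (ln t) 0) as [H|H].
  - assert (exp (a * ln t) <= exp 0); [|rewrite exp_0 in *; lra].
    destruct (Req_dec (a * ln t) 0) as [->|]; [lra|]. left. apply exp_increasing. nra.
  - assert (exp (a * ln t) <= exp (ln t)); [|rewrite exp_ln in *; lra].
    destruct (Req_dec (a * ln t) (ln t)) as [->|]; [lra|]. left. apply exp_increasing. nra.
Qed.

Lemma one_plus_exp_neg v : (1 + v) * exp (- v) <= 1.
Proof.
  pose proof (exp_ineq1_le v). pose proof (exp_pos (- v)).
  assert (exp v * exp (- v) = 1) by (rewrite <- exp_plus; replace (v + - v) with 0 by ring; apply exp_0).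
  nra.
Qed.

Lemma one_plus_exp_neg_ge v : 0 <= v -> 1 - v ^ 2 <= (1 + v) * exp (- v).
Proof. intros Hv. pose proof (exp_ineq1_le (- v)). nra. Qed.

(* [Rpower 0 a] is 1 in the library, hence the explicit extension by 0. *)
Definition pow0 (a t : R) : R := if Rle_dec t 0 then 0 else Rpower t a.

Lemma pow0_pos a t : 0 < t -> pow0 a t = Rpower t a.
Proof. intros H. unfold pow0. destruct (Rle_dec t 0); [lra | reflexivity]. Qed.

Lemma pow0_nonneg a t : 0 <= pow0 a t.
Proof. unfold pow0. destruct (Rle_dec t 0); [lra|]. left. apply Rpower_pos. Qed.

Lemma is_derive_Rpower a t : 0 < t -> is_derive (fun t => Rpower t a) t (a * Rpower t (a - 1)).
Proof.
  intros Ht. assert (E : Rpower t (a - 1) = Rpower t a / t).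
  { unfold Rminus. rewrite Rpower_plus, Rpower_Ropp, Rpower_1 by assumption. reflexivity. }
  rewrite E. unfold Rpower. auto_derive; [assumption|]. field. lra.
Qed.

Lemma pow0_continuous a t : 0 < a -> continuous (pow0 a) t.
Proof.
  intros Ha. destruct (Rtotal_order t 0) as [H|[->|H]].
  - apply (continuous_ext_loc _ (fun _ => 0)); [|apply continuous_const].
    assert (Hd : 0 < - t) by lra. exists (mkposreal _ Hd). intros y Hy.
    change (Rabs (y - t) < - t) in Hy. apply Rabs_def2 in Hy.
    unfold pow0. destruct (Rle_dec y 0); [reflexivity | lra].
  - apply continuous_of_eps. intros eta He. exists (Rpower eta (/ a)). split; [apply Rpower_pos|].
    intros y Hy. rewrite Rminus_0_r in Hy. apply Rabs_def2 in Hy.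
    unfold pow0. destruct (Rle_dec 0 0); [|lra]. rewrite Rminus_0_r.
    destruct (Rle_dec y 0); [rewrite Rabs_R0; assumption|].
    rewrite Rabs_right by (left; apply Rpower_pos).
    replace eta with (Rpower (Rpower eta (/ a)) a).
    + apply Rlt_Rpower_l; lra.
    + rewrite Rpower_mult, Rinv_l, Rpower_1 by lra. reflexivity.
  - apply (continuous_ext_loc _ (fun t => Rpower t a)).
    + exists (mkposreal _ H). intros y Hy. change (Rabs (y - t) < t) in Hy. apply Rabs_def2 in Hy.
      symmetry. apply pow0_pos. lra.
    + eapply continuous_of_derive. now apply is_derive_Rpower.
Qed.

(** * Improper integrals of nonnegative functions *)

Lemma RInt_ge_0_cont (f : R -> R) (a b : R) : a <= b ->
  (forall x, a <= x <= b -> continuous f x) -> (forall x, a < x < b -> 0 <= f x) -> 0 <= RInt f a b.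
Proof.
  intros Hab Hc Hf. apply RInt_ge_0; auto.
  apply (ex_RInt_continuous f). rewrite Rmin_left, Rmax_right by lra. exact Hc.
Qed.

(** For a nonnegative integrand the truncated integrals grow with the interval, so the improper
    integral is their supremum. The last two clauses return this in the epsilon form used for the
    truncated Gamma integrals. *)
Lemma improper_integral_of_bounded (f : R -> R) (K : R) :
  (forall t, 0 < t -> continuous f t) -> (forall t, 0 < t -> 0 <= f t) ->
  (forall a b, 0 < a < b -> RInt f a b <= K) ->
  exists l, is_RInt_gen f (at_right 0) (Rbar_locally p_infty) l /\
    (forall a b, 0 < a < b -> RInt f a b <= l) /\
    (forall eta, 0 < eta -> exists a0 b0, 0 < a0 < b0 /\
        forall a b, 0 < a <= a0 -> b0 <= b -> l - eta < RInt f a b).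
Proof.
  intros Hc Hf HK.
  assert (Hex : forall a b, 0 < a <= b -> ex_RInt f a b).
  { intros a b Hab. apply (ex_RInt_continuous f). rewrite Rmin_left, Rmax_right by lra.
    intros z Hz. apply Hc. lra. }
  assert (Hmono : forall a0 b0 a b, 0 < a <= a0 -> a0 <= b0 -> b0 <= b -> RInt f a0 b0 <= RInt f a b).
  { intros a0 b0 a b H1 H2 H3.
    assert (E1 := RInt_Chasles f a a0 b (Hex a a0 ltac:(lra)) (Hex a0 b ltac:(lra))).
    assert (E2 := RInt_Chasles f a0 b0 b (Hex a0 b0 ltac:(lra)) (Hex b0 b ltac:(lra))).
    change (RInt f a a0 + RInt f a0 b = RInt f a b) in E1.
    change (RInt f a0 b0 + RInt f b0 b = RInt f a0 b) in E2.
    assert (0 <= RInt f a a0) by (apply RInt_ge_0_cont; intros; [lra | apply Hc; lra | apply Hf; lra]).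
    assert (0 <= RInt f b0 b) by (apply RInt_ge_0_cont; intros; [lra | apply Hc; lra | apply Hf; lra]).
    lra. }
  destruct (completeness (fun v => exists a b, 0 < a < b /\ v = RInt f a b)) as [l [Hl1 Hl2]].
  { exists K. intros v [a [b [Hab ->]]]. now apply HK. }
  { exists (RInt f 1 2), 1, 2. split; [lra | reflexivity]. }
  assert (Hup : forall a b, 0 < a < b -> RInt f a b <= l).
  { intros a b Hab. apply Hl1. now exists a, b. }
  assert (Hlow : forall eta, 0 < eta -> exists a0 b0, 0 < a0 < b0 /\
        forall a b, 0 < a <= a0 -> b0 <= b -> l - eta < RInt f a b).
  { intros eta He.
    destruct (classic (exists a0 b0, 0 < a0 < b0 /\ l - eta < RInt f a0 b0)) as [[a0 [b0 [H1 H2]]]|Hn].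
    - exists a0, b0. split; [assumption|]. intros a b Ha Hb.
      eapply Rlt_le_trans; [exact H2|]. apply Hmono; lra.
    - exfalso. assert (l <= l - eta); [|lra]. apply Hl2. intros v [a [b [Hab ->]]].
      destruct (Rle_lt_dec (RInt f a b) (l - eta)); [assumption|].
      exfalso. apply Hn. now exists a, b. }
  exists l. split; [|split; assumption].
  apply (proj2 (filterlimi_locally (F := filter_prod (at_right 0) (Rbar_locally p_infty))
           (fun ab : R * R => is_RInt f (fst ab) (snd ab)) l)).
  intros eta. destruct (Hlow eta (cond_pos eta)) as [a0 [b0 [H0 HL]]].
  apply (Filter_prod _ _ _ (fun a => 0 < a <= a0) (fun b => b0 < b)).
  - exists (mkposreal a0 (proj1 H0)). intros y Hy Hy0.
    change (Rabs (y - 0) < a0) in Hy. rewrite Rminus_0_r, Rabs_right in Hy by lra. lra.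
  - exists b0. auto.
  - intros a b Ha Hb. exists (RInt f a b). split.
    + apply (RInt_correct f). apply Hex. simpl. lra.
    + change (Rabs (RInt f a b - l) < eta).
      assert (A := HL a b Ha ltac:(lra)). assert (B := Hup a b ltac:(lra)).
      apply Rabs_def1; [|lra]. pose proof (cond_pos eta). lra.
Qed.

Lemma RInt_le_primitive (f F dF : R -> R) (a b : R) : a <= b ->
  (forall x, a <= x <= b -> continuous f x) ->
  (forall x, a <= x <= b -> is_derive F x (dF x)) ->
  (forall x, a <= x <= b -> f x <= dF x) ->
  RInt f a b <= F b - F a.
Proof.
  intros Hab Hc Hd Hle.
  assert (Hex : forall y, a <= y <= b -> ex_RInt f a y).
  { intros y Hy. apply (ex_RInt_continuous f). rewrite Rmin_left, Rmax_right by lra.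
    intros z Hz. apply Hc. lra. }
  destruct (Req_dec a b) as [->|Hne].
  { rewrite RInt_point. change (0 <= F b - F b). lra. }
  (* The extension by the boundary values is continuous on all of R, so its primitive is
     differentiable at the endpoints too. *)
  set (g := fun x => f (Rmax a (Rmin b x))).
  assert (Hg : forall x, continuous g x).
  { intros x. apply (continuous_comp (fun x => Rmax a (Rmin b x)) f).
    - apply (continuous_of_lipschitz _ 1); [lra|]. intros y. rewrite Rmult_1_l.
      unfold Rmin. destruct (Rle_dec b y), (Rle_dec b x); unfold Rmax;
      repeat match goal with |- context [Rle_dec ?p ?q] => destruct (Rle_dec p q) end;
      unfold Rabs; repeat match goal with |- context [Rcase_abs ?p] => destruct (Rcase_abs p) end; lra.
    - apply Hc. split; [apply Rmax_l|]. apply Rmax_lub; [lra | apply Rmin_l]. }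
  assert (Eg : forall x, a <= x <= b -> g x = f x).
  { intros x Hx. unfold g. rewrite Rmin_right, Rmax_right; [reflexivity | lra | lra]. }
  assert (E : RInt f a b = RInt g a b).
  { apply RInt_ext. rewrite Rmin_left, Rmax_right by lra. intros x Hx. symmetry. apply Eg. lra. }
  rewrite E.
  assert (H : RInt g a b - F b <= RInt g a a - F a).
  { apply (nonincreasing_of_derive (fun x => RInt g a x - F x) (fun x => g x - dF x) a b Hab).
    - intros x Hx. apply (is_derive_minus (RInt g a) F); [now apply is_derive_primitive | apply Hd; lra].
    - intros x Hx. eapply continuous_of_derive.
      apply (is_derive_minus (RInt g a) F); [now apply is_derive_primitive | apply Hd; lra].
    - intros x Hx. rewrite Eg by lra. specialize (Hle x ltac:(lra)). lra. }
  rewrite RInt_point in H. change (RInt g a b - F b <= 0 - F a) in H. lra.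
Qed.

Lemma exp_neg_continuous t : continuous (fun t => exp (- t)) t.
Proof. smooth. Qed.

Lemma gamma_integrand_continuous a t : 0 < t -> continuous (fun t => Rpower t a * exp (- t)) t.
Proof.
  intros Ht. apply (continuous_mult (fun t => Rpower t a) (fun t => exp (- t))); [|apply exp_neg_continuous].
  eapply continuous_of_derive. now apply is_derive_Rpower.
Qed.

(** A primitive of the majorant (1 + t) exp (- t), used for both Gamma integrals. *)
Lemma two_plus_exp_neg_derive t : is_derive (fun t => - ((2 + t) * exp (- t))) t ((1 + t) * exp (- t)).
Proof. auto_derive; [trivial | ring]. Qed.

Lemma gamma_upper_bound a x y : 0 <= a <= 1 -> 0 < x < y ->
  RInt (fun t => Rpower t a * exp (- t)) x y <= 2.
Proof.
  intros Ha Hxy.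
  eapply Rle_trans; [apply (RInt_le_primitive _ (fun t => - ((2 + t) * exp (- t))) (fun t => (1 + t) * exp (- t)))|].
  - lra.
  - intros; apply gamma_integrand_continuous; lra.
  - intros; apply two_plus_exp_neg_derive.
  - intros t Ht. apply Rmult_le_compat_r; [left; apply exp_pos|]. apply Rpower_le_one_plus; lra.
  - pose proof (exp_pos (- y)). pose proof (one_plus_exp_neg x).
    assert (exp (- x) <= 1) by (rewrite <- exp_0; left; apply exp_increasing; lra).
    assert (0 <= (2 + y) * exp (- y)) by (apply Rmult_le_pos; lra). lra.
Qed.

(** The singularity at 0 is removed by parts: t^(1 - a) exp (- t) / (1 - a) has t^(- a) exp (- t) in
    its derivative, and the remaining t^(1 - a) exp (- t) is dominated by (1 + t) exp (- t). *)
Lemma gamma_lower_bound a x y : 0 < a < 1 -> 0 < x < y ->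
  RInt (fun t => Rpower t (- a) * exp (- t)) x y <= 3 / (1 - a).
Proof.
  intros Ha Hxy.
  set (F := fun t => / (1 - a) * (Rpower t (1 - a) * exp (- t) + - ((2 + t) * exp (- t)))).
  set (dF := fun t => / (1 - a) * (((1 - a) * Rpower t (1 - a - 1) * exp (- t)
              + Rpower t (1 - a) * - exp (- t)) + (1 + t) * exp (- t))).
  assert (Hi : 0 < / (1 - a)) by (apply Rinv_0_lt_compat; lra).
  assert (HdF : forall t, 0 < t -> is_derive F t (dF t)).
  { intros t Ht. apply (is_derive_scal (fun t => Rpower t (1 - a) * exp (- t) + - ((2 + t) * exp (- t)))).
    apply (is_derive_plus (fun t => Rpower t (1 - a) * exp (- t)) (fun t => - ((2 + t) * exp (- t))));
      [|apply two_plus_exp_neg_derive].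
    apply (is_derive_mult (fun t => Rpower t (1 - a)) (fun t => exp (- t)));
      [now apply is_derive_Rpower | auto_derive; [trivial | ring] | exact Rmult_comm]. }
  eapply Rle_trans; [apply (RInt_le_primitive _ F dF)|].
  - lra.
  - intros; apply gamma_integrand_continuous; lra.
  - intros; apply HdF; lra.
  - intros t Ht. unfold dF. replace (1 - a - 1) with (- a) by ring.
    assert (B := Rpower_le_one_plus t (1 - a) ltac:(lra) ltac:(lra)).
    pose proof (exp_pos (- t)).
    replace (/ (1 - a) * ((1 - a) * Rpower t (- a) * exp (- t) + Rpower t (1 - a) * - exp (- t) + (1 + t) * exp (- t)))
      with (Rpower t (- a) * exp (- t) + / (1 - a) * ((1 + t - Rpower t (1 - a)) * exp (- t))) by (field; lra).
    assert (0 <= / (1 - a) * ((1 + t - Rpower t (1 - a)) * exp (- t))).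
    { apply Rmult_le_pos; [lra|]. apply Rmult_le_pos; lra. }
    lra.
  - unfold F. rewrite <- Rmult_minus_distr_l. unfold Rdiv. rewrite (Rmult_comm 3).
    apply Rmult_le_compat_l; [lra|].
    assert (B := Rpower_le_one_plus y (1 - a) ltac:(lra) ltac:(lra)).
    pose proof (exp_pos (- y)). pose proof (exp_pos (- x)).
    pose proof (one_plus_exp_neg x). pose proof (one_plus_exp_neg y).
    assert (exp (- x) <= 1) by (rewrite <- exp_0; left; apply exp_increasing; lra).
    assert (0 <= (2 + y) * exp (- y)) by (apply Rmult_le_pos; lra).
    assert (0 < Rpower x (1 - a) * exp (- x)) by (apply Rmult_lt_0_compat; [apply Rpower_pos | assumption]).
    assert (Rpower y (1 - a) * exp (- y) <= (1 + y) * exp (- y)) by (apply Rmult_le_compat_r; lra).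
    lra.
Qed.

Lemma Gamma_is (x l : R) :
  is_RInt_gen (fun t => Rpower t (x - 1) * exp (- t)) (at_right 0) (Rbar_locally p_infty) l -> Gamma x = l.
Proof. intros H. unfold Gamma. apply is_RInt_gen_unique. exact H. Qed.

Lemma Gamma_one_plus a : 0 < a < 1 ->
  (forall x y, 0 < x < y -> RInt (fun t => Rpower t a * exp (- t)) x y <= Gamma (1 + a)) /\
  (forall eta, 0 < eta -> exists x0 y0, 0 < x0 < y0 /\ forall x y, 0 < x <= x0 -> y0 <= y ->
      Gamma (1 + a) - eta < RInt (fun t => Rpower t a * exp (- t)) x y).
Proof.
  intros Ha.
  destruct (improper_integral_of_bounded (fun t => Rpower t a * exp (- t)) 2) as [l [H1 H2]].
  - intros; now apply gamma_integrand_continuous.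
  - intros t Ht. left. apply Rmult_lt_0_compat; [apply Rpower_pos | apply exp_pos].
  - intros; apply gamma_upper_bound; lra.
  - replace (Gamma (1 + a)) with l; [exact H2|]. symmetry. apply Gamma_is.
    now replace (1 + a - 1) with a by ring.
Qed.

Lemma Gamma_one_minus a : 0 < a < 1 ->
  (forall x y, 0 < x < y -> RInt (fun t => Rpower t (- a) * exp (- t)) x y <= Gamma (1 - a)) /\
  (forall eta, 0 < eta -> exists x0 y0, 0 < x0 < y0 /\ forall x y, 0 < x <= x0 -> y0 <= y ->
      Gamma (1 - a) - eta < RInt (fun t => Rpower t (- a) * exp (- t)) x y).
Proof.
  intros Ha.
  destruct (improper_integral_of_bounded (fun t => Rpower t (- a) * exp (- t)) (3 / (1 - a))) as [l [H1 H2]].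
  - intros; now apply gamma_integrand_continuous.
  - intros t Ht. left. apply Rmult_lt_0_compat; [apply Rpower_pos | apply exp_pos].
  - intros; now apply gamma_lower_bound.
  - replace (Gamma (1 - a)) with l; [exact H2|]. symmetry. apply Gamma_is.
    now replace (1 - a - 1) with (- a) by ring.
Qed.

(** The integrand of Gamma (1 + a) extended by 0 to the negative axis, so that the lower incomplete
    Gamma function below is differentiable on all of R. *)
Definition gamma_density (a t : R) : R := pow0 a t * exp (- t).
Definition lower_gamma (a y : R) : R := RInt (gamma_density a) 0 y.

Lemma gamma_density_continuous a t : 0 < a -> continuous (gamma_density a) t.
Proof.
  intros Ha. apply (continuous_mult (pow0 a) (fun t => exp (- t)));
    [now apply pow0_continuous | apply exp_neg_continuous].
Qed.

Lemma gamma_density_bounds a t : 0 < a < 1 -> 0 <= gamma_density a t <= 1.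
Proof.
  intros Ha. unfold gamma_density. pose proof (exp_pos (- t)). split.
  - apply Rmult_le_pos; [apply pow0_nonneg | lra].
  - unfold pow0. destruct (Rle_dec t 0); [lra|].
    assert (B := Rpower_le_one_plus t a ltac:(lra) ltac:(lra)). pose proof (one_plus_exp_neg t).
    assert (Rpower t a * exp (- t) <= (1 + t) * exp (- t)) by (apply Rmult_le_compat_r; lra). lra.
Qed.

Lemma lower_gamma_derive a y : 0 < a -> is_derive (lower_gamma a) y (gamma_density a y).
Proof. intros Ha. apply is_derive_primitive. intros; now apply gamma_density_continuous. Qed.

Lemma lower_gamma_0 a : lower_gamma a 0 = 0.
Proof. unfold lower_gamma. now rewrite RInt_point. Qed.

Lemma lower_gamma_mono a x y : 0 < a < 1 -> x <= y -> lower_gamma a x <= lower_gamma a y.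
Proof.
  intros Ha Hxy. apply (nondecreasing_of_derive _ (gamma_density a)); auto.
  - intros; apply lower_gamma_derive; lra.
  - intros; eapply continuous_of_derive; apply lower_gamma_derive; lra.
  - intros; now apply gamma_density_bounds.
Qed.

Lemma lower_gamma_le a y : 0 < a < 1 -> 0 <= y -> lower_gamma a y <= y.
Proof.
  intros Ha Hy.
  assert (lower_gamma a y - y <= lower_gamma a 0 - 0); [|rewrite lower_gamma_0 in *; lra].
  apply (nonincreasing_of_derive (fun y => lower_gamma a y - y) (fun y => gamma_density a y - 1)); auto.
  - intros. apply (is_derive_minus (lower_gamma a) (fun y => y));
      [apply lower_gamma_derive; lra | apply @is_derive_id].
  - intros. eapply continuous_of_derive.
    apply (is_derive_minus (lower_gamma a) (fun y => y)); [apply lower_gamma_derive; lra | apply @is_derive_id].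
  - intros x _. pose proof (gamma_density_bounds a x Ha). lra.
Qed.

Lemma lower_gamma_diff a x y : 0 < a -> 0 < x <= y ->
  RInt (fun t => Rpower t a * exp (- t)) x y = lower_gamma a y - lower_gamma a x.
Proof.
  intros Ha Hxy.
  assert (Hex : forall p q, ex_RInt (gamma_density a) p q).
  { intros. apply ex_RInt_cont. intros; now apply gamma_density_continuous. }
  assert (E := RInt_Chasles (gamma_density a) 0 x y (Hex _ _) (Hex _ _)).
  change (lower_gamma a x + RInt (gamma_density a) x y = lower_gamma a y) in E.
  rewrite <- E. rewrite (RInt_ext _ (gamma_density a)).
  - change (RInt (gamma_density a) x y = lower_gamma a x + RInt (gamma_density a) x y - lower_gamma a x).
    assert (Er : forall u v : R, v = u + v - u) by (intros; ring). apply Er.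
  - rewrite Rmin_left, Rmax_right by lra. intros t Ht. unfold gamma_density. now rewrite pow0_pos by lra.
Qed.

Lemma lower_gamma_le_Gamma a y : 0 < a < 1 -> lower_gamma a y <= Gamma (1 + a).
Proof.
  intros Ha. destruct (Gamma_one_plus a Ha) as [H _].
  assert (HG : 0 <= Gamma (1 + a)).
  { eapply Rle_trans; [|apply (H 1 2); lra]. rewrite lower_gamma_diff by lra.
    pose proof (lower_gamma_mono a 1 2 Ha). lra. }
  destruct (Rle_lt_dec y 0) as [Hy|Hy].
  { pose proof (lower_gamma_mono a y 0 Ha Hy). rewrite lower_gamma_0 in *. lra. }
  destruct (Rle_lt_dec (lower_gamma a y) (Gamma (1 + a))) as [|Hgt]; [assumption|exfalso].
  set (x := Rmin (y / 2) ((lower_gamma a y - Gamma (1 + a)) / 2)).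
  assert (x <= y / 2) by apply Rmin_l.
  assert (x <= (lower_gamma a y - Gamma (1 + a)) / 2) by apply Rmin_r.
  assert (Hx : 0 < x) by (apply Rmin_glb_lt; lra).
  assert (A := H x y ltac:(lra)). rewrite lower_gamma_diff in A by lra.
  pose proof (lower_gamma_le a x Ha). lra.
Qed.

Lemma lower_gamma_tends a eta : 0 < a < 1 -> 0 < eta ->
  exists y0, 0 < y0 /\ forall y, y0 <= y -> Gamma (1 + a) - eta < lower_gamma a y.
Proof.
  intros Ha He. destruct (Gamma_one_plus a Ha) as [_ H].
  destruct (H eta He) as [x0 [y0 [H0 H1]]]. exists y0. split; [lra|].
  intros y Hy. specialize (H1 x0 y ltac:(lra) Hy). rewrite lower_gamma_diff in H1 by lra.
  pose proof (lower_gamma_mono a 0 x0 Ha). rewrite lower_gamma_0 in *. lra.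
Qed.

(** Over (0, infinity) this integrates to the Beta value B(1 + a, 1 - a) = Gamma (1 + a) Gamma (1 -
    a), as Gamma 2 = 1. The absolute value keeps the denominator positive for negative v. *)
Definition beta_density (a v : R) : R := pow0 a v / (1 + Rabs v) ^ 2.
Definition lower_beta (a v : R) : R := RInt (beta_density a) 0 v.

Lemma beta_density_continuous a v : 0 < a -> continuous (beta_density a) v.
Proof.
  intros Ha. apply (continuous_mult (pow0 a) (fun v => / (1 + Rabs v) ^ 2)); [now apply pow0_continuous|].
  apply (continuous_comp Rabs (fun r => / (1 + r) ^ 2)); [apply continuous_Rabs|].
  apply (ex_derive_continuous (fun r => / (1 + r) ^ 2)). auto_derive.
  pose proof (Rabs_pos v). nra.
Qed.

Lemma beta_density_pos a v : 0 < v -> beta_density a v = Rpower v a / (1 + v) ^ 2.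
Proof. intros H. unfold beta_density. rewrite pow0_pos, Rabs_right by lra. reflexivity. Qed.

Lemma lower_beta_derive a v : 0 < a -> is_derive (lower_beta a) v (beta_density a v).
Proof. intros Ha. apply is_derive_primitive. intros; now apply beta_density_continuous. Qed.

Lemma beta_density_nonneg a v : 0 <= beta_density a v.
Proof.
  apply Rdiv_le_0_compat; [apply pow0_nonneg|]. apply pow_lt. pose proof (Rabs_pos v). lra.
Qed.

Lemma lower_beta_mono a x y : 0 < a -> x <= y -> lower_beta a x <= lower_beta a y.
Proof.
  intros Ha Hxy. apply (nondecreasing_of_derive _ (beta_density a)); auto.
  - intros; now apply lower_beta_derive.
  - intros; eapply continuous_of_derive; now apply lower_beta_derive.
  - intros; apply beta_density_nonneg.
Qed.

Lemma lower_beta_0 a : lower_beta a 0 = 0.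
Proof. unfold lower_beta. now rewrite RInt_point. Qed.

Lemma lower_beta_le a v : 0 < a < 1 -> 0 <= v -> lower_beta a v <= v.
Proof.
  intros Ha Hv.
  assert (lower_beta a v - v <= lower_beta a 0 - 0); [|rewrite lower_beta_0 in *; lra].
  assert (Hd : forall y, is_derive (fun y => lower_beta a y - y) y (beta_density a y - 1)).
  { intros y. apply (is_derive_minus (lower_beta a) (fun y => y));
      [apply lower_beta_derive; lra | apply @is_derive_id]. }
  apply (nonincreasing_of_derive (fun y => lower_beta a y - y) (fun y => beta_density a y - 1)); auto.
  - intros. eapply continuous_of_derive. apply Hd.
  - intros x Hx. rewrite beta_density_pos by lra.
    assert (B := Rpower_le_one_plus x a ltac:(lra) ltac:(lra)).
    assert (Rpower x a / (1 + x) ^ 2 <= 1); [|lra].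
    apply Rmult_le_reg_r with ((1 + x) ^ 2); [apply pow_lt; lra|].
    unfold Rdiv. rewrite Rmult_assoc, Rinv_l by (apply pow_nonzero; lra). nra.
Qed.

(** * A truncated double Gamma integral and the Beta integral *)

Definition tail_weight (a x : R) : R := Rpower x (- a) * exp (- x).

(* Integrating [d/dy] of this over [y > 0] computes Gamma (1 + a) Gamma (1 - a) in two ways. *)
Definition gamma_convolution (a e T y : R) : R :=
  RInt (fun x => tail_weight a x * lower_gamma a (y * x)) e T.

Lemma tail_weight_continuous a x : 0 < x -> continuous (tail_weight a) x.
Proof. apply gamma_integrand_continuous. Qed.

Lemma convolution_integrand_derive a x u : 0 < a ->
  is_derive (fun z => tail_weight a x * lower_gamma a (z * x)) u
    (tail_weight a x * (x * gamma_density a (u * x))).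
Proof.
  intros Ha. apply (is_derive_scal (fun z => lower_gamma a (z * x))).
  assert (Hz : is_derive (fun z => z * x) u x) by (auto_derive; [trivial | ring]).
  exact (is_derive_comp (lower_gamma a) (fun z => z * x) u _ _ (lower_gamma_derive a _ Ha) Hz).
Qed.

Lemma convolution_ex a e T y : 0 < a -> 0 < e <= T ->
  ex_RInt (fun x => tail_weight a x * lower_gamma a (y * x)) e T.
Proof.
  intros Ha He. apply (ex_RInt_continuous (fun x => tail_weight a x * lower_gamma a (y * x))).
  rewrite Rmin_left, Rmax_right by lra. intros x Hx.
  apply (continuous_mult (tail_weight a) (fun x => lower_gamma a (y * x))).
  - apply tail_weight_continuous. lra.
  - apply (continuous_comp (fun x => y * x) (lower_gamma a)).
    + smooth.
    + eapply continuous_of_derive. now apply lower_gamma_derive.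
Qed.

(** In x, a primitive of x exp (- x (1 + y)), whose integral over (0, infinity) is 1 / (1 + y)^2. *)
Definition linear_exp_primitive (y x : R) : R := - ((x / (1 + y) + / (1 + y) ^ 2) * exp (- (x * (1 + y)))).

(** Differentiating under the integral brings out x (y x)^a exp (- y x); the factor x^a cancels
    against the weight x^(- a), and an elementary integral times y^a remains. *)
Lemma convolution_derive a e T y : 0 < a -> 0 < e <= T -> 0 < y ->
  is_derive (gamma_convolution a e T) y
    (Rpower y a * (linear_exp_primitive y T - linear_exp_primitive y e)).
Proof.
  intros Ha He Hy.
  assert (HD : forall u v, Derive (fun z => tail_weight a v * lower_gamma a (z * v)) u
               = tail_weight a v * (v * gamma_density a (u * v))).
  { intros u v. apply is_derive_unique. now apply convolution_integrand_derive. }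
  assert (A : is_derive (gamma_convolution a e T) y
     (RInt (fun t => Derive (fun u => tail_weight a t * lower_gamma a (u * t)) y) e T)).
  { apply (is_derive_RInt_param (fun y x => tail_weight a x * lower_gamma a (y * x)) e T y).
    - exists (mkposreal 1 Rlt_0_1). intros u _ t _. eexists. now apply convolution_integrand_derive.
    - rewrite Rmin_left, Rmax_right by lra. intros t Ht.
      apply (continuity_2d_pt_ext (fun u v => (tail_weight a v * v) * gamma_density a (u * v))).
      { intros u v. rewrite HD. ring. }
      apply continuity_2d_pt_mult.
      + apply (continuity_1d_2d_pt_comp (fun v => tail_weight a v * v) (fun u v => v)).
        * apply continuity_pt_filterlim.
          apply (continuous_mult (tail_weight a) (fun v => v)); [apply tail_weight_continuous; lra | apply continuous_id].
        * apply continuity_2d_pt_id2.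
      + apply (continuity_1d_2d_pt_comp (gamma_density a) (fun u v => u * v)).
        * apply continuity_pt_filterlim. now apply gamma_density_continuous.
        * apply continuity_2d_pt_mult; [apply continuity_2d_pt_id1 | apply continuity_2d_pt_id2].
    - exists (mkposreal 1 Rlt_0_1). intros u _. now apply convolution_ex. }
  eapply eq_rect; [exact A|].
  assert (B : is_RInt (fun x => Rpower y a * (x * exp (- (x * (1 + y))))) e T
    (minus (Rpower y a * linear_exp_primitive y T) (Rpower y a * linear_exp_primitive y e))).
  { apply (is_RInt_derive (fun x => Rpower y a * linear_exp_primitive y x)).
    - intros x _. apply (is_derive_scal (linear_exp_primitive y)). unfold linear_exp_primitive.
      auto_derive; [trivial|]. field. lra.
    - intros x _. apply (ex_derive_continuous (fun x => Rpower y a * (x * exp (- (x * (1 + y)))))).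
      auto_derive. trivial. }
  rewrite (RInt_ext _ (fun x => Rpower y a * (x * exp (- (x * (1 + y)))))).
  - rewrite (is_RInt_unique _ _ _ _ B).
    change (Rpower y a * linear_exp_primitive y T - Rpower y a * linear_exp_primitive y e
            = Rpower y a * (linear_exp_primitive y T - linear_exp_primitive y e)). ring.
  - rewrite Rmin_left, Rmax_right by lra. intros x Hx. rewrite HD.
    unfold tail_weight, gamma_density. rewrite pow0_pos by nra.
    rewrite <- Rpower_mult_distr by lra. rewrite Rpower_Ropp.
    replace (- (x * (1 + y))) with (- x + - (y * x)) by ring. rewrite exp_plus.
    pose proof (Rpower_pos x a).
    assert (Er : forall p q r s t : R, p <> 0 -> / p * r * (x * (q * p * s)) = q * (x * (r * s))).
    { intros. field. assumption. }
    apply Er; [assumption | lra].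
Qed.

(** Cutting at e loses at most e^2, since 1 - (1 + v) exp (- v) <= v^2 with v = e (1 + y) and the
    prefactor is 1 / (1 + y)^2. Cutting at T loses at most (T + 1) exp (- T). Both are uniform in
    y. *)
Lemma convolution_slope_bounds e T y : 0 < e <= T -> 0 < y ->
  / (1 + y) ^ 2 - (e ^ 2 + (T + 1) * exp (- T))
   <= linear_exp_primitive y T - linear_exp_primitive y e <= / (1 + y) ^ 2.
Proof.
  intros He Hy. unfold linear_exp_primitive.
  set (m := / (1 + y)). assert (Hm : 0 < m < 1).
  { unfold m. split; [apply Rinv_0_lt_compat; lra|]. rewrite <- Rinv_1. apply Rinv_lt_contravar; lra. }
  assert (Em : m * (1 + y) = 1) by (unfold m; field; lra).
  replace (/ (1 + y) ^ 2) with (m ^ 2) by (unfold m; field; lra).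
  replace (e / (1 + y)) with (m ^ 2 * (e * (1 + y))) by (unfold m; field; lra).
  replace (T / (1 + y)) with (T * m) by reflexivity.
  set (v := e * (1 + y)). assert (Hv : 0 <= v) by (unfold v; apply Rmult_le_pos; lra).
  assert (A1 := one_plus_exp_neg v). assert (A2 := one_plus_exp_neg_ge v Hv).
  assert (Hm2 : 0 < m ^ 2 < 1) by nra.
  assert (Ev : m ^ 2 * v ^ 2 = e ^ 2).
  { unfold v. replace (m ^ 2 * (e * (1 + y)) ^ 2) with (e ^ 2 * (m * (1 + y)) ^ 2) by ring. rewrite Em. ring. }
  assert (HexpT : exp (- (T * (1 + y))) <= exp (- T)) by (left; apply exp_increasing; nra).
  pose proof (exp_pos (- (T * (1 + y)))).
  assert (B : 0 <= (T * m + m ^ 2) * exp (- (T * (1 + y))) <= (T + 1) * exp (- T)).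
  { split; [apply Rmult_le_pos; nra|]. apply Rmult_le_compat; nra. }
  assert (C1 : m ^ 2 * ((1 + v) * exp (- v)) <= m ^ 2 * 1) by (apply Rmult_le_compat_l; lra).
  assert (C2 : m ^ 2 * (1 - v ^ 2) <= m ^ 2 * ((1 + v) * exp (- v))) by (apply Rmult_le_compat_l; lra).
  split; nra.
Qed.

(** The slope bounds are multiplied by y^a and integrated from y1 to y2; in the error term y^a is
    replaced by its largest value y2^a. *)
Lemma convolution_increment a e T y1 y2 : 0 < a -> 0 < e <= T -> 0 < y1 <= y2 ->
  lower_beta a y2 - lower_beta a y1 - (e ^ 2 + (T + 1) * exp (- T)) * (Rpower y2 a * (y2 - y1))
    <= gamma_convolution a e T y2 - gamma_convolution a e T y1
    <= lower_beta a y2 - lower_beta a y1.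
Proof.
  intros Ha He Hy. set (er := e ^ 2 + (T + 1) * exp (- T)).
  assert (Her : 0 <= er).
  { unfold er. pose proof (exp_pos (- T)). pose proof (pow2_ge_0 e).
    assert (0 <= (T + 1) * exp (- T)) by (apply Rmult_le_pos; lra). lra. }
  set (dI := fun y => Rpower y a * (linear_exp_primitive y T - linear_exp_primitive y e)).
  assert (Hd : forall y, 0 < y -> is_derive (gamma_convolution a e T) y (dI y)).
  { intros; now apply convolution_derive. }
  split.
  - assert (H : gamma_convolution a e T y1 - lower_beta a y1 + er * Rpower y2 a * y1
              <= gamma_convolution a e T y2 - lower_beta a y2 + er * Rpower y2 a * y2); [|lra].
    assert (HD : forall y, 0 < y ->
      is_derive (fun y => gamma_convolution a e T y - lower_beta a y + er * Rpower y2 a * y) y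
        (dI y - beta_density a y + er * Rpower y2 a)).
    { intros y Hy0. apply (is_derive_plus (fun y => gamma_convolution a e T y - lower_beta a y)
                             (fun y => er * Rpower y2 a * y)).
      - apply (is_derive_minus (gamma_convolution a e T) (lower_beta a)); [now apply Hd | now apply lower_beta_derive].
      - auto_derive; [trivial | ring]. }
    apply (nondecreasing_of_derive (fun y => gamma_convolution a e T y - lower_beta a y + er * Rpower y2 a * y)
       (fun y => dI y - beta_density a y + er * Rpower y2 a)); [lra| | |].
    + intros; apply HD; lra.
    + intros; eapply continuous_of_derive; apply HD; lra.
    + intros y Hy0. destruct (convolution_slope_bounds e T y He ltac:(lra)) as [B _].
      fold er in B. unfold dI. rewrite beta_density_pos by lra.
      assert (Hp : Rpower y a <= Rpower y2 a) by (left; apply Rlt_Rpower_l; lra).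
      pose proof (Rpower_pos y a).
      assert (Rpower y a * (/ (1 + y) ^ 2 - er)
        <= Rpower y a * (linear_exp_primitive y T - linear_exp_primitive y e)) by (apply Rmult_le_compat_l; lra).
      assert (er * Rpower y a <= er * Rpower y2 a) by (apply Rmult_le_compat_l; lra).
      unfold Rdiv. lra.
  - assert (H : gamma_convolution a e T y2 - lower_beta a y2
              <= gamma_convolution a e T y1 - lower_beta a y1); [|lra].
    assert (HD : forall y, 0 < y ->
      is_derive (fun y => gamma_convolution a e T y - lower_beta a y) y (dI y - beta_density a y)).
    { intros y Hy0. apply (is_derive_minus (gamma_convolution a e T) (lower_beta a));
        [now apply Hd | now apply lower_beta_derive]. }
    apply (nonincreasing_of_derive (fun y => gamma_convolution a e T y - lower_beta a y)
       (fun y => dI y - beta_density a y)); [lra| | |].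
    + intros; apply HD; lra.
    + intros; eapply continuous_of_derive; apply HD; lra.
    + intros y Hy0. destruct (convolution_slope_bounds e T y He ltac:(lra)) as [_ B].
      unfold dI. rewrite beta_density_pos by lra. pose proof (Rpower_pos y a).
      assert (Rpower y a * (linear_exp_primitive y T - linear_exp_primitive y e)
               <= Rpower y a * / (1 + y) ^ 2) by (apply Rmult_le_compat_l; lra).
      unfold Rdiv. lra.
Qed.

Lemma convolution_bounds a e T y : 0 < a < 1 -> 0 < e < T -> 0 < y ->
  lower_gamma a (y * e) * RInt (tail_weight a) e T <= gamma_convolution a e T y
    <= lower_gamma a (y * T) * RInt (tail_weight a) e T.
Proof.
  intros Ha He Hy.
  assert (Hex : ex_RInt (tail_weight a) e T).
  { apply (ex_RInt_continuous (tail_weight a)). rewrite Rmin_left, Rmax_right by lra.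
    intros; apply tail_weight_continuous; lra. }
  assert (Hpos : forall x, 0 <= tail_weight a x).
  { intros x. left. apply Rmult_lt_0_compat; [apply Rpower_pos | apply exp_pos]. }
  assert (Es : forall m, m * RInt (tail_weight a) e T = RInt (fun x => m * tail_weight a x) e T).
  { intros m. symmetry. apply (RInt_scal (tail_weight a) e T m Hex). }
  assert (Hs : forall m, ex_RInt (fun x => m * tail_weight a x) e T).
  { intros m. apply (ex_RInt_scal (tail_weight a) e T m Hex). }
  assert (Hc := convolution_ex a e T y (proj1 Ha) ltac:(lra)).
  rewrite !Es. unfold gamma_convolution. split; apply RInt_le; auto; try lra; intros x Hx; rewrite Rmult_comm.
  - apply Rmult_le_compat_l; [apply Hpos|]. apply lower_gamma_mono; [assumption | nra].
  - rewrite (Rmult_comm (lower_gamma a (y * T))). rewrite Rmult_comm.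
    apply Rmult_le_compat_l; [apply Hpos|]. apply lower_gamma_mono; [assumption | nra].
Qed.

Lemma le_of_le_add_eps a b : (forall eta, 0 < eta -> a <= b + eta) -> a <= b.
Proof. intros H. destruct (Rle_lt_dec a b); [assumption|]. specialize (H ((a - b) / 2)). lra. Qed.

(** The increment of the convolution from a tiny y1 to v is at most the product of the two Gamma
    values, for every truncation. Choosing e small and T large makes the truncation error
    negligible, and y1 small makes the omitted initial part of the Beta integral negligible. *)
Lemma lower_beta_le_Gamma a v : 0 < a < 1 -> 0 < v ->
  lower_beta a v <= Gamma (1 + a) * Gamma (1 - a).
Proof.
  intros Ha Hv. destruct (Gamma_one_minus a Ha) as [HN HN2].
  assert (HGp : 0 <= Gamma (1 + a)).
  { pose proof (lower_gamma_le_Gamma a 0 Ha). rewrite lower_gamma_0 in *. lra. }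
  apply le_of_le_add_eps. intros eta He.
  set (A := Rpower v a * v). assert (HA : 0 < A) by (apply Rmult_lt_0_compat; [apply Rpower_pos | lra]).
  set (y1 := Rmin (v / 2) (eta / 4)).
  assert (Hy1 : 0 < y1) by (apply Rmin_glb_lt; lra).
  assert (Hy1v : y1 <= v / 2) by apply Rmin_l. assert (Hy1e : y1 <= eta / 4) by apply Rmin_r.
  assert (Hlim : is_lim (fun T => (T + 1) * exp (- T)) p_infty 0).
  { apply (is_lim_le_le_loc (fun _ => 0) (fun T => 4 / T)).
    - exists 1. intros T HT. pose proof (exp_pos (- T)). split; [apply Rmult_le_pos; lra|].
      apply Rmult_le_reg_r with T; [lra|]. unfold Rdiv. rewrite (Rmult_assoc 4), Rinv_l, Rmult_1_r by lra.
      set (h := T / 2). assert (E : exp (- T) = exp (- h) * exp (- h)).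
      { rewrite <- exp_plus. f_equal. unfold h. field. }
      assert (Hh := one_plus_exp_neg h). pose proof (exp_pos (- h)).
      assert (Hh2 : ((1 + h) * exp (- h)) * ((1 + h) * exp (- h)) <= 1 * 1).
      { apply Rmult_le_compat; try lra; apply Rmult_le_pos; unfold h in *; lra. }
      rewrite E. replace T with (2 * h) by (unfold h; field).
      assert (0 <= exp (- h) * exp (- h)) by nra.
      assert (((2 * h + 1) * (2 * h)) * (exp (- h) * exp (- h)) <= (4 * ((1 + h) * (1 + h))) * (exp (- h) * exp (- h))).
      { apply Rmult_le_compat_r; [assumption|]. unfold h in *. nra. }
      nra.
    - apply is_lim_const.
    - apply is_lim_p_infty_iff. intros d Hd. exists (4 / d). intros T HT.
      assert (0 < 4 / d) by (apply Rdiv_lt_0_compat; lra).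
      assert (0 < 4 / T) by (apply Rdiv_lt_0_compat; lra).
      rewrite Rminus_0_r, Rabs_right by lra.
      apply Rmult_lt_reg_r with T; [lra|]. unfold Rdiv. rewrite Rmult_assoc, Rinv_l, Rmult_1_r by lra.
      apply (Rmult_lt_compat_r d) in HT; [|lra].
      replace (4 / d * d) with 4 in HT by (field; lra). lra. }
  rewrite is_lim_p_infty_iff in Hlim.
  destruct (Hlim (eta / 4 / A)) as [M HM]; [repeat apply Rdiv_lt_0_compat; lra|].
  set (e := Rmin (/ 2) (eta / 4 / A)).
  assert (HeA : 0 < eta / 4 / A) by (repeat apply Rdiv_lt_0_compat; lra).
  assert (He0 : 0 < e) by (apply Rmin_glb_lt; lra).
  assert (He1 : e <= / 2) by apply Rmin_l. assert (He2 : e <= eta / 4 / A) by apply Rmin_r.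
  set (T := Rmax 1 (M + 1)). assert (1 <= T) by apply Rmax_l. assert (M + 1 <= T) by apply Rmax_r.
  specialize (HM T ltac:(lra)). rewrite Rminus_0_r in HM. apply Rabs_def2 in HM.
  destruct (convolution_increment a e T y1 v (proj1 Ha) ltac:(lra) ltac:(lra)) as [B _].
  destruct (convolution_bounds a e T v Ha ltac:(lra) Hv) as [_ B2].
  destruct (convolution_bounds a e T y1 Ha ltac:(lra) Hy1) as [B3 _].
  assert (HNp : 0 <= RInt (tail_weight a) e T).
  { apply RInt_ge_0_cont; [lra| |].
    - intros; apply tail_weight_continuous; lra.
    - intros. left. apply Rmult_lt_0_compat; [apply Rpower_pos | apply exp_pos]. }
  assert (HNe := HN e T ltac:(lra)). change (RInt (tail_weight a) e T <= Gamma (1 - a)) in HNe.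
  assert (B4 : 0 <= lower_gamma a (y1 * e) * RInt (tail_weight a) e T).
  { apply Rmult_le_pos; [|assumption]. rewrite <- (lower_gamma_0 a). apply lower_gamma_mono; [assumption | nra]. }
  assert (B5 : lower_gamma a (v * T) * RInt (tail_weight a) e T <= Gamma (1 + a) * Gamma (1 - a)).
  { apply Rmult_le_compat; auto; [|now apply lower_gamma_le_Gamma].
    rewrite <- (lower_gamma_0 a). apply lower_gamma_mono; [assumption | nra]. }
  assert (B6 := lower_beta_le a y1 Ha ltac:(lra)).
  assert (B7 : (e ^ 2 + (T + 1) * exp (- T)) * (Rpower v a * (v - y1)) <= (eta / 4 / A + eta / 4 / A) * A).
  { apply Rmult_le_compat.
    - pose proof (exp_pos (- T)). pose proof (pow2_ge_0 e).
      assert (0 <= (T + 1) * exp (- T)) by (apply Rmult_le_pos; lra). lra.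
    - apply Rmult_le_pos; [left; apply Rpower_pos | lra].
    - apply Rplus_le_compat; nra.
    - unfold A. apply Rmult_le_compat_l; [left; apply Rpower_pos | lra]. }
  replace ((eta / 4 / A + eta / 4 / A) * A) with (eta / 2) in B7 by (field; lra). lra.
Qed.

(** The order of choices matters: first e and T, so that the truncated Gamma (1 - a) is nearly
    complete; then v so large that the inner integral up to v e is nearly Gamma (1 + a); finally y1
    so small that the convolution at y1 is negligible. *)
Lemma lower_beta_tends a eta : 0 < a < 1 -> 0 < eta ->
  exists v0, 0 < v0 /\ forall v, v0 <= v -> Gamma (1 + a) * Gamma (1 - a) - eta < lower_beta a v.
Proof.
  intros Ha He. destruct (Gamma_one_minus a Ha) as [HN HN2].
  assert (HGp : 0 <= Gamma (1 + a)).
  { pose proof (lower_gamma_le_Gamma a 0 Ha). rewrite lower_gamma_0 in *. lra. }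
  assert (HGm : 0 <= Gamma (1 - a)).
  { eapply Rle_trans; [|apply (HN 1 2); lra]. apply RInt_ge_0_cont; [lra| |].
    - intros; apply tail_weight_continuous; lra.
    - intros. left. apply Rmult_lt_0_compat; [apply Rpower_pos | apply exp_pos]. }
  set (S := Gamma (1 + a) + Gamma (1 - a) + 1).
  set (d := eta / 2 / S). assert (HS : 0 < S) by (unfold S; lra).
  assert (Hd : 0 < d) by (repeat apply Rdiv_lt_0_compat; lra).
  assert (EdS : d * S = eta / 2) by (unfold d; field; lra).
  destruct (HN2 d Hd) as [e [T [HeT HNlow]]]. specialize (HNlow e T ltac:(lra) ltac:(lra)).
  change (Gamma (1 - a) - d < RInt (tail_weight a) e T) in HNlow.
  destruct (lower_gamma_tends a d Ha Hd) as [y0 [Hy0 Hlow]].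
  exists (y0 / e + 1). assert (Hye : 0 < y0 / e) by (apply Rdiv_lt_0_compat; lra). split; [lra|].
  intros v Hv.
  assert (Hve : y0 <= v * e).
  { assert (A := Rmult_le_compat_r e (y0 / e + 1) v ltac:(lra) Hv).
    replace ((y0 / e + 1) * e) with (y0 + e) in A by (field; lra). lra. }
  specialize (Hlow (v * e) Hve).
  set (N := RInt (tail_weight a) e T) in *.
  assert (HNe := HN e T HeT). change (N <= Gamma (1 - a)) in HNe.
  assert (HNp : 0 <= N).
  { apply RInt_ge_0_cont; [lra| |].
    - intros; apply tail_weight_continuous; lra.
    - intros. left. apply Rmult_lt_0_compat; [apply Rpower_pos | apply exp_pos]. }
  set (y1 := Rmin v (eta / 4 / (T * (Gamma (1 - a) + 1)))).
  assert (HTG : 0 < T * (Gamma (1 - a) + 1)) by (apply Rmult_lt_0_compat; lra).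
  assert (Hy1 : 0 < y1) by (apply Rmin_glb_lt; [lra | repeat apply Rdiv_lt_0_compat; lra]).
  assert (Hy1v : y1 <= v) by apply Rmin_l.
  assert (Hy1s : y1 * (T * (Gamma (1 - a) + 1)) <= eta / 4).
  { assert (y1 <= eta / 4 / (T * (Gamma (1 - a) + 1))) by apply Rmin_r.
    apply Rmult_le_compat_r with (r := T * (Gamma (1 - a) + 1)) in H; [|lra].
    replace (eta / 4 / (T * (Gamma (1 - a) + 1)) * (T * (Gamma (1 - a) + 1))) with (eta / 4) in H by (field; lra).
    exact H. }
  destruct (convolution_increment a e T y1 v (proj1 Ha) ltac:(lra) ltac:(lra)) as [_ B].
  destruct (convolution_bounds a e T v Ha ltac:(lra) ltac:(lra)) as [B2 _].
  destruct (convolution_bounds a e T y1 Ha ltac:(lra) Hy1) as [_ B3]. fold N in B2, B3.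
  assert (B4 : lower_gamma a (y1 * T) * N <= eta / 4).
  { eapply Rle_trans; [|exact Hy1s]. rewrite <- Rmult_assoc.
    apply Rmult_le_compat; auto; [|apply lower_gamma_le; [assumption | nra] | lra].
    rewrite <- (lower_gamma_0 a). apply lower_gamma_mono; [assumption | nra]. }
  assert (B5 : 0 <= lower_beta a y1) by (rewrite <- (lower_beta_0 a); apply lower_beta_mono; lra).
  assert (B6 := lower_gamma_le_Gamma a (v * e) Ha).
  set (P := lower_gamma a (v * e)) in *.
  assert (B7 : Gamma (1 + a) * Gamma (1 - a) - P * N <= d * S).
  { replace (Gamma (1 + a) * Gamma (1 - a) - P * N)
      with (Gamma (1 + a) * (Gamma (1 - a) - N) + (Gamma (1 + a) - P) * N) by ring.
    unfold S. assert (Gamma (1 + a) * (Gamma (1 - a) - N) <= Gamma (1 + a) * d) by (apply Rmult_le_compat_l; lra).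
    assert ((Gamma (1 + a) - P) * N <= d * Gamma (1 - a)) by (apply Rmult_le_compat; lra). lra. }
  lra.
Qed.

(** The substitution v = t / (1 - t) turns the integral of (t / (1 - t))^a over (0, x) into the Beta
    integral up to x / (1 - x). *)
Definition odds_primitive (a x : R) : R := lower_beta a (x / (1 - x)).

Lemma odds_primitive_derive a x : 0 < a -> 0 < x < 1 ->
  is_derive (odds_primitive a) x (Rpower (x / (1 - x)) a).
Proof.
  intros Ha Hx. assert (Hq : 0 < x / (1 - x)) by (apply Rdiv_lt_0_compat; lra).
  assert (Hz : is_derive (fun x => x / (1 - x)) x (/ (1 - x) ^ 2)).
  { auto_derive; [lra|]. field. lra. }
  assert (A := is_derive_comp (lower_beta a) (fun x => x / (1 - x)) x _ _ (lower_beta_derive a _ Ha) Hz).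
  eapply eq_rect; [exact A|].
  change (/ (1 - x) ^ 2 * beta_density a (x / (1 - x)) = Rpower (x / (1 - x)) a).
  rewrite beta_density_pos by assumption.
  replace (1 + x / (1 - x)) with (/ (1 - x)) by (field; lra). field. lra.
Qed.

Lemma odds_primitive_bounds a x : 0 < a < 1 -> 0 < x < 1 -> 0 <= odds_primitive a x <= x / (1 - x).
Proof.
  intros Ha Hx. assert (Hq : 0 < x / (1 - x)) by (apply Rdiv_lt_0_compat; lra). split.
  - rewrite <- (lower_beta_0 a). apply lower_beta_mono; lra.
  - apply lower_beta_le; [assumption | lra].
Qed.

Lemma odds_primitive_limit a : 0 < a < 1 ->
  filterlim (fun u => odds_primitive a (1 - u)) (at_right 0) (locally (Gamma (1 + a) * Gamma (1 - a))).
Proof.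
  intros Ha. apply filterlim_locally. intros eta.
  destruct (lower_beta_tends a eta Ha (cond_pos eta)) as [v0 [Hv0 H]].
  assert (Hd : 0 < / (1 + v0)) by (apply Rinv_0_lt_compat; lra).
  assert (Hd1 : / (1 + v0) < 1) by (rewrite <- Rinv_1; apply Rinv_lt_contravar; lra).
  exists (mkposreal _ Hd). intros u Hu Hu0.
  change (Rabs (u - 0) < / (1 + v0)) in Hu. rewrite Rminus_0_r, Rabs_right in Hu by lra.
  change (Rabs (odds_primitive a (1 - u) - Gamma (1 + a) * Gamma (1 - a)) < eta).
  unfold odds_primitive. assert (Er : forall w : R, 1 - (1 - w) = w) by (intros; ring). rewrite Er.
  assert (Hv : v0 <= (1 - u) / u).
  { apply Rmult_le_reg_r with u; [assumption|]. unfold Rdiv. rewrite Rmult_assoc, Rinv_l, Rmult_1_r by lra.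
    apply (Rmult_lt_compat_r (1 + v0)) in Hu; [|lra]. rewrite Rinv_l in Hu by lra. lra. }
  assert (A := H _ Hv). assert (B := lower_beta_le_Gamma a ((1 - u) / u) Ha ltac:(lra)).
  pose proof (cond_pos eta). apply Rabs_def1; lra.
Qed.

(** * Pushed fronts: k > 2 *)

Lemma odds_derive a x : 0 < x < 1 ->
  is_derive (fun x => Rpower (x / (1 - x)) a) x (Rpower (x / (1 - x)) a * (a / (x * (1 - x)))).
Proof.
  intros Hx. assert (Hq : 0 < x / (1 - x)) by (apply Rdiv_lt_0_compat; lra).
  unfold Rpower. auto_derive; [split; [lra | split; [exact Hq | trivial]]|]. unfold Rminus, Rdiv in *. field. lra.
Qed.

Lemma odds_primitive_pos a x : 0 < a < 1 -> 0 < x < 1 -> 0 < odds_primitive a x.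
Proof.
  intros Ha Hx.
  destruct (mvt (odds_primitive a) (fun x => Rpower (x / (1 - x)) a) (x / 2) x) as [z [Hz E]]; [lra| | |].
  - intros; apply odds_primitive_derive; lra.
  - intros; eapply continuous_of_derive; apply odds_primitive_derive; lra.
  - assert (0 <= odds_primitive a (x / 2)) by (apply odds_primitive_bounds; lra).
    pose proof (Rpower_pos (z / (1 - z)) a). nra.
Qed.

Lemma odds_primitive_mono a x y : 0 < a < 1 -> 0 < x <= y -> y < 1 -> odds_primitive a x <= odds_primitive a y.
Proof.
  intros Ha Hx Hy. apply (nondecreasing_of_derive _ (fun x => Rpower (x / (1 - x)) a)); [lra| | |].
  - intros; apply odds_primitive_derive; lra.
  - intros; eapply continuous_of_derive; apply odds_primitive_derive; lra.
  - intros. left. apply Rpower_pos.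
Qed.

Section Pushed.
Variables (k De : R).
Hypothesis hk : 2 < k.
Hypothesis hDe : 0 < De.

(** At the critical speed the two decay rates at U = 0 are k / 2 and 2 / k, the roots of z^2 - c z +
    1. Here [a] is their quotient and [kap] their difference. *)
Let a := 4 / k ^ 2.
Let kap := k / 2 - 2 / k.
Let c := k / 2 + 2 / k - De.
Let D (x : R) := profile k c x - k / 2 * (x * (1 - x)).
Let q (x : R) := Rpower (x / (1 - x)) a.

Lemma pushed_exponent : 0 < a < 1.
Proof.
  unfold a. assert (4 < k ^ 2) by nra. split; [apply Rdiv_lt_0_compat; lra|].
  apply Rmult_lt_reg_r with (k ^ 2); [lra|]. unfold Rdiv. rewrite Rmult_assoc, Rinv_l by lra. lra.
Qed.

Lemma pushed_kap : kap = (1 - a) * (k / 2) /\ 0 < kap.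
Proof.
  assert (E : kap = (1 - a) * (k / 2)) by (unfold kap, a; field; lra).
  split; [assumption|]. rewrite E. pose proof pushed_exponent. apply Rmult_lt_0_compat; lra.
Qed.

Lemma pushed_diff_bounds x : 0 < x < 1 -> 0 <= D x <= De * x.
Proof.
  intros Hx. assert (hk0 : 0 < k) by lra. unfold D.
  assert (A := profile_le k (k / 2 + 2 / k) _ k c _ (Rle_refl k) ltac:(unfold c; lra)
      (profile_spec k _ hk0) (profile_spec k c hk0) x Hx).
  assert (B := profile_diff_le k c _ (k / 2 + 2 / k) _ ltac:(unfold c; lra)
      (profile_spec k c hk0) (profile_spec k _ hk0) x Hx).
  rewrite profile_supercritical in A, B by assumption.
  replace (k / 2 + 2 / k - c) with De in B by (unfold c; ring). lra.
Qed.

Lemma pushed_diff_derive x : 0 < x < 1 -> is_derive D x (De - 2 / k * D x / profile k c x).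
Proof.
  intros Hx. assert (hk0 : 0 < k) by lra.
  assert (Hp : 0 < profile k c x) by (apply (profile_pos k c); [now apply profile_spec | assumption]).
  assert (Hd : is_derive (fun x => k / 2 * (x * (1 - x))) x (k / 2 * (1 - 2 * x))).
  { auto_derive; [trivial | ring]. }
  assert (A := is_derive_minus _ _ x _ _ (profile_derive k c _ x (profile_spec k c hk0) Hx) Hd).
  eapply eq_rect; [exact A|].
  change (profile_rhs k c x (profile k c x) - k / 2 * (1 - 2 * x) = De - 2 / k * D x / profile k c x).
  unfold profile_rhs, D. set (p := profile k c x) in *. unfold c. field. lra.
Qed.

(** If the profile in the damping is replaced by (k / 2) x (1 - x), the coefficient becomes a / (x
    (1 - x)) and [q] is the integrating factor. The remainder is quadratic in [D]. *)
Lemma pushed_weighted_derive x : 0 < x < 1 ->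
  is_derive (fun x => D x * q x) x
    (q x * (De + 2 / k * D x ^ 2 / (k / 2 * (x * (1 - x)) * profile k c x))).
Proof.
  intros Hx. assert (hk0 : 0 < k) by lra.
  assert (Hp : 0 < profile k c x) by (apply (profile_pos k c); [now apply profile_spec | assumption]).
  assert (A := is_derive_mult D q x _ _ (pushed_diff_derive x Hx) (odds_derive a x Hx) Rmult_comm).
  eapply eq_rect; [exact A|].
  change ((De - 2 / k * D x / profile k c x) * q x + D x * (q x * (a / (x * (1 - x))))
     = q x * (De + 2 / k * D x ^ 2 / (k / 2 * (x * (1 - x)) * profile k c x))).
  unfold a. assert (Ep : profile k c x = D x + k / 2 * (x * (1 - x))) by (unfold D; ring).
  rewrite Ep in *. field. repeat split; lra.
Qed.

(** The quadratic remainder is nonnegative, so the solution of the linearised equation is a lower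
    bound on all of (0, 1). *)
Lemma pushed_weighted_ge x : 0 < x < 1 -> De * odds_primitive a x <= D x * q x.
Proof.
  intros Hx. assert (Ha := pushed_exponent). assert (hk0 : 0 < k) by lra.
  assert (De * odds_primitive a x - D x * q x <= 0); [|lra].
  apply (barrier_from_zero (fun x => De * odds_primitive a x - D x * q x)
    (fun x => De * q x - q x * (De + 2 / k * D x ^ 2 / (k / 2 * (x * (1 - x)) * profile k c x))) 1); [| | |assumption].
  - intros t Ht. apply (is_derive_minus (fun x => De * odds_primitive a x) (fun x => D x * q x)).
    + apply (is_derive_scal (odds_primitive a)). apply odds_primitive_derive; lra.
    + now apply pushed_weighted_derive.
  - intros t Ht _.
    assert (Hp : 0 < profile k c t) by (apply (profile_pos k c); [now apply profile_spec | assumption]).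
    assert (0 <= 2 / k * D t ^ 2 / (k / 2 * (t * (1 - t)) * profile k c t)).
    { apply Rdiv_le_0_compat; [apply Rmult_le_pos; [left; apply Rdiv_lt_0_compat; lra | apply pow2_ge_0]|].
      repeat apply Rmult_lt_0_compat; lra. }
    assert (0 < q t) by apply Rpower_pos. nra.
  - apply (small_of_linear_bound _ (2 * De)). intros t Ht.
    destruct (odds_primitive_bounds a t Ha ltac:(lra)) as [_ B].
    assert (t / (1 - t) <= 2 * t).
    { apply Rmult_le_reg_r with (1 - t); [lra|]. unfold Rdiv. rewrite Rmult_assoc, Rinv_l by lra. nra. }
    assert (0 <= D t) by (apply pushed_diff_bounds; lra). assert (0 < q t) by apply Rpower_pos.
    assert (0 <= D t * q t) by (apply Rmult_le_pos; lra).
    assert (De * odds_primitive a t <= De * (2 * t)) by (apply Rmult_le_compat_l; lra). lra.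
Qed.

Lemma pushed_diff_pos x : 0 < x < 1 -> 0 < D x.
Proof.
  intros Hx. assert (Ha := pushed_exponent). assert (A := pushed_weighted_ge x Hx).
  assert (B := odds_primitive_pos a x Ha Hx). assert (0 < q x) by apply Rpower_pos.
  assert (0 < De * odds_primitive a x) by (apply Rmult_lt_0_compat; lra).
  destruct (Rlt_le_dec 0 (D x)); [assumption|]. nra.
Qed.

(** Up to 1 - rho the bound D <= De x makes the quadratic remainder at most De times 8 De / (k^3
    rho^2), so the linear solution is accurate up to this relative error. *)
Lemma pushed_weighted_le rho x : 0 < rho -> 0 < x <= 1 - rho ->
  D x * q x <= De * (1 + 8 / k ^ 3 * De / rho ^ 2) * odds_primitive a x.
Proof.
  intros Hrho Hx. assert (Ha := pushed_exponent). assert (hk0 : 0 < k) by lra.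
  set (L := De * (1 + 8 / k ^ 3 * De / rho ^ 2)).
  assert (HL : 0 <= L).
  { unfold L. apply Rmult_le_pos; [lra|]. assert (0 <= 8 / k ^ 3 * De / rho ^ 2); [|lra].
    apply Rdiv_le_0_compat; [|apply pow_lt; lra]. apply Rmult_le_pos; [|lra].
    apply Rdiv_le_0_compat; [lra | apply pow_lt; lra]. }
  assert (Hd : forall t, 0 < t < 1 -> is_derive (fun x => D x * q x - L * odds_primitive a x) t
    (q t * (De + 2 / k * D t ^ 2 / (k / 2 * (t * (1 - t)) * profile k c t)) - L * q t)).
  { intros t Ht. apply (is_derive_minus (fun x => D x * q x) (fun x => L * odds_primitive a x)).
    - now apply pushed_weighted_derive.
    - apply (is_derive_scal (odds_primitive a)). apply odds_primitive_derive; lra. }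
  assert (Hsmall : forall eta r, 0 < eta -> 0 < r -> exists x0, 0 < x0 < r /\ D x0 * q x0 - L * odds_primitive a x0 <= eta).
  { apply (small_of_linear_bound _ (2 * De)). intros t Ht.
    destruct (odds_primitive_bounds a t Ha ltac:(lra)) as [B _].
    assert (A := pushed_diff_bounds t ltac:(lra)).
    assert (Hq : q t <= 2).
    { assert (Ht1 : 0 < t / (1 - t)) by (apply Rdiv_lt_0_compat; lra).
      assert (A2 := Rpower_le_one_plus (t / (1 - t)) a Ht1 ltac:(lra)). fold (q t) in A2.
      assert (t / (1 - t) <= 1); [|lra].
      apply Rmult_le_reg_r with (1 - t); [lra|]. unfold Rdiv. rewrite Rmult_assoc, Rinv_l by lra. lra. }
    assert (0 < q t) by apply Rpower_pos.
    assert (D t * q t <= De * t * 2) by (apply Rmult_le_compat; lra).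
    assert (0 <= L * odds_primitive a t) by (apply Rmult_le_pos; lra). lra. }
  assert (D x * q x - L * odds_primitive a x <= 0); [|lra].
  apply le_of_le_add_eps. intros eta He. rewrite Rplus_0_l.
  destruct (Hsmall eta x He ltac:(lra)) as [x0 [Hx0 H0]].
  apply Rle_trans with (D x0 * q x0 - L * odds_primitive a x0); [|assumption].
  apply (nonincreasing_of_derive (fun x => D x * q x - L * odds_primitive a x)
    (fun t => q t * (De + 2 / k * D t ^ 2 / (k / 2 * (t * (1 - t)) * profile k c t)) - L * q t)); [lra| | |].
  - intros; apply Hd; lra.
  - intros; eapply continuous_of_derive; apply Hd; lra.
  - intros t Ht. assert (0 < q t) by apply Rpower_pos.
    assert (A := pushed_diff_bounds t ltac:(lra)).
    assert (Ht' : 0 < t * (1 - t)) by (apply Rmult_lt_0_compat; lra).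
    assert (HP0 : 0 < k / 2 * (t * (1 - t))) by (apply Rmult_lt_0_compat; lra).
    assert (Hp : k / 2 * (t * (1 - t)) <= profile k c t) by (unfold D in A; lra).
    assert (Hfrac : D t ^ 2 / (k / 2 * (t * (1 - t)) * profile k c t) <= 4 / k ^ 2 * De ^ 2 / rho ^ 2).
    { apply Rle_trans with ((De * t) ^ 2 / (k / 2 * (t * (1 - t)) * (k / 2 * (t * (1 - t))))).
      - apply Rdiv_le_compat.
        + split; [apply pow2_ge_0 | apply pow_incr; lra].
        + split; [apply Rmult_lt_0_compat; lra | apply Rmult_le_compat_l; lra].
      - replace ((De * t) ^ 2 / (k / 2 * (t * (1 - t)) * (k / 2 * (t * (1 - t)))))
          with (4 / k ^ 2 * De ^ 2 / (1 - t) ^ 2) by (field; lra).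
        apply Rmult_le_compat_l.
        + apply Rmult_le_pos; [apply Rdiv_le_0_compat; [lra | apply pow_lt; lra] | apply pow2_ge_0].
        + apply Rinv_le_contravar; [apply pow_lt; lra | apply pow_incr; lra]. }
    assert (Hk2 : 0 < 2 / k) by (apply Rdiv_lt_0_compat; lra).
    assert (HL2 : De + 2 / k * D t ^ 2 / (k / 2 * (t * (1 - t)) * profile k c t) <= L).
    { unfold L.
      replace (2 / k * D t ^ 2 / (k / 2 * (t * (1 - t)) * profile k c t))
        with (2 / k * (D t ^ 2 / (k / 2 * (t * (1 - t)) * profile k c t))) by (unfold Rdiv; ring).
      apply (Rmult_le_compat_l (2 / k)) in Hfrac; [|lra].
      replace (De * (1 + 8 / k ^ 3 * De / rho ^ 2)) with (De + 2 / k * (4 / k ^ 2 * De ^ 2 / rho ^ 2)) by (field; lra).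
      lra. }
    assert (q t * (De + 2 / k * D t ^ 2 / (k / 2 * (t * (1 - t)) * profile k c t)) <= q t * L)
      by (apply Rmult_le_compat_l; lra). lra.
Qed.

(* First integral of [dD/dU = (2/k) D / ((k/2) U + D)], which is the equation for [D] with
   [De] dropped and [(k/2) x (1 - x)] replaced by [(k/2) U]. *)
Let M (x : R) := ln (D x) - a * ln (D x + kap * (1 - x)).

Lemma pushed_invariant_derive x : 0 < x < 1 ->
  is_derive M x (De * ((1 - a) * (D x + k / 2 * (1 - x))) / (D x * (D x + kap * (1 - x)))
     - (1 - a) * (1 - x) ^ 2 / ((D x + kap * (1 - x)) * profile k c x)).
Proof.
  intros Hx. assert (HD := pushed_diff_pos x Hx). destruct pushed_kap as [Ekap Hkap].
  assert (Hs : 0 < D x + kap * (1 - x)) by (assert (0 < kap * (1 - x)) by (apply Rmult_lt_0_compat; lra); lra).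
  assert (hk0 : 0 < k) by lra.
  assert (Hp : 0 < profile k c x) by (apply (profile_pos k c); [now apply profile_spec | assumption]).
  assert (Hl : forall y, 0 < y -> is_derive ln y (/ y)) by (intros; now apply is_derive_ln).
  assert (HDd := pushed_diff_derive x Hx).
  assert (Hsd : is_derive (fun x => D x + kap * (1 - x)) x ((De - 2 / k * D x / profile k c x) + - kap)).
  { apply (is_derive_plus D (fun x => kap * (1 - x))); [assumption|]. auto_derive; [trivial | ring]. }
  assert (A1 := is_derive_comp ln D x _ _ (Hl _ HD) HDd).
  assert (A2 := is_derive_scal _ x a _ (is_derive_comp ln (fun x => D x + kap * (1 - x)) x _ _ (Hl _ Hs) Hsd)).
  assert (A := is_derive_minus _ _ x _ _ A1 A2).
  eapply eq_rect; [exact A|].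
  change ((De - 2 / k * D x / profile k c x) * / D x
     - a * ((De - 2 / k * D x / profile k c x + - kap) * / (D x + kap * (1 - x)))
     = De * ((1 - a) * (D x + k / 2 * (1 - x))) / (D x * (D x + kap * (1 - x)))
     - (1 - a) * (1 - x) ^ 2 / ((D x + kap * (1 - x)) * profile k c x)).
  assert (Ep : profile k c x = D x + k / 2 * (x * (1 - x))) by (unfold D; ring).
  set (s := D x + kap * (1 - x)) in *. set (p := profile k c x) in *. set (d := D x) in *.
  apply Rmult_eq_reg_r with (d * s * p); [|apply Rgt_not_eq; repeat apply Rmult_lt_0_compat; lra].
  replace (((De - 2 / k * d / p) * / d - a * ((De - 2 / k * d / p + - kap) * / s)) * (d * s * p))
    with ((De * p - 2 / k * d) * s - a * ((De * p - 2 / k * d) - kap * p) * d) by (field; lra).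
  replace ((De * ((1 - a) * (d + k / 2 * (1 - x))) / (d * s) - (1 - a) * (1 - x) ^ 2 / (s * p)) * (d * s * p))
    with (De * ((1 - a) * (d + k / 2 * (1 - x))) * p - (1 - a) * (1 - x) ^ 2 * d) by (field; lra).
  rewrite Ep. unfold s. rewrite Ekap. fold d. unfold a. field. lra.
Qed.

(** The derivative of [M] has two parts. The source due to De is at most De / D, hence by
    [pushed_weighted_ge] at most the logarithmic derivative of [odds_primitive]. The error of
    replacing x (1 - x) by U is negative and at most 2 a in size for x >= 1/2. *)
Lemma pushed_invariant_bounds x1 x2 : / 2 <= x1 <= x2 -> x2 < 1 ->
  - (2 * a * (x2 - x1)) <= M x2 - M x1 <= ln (odds_primitive a x2) - ln (odds_primitive a x1).
Proof.
  intros Hx1 Hx2. assert (Ha := pushed_exponent). destruct pushed_kap as [Ekap Hkap].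
  assert (hk0 : 0 < k) by lra.
  set (dM := fun x => De * ((1 - a) * (D x + k / 2 * (1 - x))) / (D x * (D x + kap * (1 - x)))
     - (1 - a) * (1 - x) ^ 2 / ((D x + kap * (1 - x)) * profile k c x)).
  assert (Hfacts : forall x, / 2 <= x < 1 -> 0 < D x /\ 0 < D x + kap * (1 - x) /\ kap * (1 - x) <= D x + kap * (1 - x)
            /\ k / 2 * (x * (1 - x)) <= profile k c x /\ 0 < kap * (1 - x)).
  { intros x Hx. assert (HD := pushed_diff_pos x ltac:(lra)).
    assert (0 < kap * (1 - x)) by (apply Rmult_lt_0_compat; lra).
    assert (HD0 := HD). unfold D in HD0. repeat split; lra. }
  split.
  - assert (M x1 + 2 * a * x1 <= M x2 + 2 * a * x2); [|lra].
    assert (Hd : forall x, 0 < x < 1 -> is_derive (fun x => M x + 2 * a * x) x (dM x + 2 * a)).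
    { intros x Hx. apply (is_derive_plus M (fun x => 2 * a * x)); [now apply pushed_invariant_derive|].
      auto_derive; [trivial | ring]. }
    apply (nondecreasing_of_derive (fun x => M x + 2 * a * x) (fun x => dM x + 2 * a)); [lra| | |].
    + intros; apply Hd; lra.
    + intros; eapply continuous_of_derive; apply Hd; lra.
    + intros x Hx. destruct (Hfacts x ltac:(lra)) as [F1 [F2 [F3 [F4 F5]]]]. unfold dM.
      assert (T1 : 0 <= De * ((1 - a) * (D x + k / 2 * (1 - x))) / (D x * (D x + kap * (1 - x)))).
      { apply Rdiv_le_0_compat; [|now apply Rmult_lt_0_compat].
        assert (0 < k / 2 * (1 - x)) by (apply Rmult_lt_0_compat; lra).
        repeat apply Rmult_le_pos; lra. }
      (* With x >= 1/2 the profile is at least (k / 4) (1 - x); the factors 1 - a and (1 - x)^2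
         cancel and 8 / k^2 = 2 a is left. *)
      assert (T2 : (1 - a) * (1 - x) ^ 2 / ((D x + kap * (1 - x)) * profile k c x) <= 2 * a).
      { assert (G : 0 < kap * (1 - x) * (k / 2 * (/ 2 * (1 - x)))) by (repeat apply Rmult_lt_0_compat; lra).
        apply Rle_trans with ((1 - a) * (1 - x) ^ 2 / (kap * (1 - x) * (k / 2 * (/ 2 * (1 - x))))).
        - apply Rdiv_le_compat.
          + split; [|lra]. apply Rmult_le_pos; [lra | apply pow2_ge_0].
          + split; [assumption|]. apply Rmult_le_compat; try lra.
            * repeat apply Rmult_le_pos; lra.
            * eapply Rle_trans; [|exact F4]. apply Rmult_le_compat_l; [lra|].
              apply Rmult_le_compat_r; lra.
        - right. rewrite Ekap. unfold a. assert (4 < k ^ 2) by nra. field. repeat split; try lra.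
      }
      lra.
  - assert (M x2 - ln (odds_primitive a x2) <= M x1 - ln (odds_primitive a x1)); [|lra].
    assert (Hd : forall x, 0 < x < 1 -> is_derive (fun x => M x - ln (odds_primitive a x)) x
               (dM x - q x * / odds_primitive a x)).
    { intros x Hx. apply (is_derive_minus M (fun x => ln (odds_primitive a x))); [now apply pushed_invariant_derive|].
      apply (is_derive_comp ln (odds_primitive a)).
      - apply is_derive_ln. now apply odds_primitive_pos.
      - apply odds_primitive_derive; lra. }
    apply (nonincreasing_of_derive (fun x => M x - ln (odds_primitive a x)) (fun x => dM x - q x * / odds_primitive a x)); [lra| | |].
    + intros; apply Hd; lra.
    + intros; eapply continuous_of_derive; apply Hd; lra.
    + intros x Hx. destruct (Hfacts x ltac:(lra)) as [F1 [F2 [F3 [F4 F5]]]]. unfold dM.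
      assert (HB := odds_primitive_pos a x Ha ltac:(lra)).
      assert (T1 : De * ((1 - a) * (D x + k / 2 * (1 - x))) / (D x * (D x + kap * (1 - x))) <= q x * / odds_primitive a x).
      { apply Rle_trans with (De / D x).
        - replace (De * ((1 - a) * (D x + k / 2 * (1 - x))) / (D x * (D x + kap * (1 - x))))
            with (De / D x * (((1 - a) * (D x + k / 2 * (1 - x))) / (D x + kap * (1 - x)))) by (field; lra).
          rewrite <- (Rmult_1_r (De / D x)) at 2. apply Rmult_le_compat_l; [apply Rdiv_le_0_compat; lra|].
          apply Rmult_le_reg_r with (D x + kap * (1 - x)); [assumption|].
          unfold Rdiv at 1. rewrite Rmult_assoc, Rinv_l, Rmult_1_r, Rmult_1_l by lra.
          rewrite Ekap. assert (0 <= a * D x) by (apply Rmult_le_pos; lra). lra.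
        - assert (W := pushed_weighted_ge x ltac:(lra)).
          apply Rmult_le_reg_r with (D x * odds_primitive a x); [now apply Rmult_lt_0_compat|].
          replace (De / D x * (D x * odds_primitive a x)) with (De * odds_primitive a x) by (field; lra).
          replace (q x * / odds_primitive a x * (D x * odds_primitive a x)) with (D x * q x) by (field; lra).
          exact W. }
      assert (T2 : 0 <= (1 - a) * (1 - x) ^ 2 / ((D x + kap * (1 - x)) * profile k c x)).
      { assert (0 < k / 2 * (x * (1 - x))) by (repeat apply Rmult_lt_0_compat; lra).
        apply Rdiv_le_0_compat; [apply Rmult_le_pos; [lra | apply pow2_ge_0]|].
        apply Rmult_lt_0_compat; lra. }
      lra.
Qed.

Lemma pushed_diff_at_cutoff eps : profile k c (1 - eps) = c * eps ->
  D (1 - eps) = (2 / k - De + k / 2 * eps) * eps.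
Proof. intros E. unfold D. rewrite E. unfold c. field. lra. Qed.

(** The a priori order of the gap, from the linear lower bound evaluated at the cut-off itself. The
    power of eps is already the right one; only the constant is crude, since the full nonlinearity
    acts there. *)
Lemma pushed_gap_bound eps : 0 < eps <= / 2 -> profile k c (1 - eps) = c * eps ->
  De * odds_primitive a (/ 2) <= (k / 2 + 2 / k) * Rpower eps (1 - a).
Proof.
  intros He E. assert (Ha := pushed_exponent).
  assert (W := pushed_weighted_ge (1 - eps) ltac:(lra)).
  assert (Hm := odds_primitive_mono a (/ 2) (1 - eps) Ha ltac:(lra) ltac:(lra)).
  assert (HD2 := pushed_diff_pos (1 - eps) ltac:(lra)).
  rewrite (pushed_diff_at_cutoff eps E) in *.
  assert (Hk2 : 0 < 2 / k) by (apply Rdiv_lt_0_compat; lra).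
  assert (Hq : q (1 - eps) <= Rpower eps (- a)).
  { unfold q. replace ((1 - eps) / (1 - (1 - eps))) with ((1 - eps) / eps) by (f_equal; ring).
    replace (Rpower eps (- a)) with (Rpower (/ eps) a).
    - left. apply Rlt_Rpower_l; [lra|]. split; [apply Rdiv_lt_0_compat; lra|].
      unfold Rdiv. rewrite <- (Rmult_1_l (/ eps)) at 2. apply Rmult_lt_compat_r; [apply Rinv_0_lt_compat|]; lra.
    - unfold Rpower. rewrite ln_Rinv by lra. f_equal. ring. }
  assert (Er : Rpower eps (1 - a) = eps * Rpower eps (- a)).
  { unfold Rminus. rewrite Rpower_plus, Rpower_1 by lra. reflexivity. }
  assert (0 < q (1 - eps)) by apply Rpower_pos.
  rewrite Er. eapply Rle_trans; [apply Rmult_le_compat_l; [lra | exact Hm]|].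
  eapply Rle_trans; [exact W|]. rewrite <- Rmult_assoc.
  apply Rmult_le_compat; [lra | lra | | exact Hq].
  apply Rmult_le_compat_r; [lra|]. nra.
Qed.

(** Matching at x = 1 - rho: the linear regime determines D there and the invariant [M] transports
    it to the cut-off, where D is known. [R] is the logarithm of De over its leading term with [B0]
    in place of B(1). [A] is the effect of De and eps on the values at the cut-off; the other terms
    are the errors of the two regimes. *)
Lemma pushed_log_estimate B0 eps rho : 0 < eps <= rho -> rho <= / 2 ->
  profile k c (1 - eps) = c * eps ->
  (forall x, 0 < x < 1 -> odds_primitive a x <= B0) ->
  let R := ln De - (1 - a) * ln eps - (ln (2 / k) - a * ln (k / 2) + a * ln kap - ln B0) in
  let A := (ln (2 / k - De + k / 2 * eps) - ln (2 / k))
           - a * (ln (k / 2 - De + k / 2 * eps) - ln (k / 2)) in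
  A - 8 / k ^ 3 * De / rho ^ 2 + a * ln (1 - rho) <= R
  <= A + 2 * a * rho + (ln B0 - ln (odds_primitive a (1 - rho))) + a * (ln (kap + De / rho) - ln kap).
Proof.
  intros He Hr E HB R A. assert (Ha := pushed_exponent). destruct pushed_kap as [Ekap Hkap].
  assert (Hle : forall x y, 0 < x <= y -> ln x <= ln y).
  { intros x y [Hx [Hy| ->]]; [left; now apply ln_increasing | lra]. }
  assert (HD1 := pushed_diff_pos (1 - rho) ltac:(lra)).
  assert (HD2 := pushed_diff_pos (1 - eps) ltac:(lra)).
  assert (HD1u := pushed_diff_bounds (1 - rho) ltac:(lra)).
  assert (ED2 := pushed_diff_at_cutoff eps E).
  assert (HB1 := odds_primitive_pos a (1 - rho) Ha ltac:(lra)).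
  assert (HB2 := odds_primitive_pos a (1 - eps) Ha ltac:(lra)).
  assert (HB2l := HB (1 - eps) ltac:(lra)).
  assert (W1 := pushed_weighted_ge (1 - rho) ltac:(lra)).
  assert (W2 := pushed_weighted_le rho (1 - rho) ltac:(lra) ltac:(lra)).
  destruct (pushed_invariant_bounds (1 - rho) (1 - eps) ltac:(lra) ltac:(lra)) as [I1 I2].
  assert (Hlb := Hle _ _ (conj HB2 HB2l)).
  set (y := 2 / k - De + k / 2 * eps) in *.
  assert (Hy : 0 < y) by (rewrite ED2 in HD2; nra).
  assert (Hy2 : k / 2 - De + k / 2 * eps = y + kap) by (unfold y, kap; ring).
  (* Both logarithms in [M] split off ln eps at the cut-off, with total weight 1 - a: this produces
     the exponent of eps. *)
  assert (EM2 : M (1 - eps) = ln y - a * ln (y + kap) + (1 - a) * ln eps).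
  { unfold M. rewrite ED2. replace (y * eps + kap * (1 - (1 - eps))) with ((y + kap) * eps) by ring.
    rewrite !ln_mult by lra. ring. }
  assert (Hq1 : ln (q (1 - rho)) = a * (ln (1 - rho) - ln rho)).
  { unfold q. replace ((1 - rho) / (1 - (1 - rho))) with ((1 - rho) / rho) by (f_equal; ring).
    unfold Rpower. rewrite ln_exp, ln_div by lra. reflexivity. }
  assert (Hqp : 0 < q (1 - rho)) by apply Rpower_pos.
  set (D1 := D (1 - rho)) in *.
  assert (EM1 : M (1 - rho) = ln (D1 * q (1 - rho)) - a * ln (1 - rho) - a * ln (kap + D1 / rho)).
  { unfold M. fold D1. rewrite (ln_mult D1) by assumption. rewrite Hq1.
    replace (D1 + kap * (1 - (1 - rho))) with (rho * (kap + D1 / rho)) by (field; lra).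
    rewrite ln_mult; [ring | lra|]. assert (0 < D1 / rho) by (apply Rdiv_lt_0_compat; lra). lra. }
  assert (HL1 : ln De + ln (odds_primitive a (1 - rho)) <= ln (D1 * q (1 - rho))).
  { rewrite <- ln_mult by assumption. apply Hle. split; [now apply Rmult_lt_0_compat | assumption]. }
  set (th := 8 / k ^ 3 * De / rho ^ 2) in *.
  assert (Hth : 0 <= th).
  { unfold th. apply Rdiv_le_0_compat; [|apply pow_lt; lra]. apply Rmult_le_pos; [|lra].
    apply Rdiv_le_0_compat; [lra | apply pow_lt; lra]. }
  assert (HL2 : ln (D1 * q (1 - rho)) <= ln De + th + ln (odds_primitive a (1 - rho))).
  { apply Rle_trans with (ln (De * (1 + th) * odds_primitive a (1 - rho))).
    - apply Hle. split; [now apply Rmult_lt_0_compat | assumption].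
    - rewrite !ln_mult; try lra; [|apply Rmult_lt_0_compat; lra].
      pose proof (ln_le_sub_one (1 + th)). lra. }
  assert (Hk1 : ln kap <= ln (kap + D1 / rho)).
  { apply Hle. split; [assumption|]. assert (0 < D1 / rho) by (apply Rdiv_lt_0_compat; lra). lra. }
  assert (Hk2 : ln (kap + D1 / rho) <= ln (kap + De / rho)).
  { apply Hle. assert (0 < D1 / rho) by (apply Rdiv_lt_0_compat; lra). split; [lra|].
    apply Rplus_le_compat_l. apply Rmult_le_compat_r; [left; apply Rinv_0_lt_compat; lra|]. nra. }
  assert (Hl1 : ln (1 - rho) <= 0) by (rewrite <- ln_1; apply Hle; lra).
  assert (Ha1 : a * ln kap <= a * ln (kap + D1 / rho)) by (apply Rmult_le_compat_l; lra).
  assert (Ha2 : a * ln (kap + D1 / rho) <= a * ln (kap + De / rho)) by (apply Rmult_le_compat_l; lra).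
  assert (Ha3 : a * ln (1 - rho) <= 0) by (assert (0 <= a * - ln (1 - rho)) by (apply Rmult_le_pos; lra); lra).
  assert (Ha4 : a * (1 - eps - (1 - rho)) <= a * rho) by (apply Rmult_le_compat_l; lra).
  rewrite EM1, EM2 in I1, I2. unfold R, A. rewrite Hy2. split; lra.
Qed.
End Pushed.

(** * Asymptotics of the pushed speed *)

Lemma filterlim_continuous_comp (F : (R -> Prop) -> Prop) {FF : Filter F} (f h : R -> R) (l : R) :
  filterlim f F (locally l) -> continuous h l -> filterlim (fun x => h (f x)) F (locally (h l)).
Proof. intros Hf Hh. exact (filterlim_comp _ _ _ f h _ _ _ Hf Hh). Qed.

Lemma filterlim_Rplus (F : (R -> Prop) -> Prop) {FF : Filter F} (f g : R -> R) (l m : R) :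
  filterlim f F (locally l) -> filterlim g F (locally m) ->
  filterlim (fun x => f x + g x) F (locally (l + m)).
Proof.
  intros Hf Hg.
  exact (filterlim_comp_2 f g Rplus Hf Hg (filterlim_plus l m)).
Qed.

Lemma eventually_at_right (d : R) (P : R -> Prop) : 0 < d ->
  (forall eps, 0 < eps < d -> P eps) -> at_right 0 P.
Proof.
  intros Hd H. exists (mkposreal d Hd). intros eps Heps Hpos.
  change (Rabs (eps - 0) < d) in Heps. rewrite Rminus_0_r, Rabs_right in Heps by lra.
  apply H. lra.
Qed.

Lemma filterlim_at_right_id : filterlim (fun eps : R => eps) (at_right 0) (locally 0).
Proof. intros P HP. unfold filtermap. now apply filter_le_within. Qed.

Lemma Rpower_at_right_zero b : 0 < b -> filterlim (fun eps => Rpower eps b) (at_right 0) (locally 0).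
Proof.
  intros Hb. apply (filterlim_ext_loc (pow0 b)).
  - apply (eventually_at_right 1); [lra|]. intros eps He. apply pow0_pos. lra.
  - assert (A := filterlim_continuous_comp (at_right 0) _ (pow0 b) 0 filterlim_at_right_id (pow0_continuous b 0 Hb)).
    unfold pow0 at 2 in A. destruct (Rle_dec 0 0) in A; [exact A | lra].
Qed.

Lemma pushed_exponent_pos k : 2 < k -> 0 < 4 / k ^ 2 < 1.
Proof. apply pushed_exponent. Qed.

Lemma pushed_speed_gap k eps : 2 < k -> 0 < eps <= / 2 ->
  let De := k / 2 + 2 / k - cutoff_speed k eps in
  0 < De /\ profile k (k / 2 + 2 / k - De) (1 - eps) = (k / 2 + 2 / k - De) * eps.
Proof.
  intros hk He De. destruct (cutoff_speed_spec k eps ltac:(lra) ltac:(lra)) as [Hc Ep].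
  unfold c_crit in Hc. destruct (Rle_dec k 2); [lra|].
  replace (k / 2 + 2 / k - De) with (cutoff_speed k eps) by (unfold De; ring).
  split; [unfold De; lra | exact Ep].
Qed.

Lemma pushed_gap_le_power k : 2 < k ->
  exists C, forall eps, 0 < eps <= / 2 ->
    0 < k / 2 + 2 / k - cutoff_speed k eps <= C * Rpower eps (1 - 4 / k ^ 2).
Proof.
  intros hk. assert (Ha := pushed_exponent_pos k hk).
  assert (HB := odds_primitive_pos (4 / k ^ 2) (/ 2) Ha ltac:(lra)).
  exists ((k / 2 + 2 / k) / odds_primitive (4 / k ^ 2) (/ 2)). intros eps He.
  destruct (pushed_speed_gap k eps hk He) as [H1 H2]. split; [assumption|].
  assert (A := pushed_gap_bound k _ hk H1 eps He H2). cbv zeta in A.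
  apply Rmult_le_reg_r with (odds_primitive (4 / k ^ 2) (/ 2)); [assumption|].
  replace ((k / 2 + 2 / k) / odds_primitive (4 / k ^ 2) (/ 2) * Rpower eps (1 - 4 / k ^ 2) * odds_primitive (4 / k ^ 2) (/ 2))
    with ((k / 2 + 2 / k) * Rpower eps (1 - 4 / k ^ 2)) by (field; lra).
  exact A.
Qed.

Lemma pushed_gap_vanishes k : 2 < k ->
  filterlim (fun eps => k / 2 + 2 / k - cutoff_speed k eps) (at_right 0) (locally 0).
Proof.
  intros hk. assert (Ha := pushed_exponent_pos k hk). destruct (pushed_gap_le_power k hk) as [C HC].
  assert (L := filterlim_continuous_comp (at_right 0) _ (fun y => C * y) 0
     (Rpower_at_right_zero (1 - 4 / k ^ 2) ltac:(lra))).
  cbv beta in L. rewrite Rmult_0_r in L.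
  refine (filterlim_squeeze _ (fun _ => 0) _ _ _ _ (filterlim_const 0) (L _)).
  - apply (eventually_at_right (/ 2)); [lra|]. intros eps He. specialize (HC eps ltac:(lra)). lra.
  - smooth.
Qed.

Lemma cutoff_speed_limit_gt k : 2 < k ->
  filterlim (cutoff_speed k) (at_right 0) (locally (k / 2 + 2 / k)).
Proof.
  intros hk. apply (filterlim_ext (fun eps => k / 2 + 2 / k - (k / 2 + 2 / k - cutoff_speed k eps))).
  { intros eps. assert (Er : forall u v : R, u - (u - v) = v) by (intros; ring). apply Er. }
  assert (L := filterlim_continuous_comp (at_right 0) _ (fun y => k / 2 + 2 / k - y) 0 (pushed_gap_vanishes k hk)).
  cbv beta in L. rewrite Rminus_0_r in L. apply L.
  smooth.
Qed.

Definition leading_log (k : R) : R :=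
  ln (2 / k) - 4 / k ^ 2 * ln (k / 2) + 4 / k ^ 2 * ln (k / 2 - 2 / k)
  - ln (Gamma (1 + 4 / k ^ 2) * Gamma (1 - 4 / k ^ 2)).

Lemma Gamma_product_bound a x : 0 < a < 1 -> 0 < x < 1 ->
  odds_primitive a x <= Gamma (1 + a) * Gamma (1 - a).
Proof. intros Ha Hx. apply lower_beta_le_Gamma; [assumption|]. apply Rdiv_lt_0_compat; lra. Qed.

Lemma Gamma_product_pos a : 0 < a < 1 -> 0 < Gamma (1 + a) * Gamma (1 - a).
Proof.
  intros Ha. assert (A := odds_primitive_pos a (/ 2) Ha ltac:(lra)).
  assert (B := Gamma_product_bound a (/ 2) Ha ltac:(lra)). lra.
Qed.

Lemma Delta_c_leading_gt k eps : 2 < k -> 0 < eps ->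
  Delta_c_leading k eps = exp (leading_log k + (1 - 4 / k ^ 2) * ln eps).
Proof.
  intros hk He. assert (HG := Gamma_product_pos (4 / k ^ 2) (pushed_exponent_pos k hk)).
  unfold Delta_c_leading. destruct (Rlt_dec k 2); [lra|]. destruct (Req_dec_T k 2); [lra|].
  unfold leading_log. set (G := Gamma (1 + 4 / k ^ 2) * Gamma (1 - 4 / k ^ 2)) in *.
  assert (Hk4 : 0 < k ^ 2 - 4) by nra.
  replace (k / 2 - 2 / k) with ((k ^ 2 - 4) / (2 * k)) by (field; lra).
  rewrite !ln_div, ln_mult by lra.
  unfold Rpower.
  replace (ln 2 - ln k - 4 / k ^ 2 * (ln k - ln 2) + 4 / k ^ 2 * (ln (k ^ 2 - 4) - (ln 2 + ln k)) - ln G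
     + (1 - 4 / k ^ 2) * ln eps)
    with (ln 2 + - ((1 + 8 / k ^ 2) * ln k) + (4 / k ^ 2 * ln (k ^ 2 - 4) + - ln G) + (1 - 4 / k ^ 2) * ln eps)
    by (field; lra).
  rewrite !exp_plus, !exp_Ropp, !exp_ln by lra. reflexivity.
Qed.

(** Working with logarithms turns the relative error of the gap into an additive one, to which the
    two-sided estimate at the matching point applies directly. *)
Lemma log_gap_limit k : 2 < k ->
  filterlim (fun eps => ln (k / 2 + 2 / k - cutoff_speed k eps) - (1 - 4 / k ^ 2) * ln eps - leading_log k)
    (at_right 0) (locally 0).
Proof.
  intros hk. set (a := 4 / k ^ 2). assert (Ha : 0 < a < 1) by (apply pushed_exponent_pos; assumption).
  set (kap := k / 2 - 2 / k).
  assert (Hkap : 0 < kap) by (apply (pushed_kap k hk)).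
  set (B0 := Gamma (1 + a) * Gamma (1 - a)). assert (HB0 : 0 < B0) by now apply Gamma_product_pos.
  destruct (pushed_gap_le_power k hk) as [C HC]. fold a in HC.
  assert (HCp : 0 < C).
  { specialize (HC (/ 2) ltac:(lra)). pose proof (Rpower_pos (/ 2) (1 - a)). nra. }
  set (De := fun eps => k / 2 + 2 / k - cutoff_speed k eps) in *.
  assert (HDe : filterlim De (at_right 0) (locally 0)) by (now apply pushed_gap_vanishes).
  (* With this choice De = O(rho^4), so De / rho and De / rho^2 vanish together with rho, while eps
     <= rho as the matching requires. *)
  set (rho := fun eps => Rpower eps ((1 - a) / 4)).
  assert (Hrho : filterlim rho (at_right 0) (locally 0)) by (apply Rpower_at_right_zero; lra).
  assert (Hrhop : forall eps, 0 < rho eps) by (intros; apply Rpower_pos).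
  assert (Hrhor : filterlim rho (at_right 0) (at_right 0)).
  { intros P [d Hd]. assert (A := proj1 (filterlim_locally rho 0) Hrho d).
    unfold filtermap. revert A. apply filter_imp. intros eps A. apply Hd; [exact A | apply Hrhop]. }
  assert (Hrho4 : forall eps, Rpower eps (1 - a) = rho eps ^ 4).
  { intros eps. unfold rho. rewrite <- Rpower_pow by apply Rpower_pos. rewrite Rpower_mult.
    f_equal. simpl. field. }
  assert (Heps := filterlim_at_right_id).
  set (A := fun eps => (ln (2 / k - De eps + k / 2 * eps) - ln (2 / k))
           - a * (ln (k / 2 - De eps + k / 2 * eps) - ln (k / 2))).
  assert (Hlin : forall m, 0 < m -> filterlim (fun eps => ln (m - De eps + k / 2 * eps)) (at_right 0) (locally (ln m))).
  { intros m Hm.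
    assert (L1 := filterlim_continuous_comp (at_right 0) _ (fun y => m - y) 0 HDe).
    assert (L2 := filterlim_continuous_comp (at_right 0) _ (fun y => k / 2 * y) 0 Heps).
    assert (L3 := filterlim_Rplus (at_right 0) _ _ _ _ (L1 ltac:(apply (ex_derive_continuous (fun y => m - y)); auto_derive; trivial))
                    (L2 ltac:(apply (ex_derive_continuous (fun y => k / 2 * y)); auto_derive; trivial))).
    cbv beta in L3. replace (m - 0 + k / 2 * 0) with m in L3 by ring.
    apply (filterlim_continuous_comp (at_right 0) _ ln m L3).
    eapply continuous_of_derive. now apply is_derive_ln. }
  assert (HA : filterlim A (at_right 0) (locally 0)).
  { assert (Hk1 : 0 < 2 / k) by (apply Rdiv_lt_0_compat; lra).
    assert (L1 := filterlim_continuous_comp (at_right 0) _ (fun y => y - ln (2 / k)) _ (Hlin (2 / k) Hk1)).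
    assert (L2 := filterlim_continuous_comp (at_right 0) _ (fun y => - a * (y - ln (k / 2))) _ (Hlin (k / 2) ltac:(lra))).
    assert (L3 := filterlim_Rplus (at_right 0) _ _ _ _
       (L1 ltac:(apply (ex_derive_continuous (fun y => y - ln (2 / k))); auto_derive; trivial))
       (L2 ltac:(apply (ex_derive_continuous (fun y => - a * (y - ln (k / 2)))); auto_derive; trivial))).
    cbv beta in L3. replace (ln (2 / k) - ln (2 / k) + - a * (ln (k / 2) - ln (k / 2))) with 0 in L3 by ring.
    eapply filterlim_ext; [|exact L3]. intros eps. unfold A. cbv beta.
    assert (Er : forall u v : R, u + - a * v = u - a * v) by (intros; ring). apply Er. }
  set (lo := fun r => - (8 / k ^ 3 * C) * r ^ 2 + a * ln (1 - r)).
  set (hi := fun r => 2 * a * r + a * (ln (kap + C * r ^ 3) - ln kap)).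
  assert (Hlo : filterlim (fun eps => A eps + lo (rho eps)) (at_right 0) (locally 0)).
  { assert (L := filterlim_continuous_comp (at_right 0) _ lo 0 Hrho).
    assert (L3 := filterlim_Rplus (at_right 0) _ _ _ _ HA (L ltac:(apply (ex_derive_continuous lo); unfold lo; auto_derive; lra))).
    unfold lo at 2 in L3. rewrite Rminus_0_r, ln_1 in L3.
    now replace (0 + (- (8 / k ^ 3 * C) * 0 ^ 2 + a * 0)) with 0 in L3 by ring. }
  assert (HlnB : filterlim (fun eps => ln B0 - ln (odds_primitive a (1 - rho eps))) (at_right 0) (locally 0)).
  { assert (L1 := filterlim_comp _ _ _ rho (fun u => odds_primitive a (1 - u)) _ _ _ Hrhor (odds_primitive_limit a Ha)).
    fold B0 in L1.
    assert (L2 := filterlim_continuous_comp (at_right 0) _ (fun y => ln B0 - ln y) B0 L1).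
    cbv beta in L2. rewrite Rminus_diag in L2. apply L2.
    apply (ex_derive_continuous (fun y => ln B0 - ln y)). auto_derive. assumption. }
  assert (Hhi : filterlim (fun eps => A eps + (hi (rho eps) + (ln B0 - ln (odds_primitive a (1 - rho eps))))) (at_right 0) (locally 0)).
  { assert (L := filterlim_continuous_comp (at_right 0) _ hi 0 Hrho).
    assert (L3 := filterlim_Rplus (at_right 0) _ _ _ _ (L ltac:(apply (ex_derive_continuous hi); unfold hi; auto_derive; lra)) HlnB).
    assert (L4 := filterlim_Rplus (at_right 0) _ _ _ _ HA L3).
    unfold hi at 2 in L4. replace (kap + C * 0 ^ 3) with kap in L4 by ring.
    now replace (0 + (2 * a * 0 + a * (ln kap - ln kap) + 0)) with 0 in L4 by ring. }
  refine (filterlim_squeeze _ _ _ _ _ _ Hlo Hhi).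
  assert (Hsmall : at_right 0 (fun eps => rho eps < / 2)).
  { assert (E := proj1 (filterlim_locally rho 0) Hrho (mkposreal (/ 2) ltac:(lra))). revert E. apply filter_imp.
    intros eps E. change (Rabs (rho eps - 0) < / 2) in E. apply Rabs_def2 in E. lra. }
  assert (Hdom : at_right 0 (fun eps => 0 < eps < / 2)) by (apply (eventually_at_right (/ 2)); [lra | auto]).
  refine (filter_imp _ _ _ (filter_and _ _ Hsmall Hdom)). intros eps [Hr He].
  destruct (pushed_speed_gap k eps hk ltac:(lra)) as [P1 P2]. fold (De eps) in P1, P2.
  assert (Her : eps <= rho eps).
  { unfold rho, Rpower. rewrite <- (exp_ln eps) at 1 by lra.
    assert (ln eps < 0) by (rewrite <- ln_1; apply ln_increasing; lra).
    left. apply exp_increasing. nra. }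
  destruct (pushed_log_estimate k (De eps) hk P1 B0 eps (rho eps) ltac:(lra) ltac:(lra) P2) as [E1 E2].
  { intros x Hx. now apply Gamma_product_bound. }
  fold a kap in E1, E2.
  destruct (HC eps ltac:(lra)) as [_ HCe]. rewrite Hrho4 in HCe. change (De eps <= C * rho eps ^ 4) in HCe.
  assert (Hr0 := Hrhop eps). set (r := rho eps) in *.
  assert (Hr2 : 0 < r ^ 2) by (apply pow_lt; lra).
  assert (T1 : 8 / k ^ 3 * De eps / r ^ 2 <= 8 / k ^ 3 * C * r ^ 2).
  { apply Rmult_le_reg_r with (r ^ 2); [assumption|].
    unfold Rdiv at 1. rewrite (Rmult_assoc _ (/ r ^ 2)), Rinv_l, Rmult_1_r by lra.
    replace (8 / k ^ 3 * C * r ^ 2 * r ^ 2) with (8 / k ^ 3 * (C * r ^ 4)) by ring.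
    apply Rmult_le_compat_l; [apply Rdiv_le_0_compat; [lra | apply pow_lt; lra] | assumption]. }
  assert (T2 : a * ln (kap + De eps / r) <= a * ln (kap + C * r ^ 3)).
  { apply Rmult_le_compat_l; [lra|].
    assert (De eps / r <= C * r ^ 3).
    { apply Rmult_le_reg_r with r; [assumption|]. unfold Rdiv. rewrite Rmult_assoc, Rinv_l, Rmult_1_r by lra.
      replace (C * r ^ 3 * r) with (C * r ^ 4) by ring. assumption. }
    assert (0 < De eps / r) by (apply Rdiv_lt_0_compat; lra).
    destruct (Req_dec (kap + De eps / r) (kap + C * r ^ 3)) as [->|]; [lra|].
    left. apply ln_increasing; lra. }
  assert (EL : leading_log k = ln (2 / k) - a * ln (k / 2) + a * ln kap - ln B0) by reflexivity.
  rewrite EL. change (k / 2 + 2 / k - cutoff_speed k eps) with (De eps). fold a.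
  unfold lo, hi, A. fold r. split; lra.
Qed.

Lemma speed_gap_limit_gt k : 2 < k ->
  filterlim (fun eps => (k / 2 + 2 / k - cutoff_speed k eps) / Delta_c_leading k eps) (at_right 0) (locally 1).
Proof.
  intros hk.
  assert (L := filterlim_continuous_comp (at_right 0) _ exp 0 (log_gap_limit k hk)).
  rewrite exp_0 in L.
  assert (L2 := L ltac:(apply (ex_derive_continuous exp); auto_derive; trivial)).
  revert L2. apply filterlim_ext_loc. apply (eventually_at_right (/ 2)); [lra|]. intros eps He.
  destruct (pushed_speed_gap k eps hk ltac:(lra)) as [P1 _].
  rewrite Delta_c_leading_gt by lra.
  set (De := k / 2 + 2 / k - cutoff_speed k eps) in *.
  replace (ln De - (1 - 4 / k ^ 2) * ln eps - leading_log k)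
    with (ln De + - (leading_log k + (1 - 4 / k ^ 2) * ln eps)) by ring.
  rewrite exp_plus, exp_Ropp, exp_ln by assumption. reflexivity.
Qed.

(** * Existence and uniqueness of critical fronts *)

Lemma cutoff_speed_limit k : 0 < k -> filterlim (cutoff_speed k) (at_right 0) (locally (c_crit k)).
Proof.
  intros hk. unfold c_crit. destruct (Rle_dec k 2).
  - apply cutoff_speed_limit_le. lra.
  - apply cutoff_speed_limit_gt. lra.
Qed.

Lemma cutoff_speed_0 k : cutoff_speed k 0 = c_crit k.
Proof. unfold cutoff_speed. destruct (Rlt_dec 0 0); [lra | reflexivity]. Qed.

Lemma speed_gap_limit k : 0 < k ->
  filterlim (fun eps => (cutoff_speed k 0 - cutoff_speed k eps) / Delta_c_leading k eps) (at_right 0) (locally 1).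
Proof.
  intros hk. rewrite cutoff_speed_0. unfold c_crit. destruct (Rle_dec k 2) as [Hk|Hk].
  - unfold Delta_c_leading. destruct (Rlt_dec k 2) as [Hk2|Hk2].
    + apply (speed_gap_limit_le k PI); [lra | apply PI_RGT_0 | now apply scaled_time_limit_lt].
    + assert (E : k = 2) by lra. subst k. destruct (Req_dec_T 2 2) as [_|]; [|lra].
      assert (HPI := PI_RGT_0).
      assert (L := speed_gap_limit_le 2 (PI / 2) ltac:(lra) ltac:(lra) scaled_time_limit_eq).
      revert L. apply filterlim_ext_loc. apply (eventually_at_right 1); [lra|]. intros eps He.
      assert (ln eps < 0) by (rewrite <- ln_1; apply ln_increasing; lra).
      f_equal. field. lra.
  - apply speed_gap_limit_gt. lra.
Qed.

Lemma cutoff_speed_match k eps : 0 < k -> eps < 1 ->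
  0 < eps -> profile k (cutoff_speed k eps) (1 - eps) = cutoff_speed k eps * eps.
Proof. intros hk H1 H0. now apply cutoff_speed_spec. Qed.

(** This is the hypothesis of [decreasing_orbit_exists]. For eps > 0 the zero at u = 0 comes from
    the linear piece c u and the one at u = 1 from the linear bound on the profile; for eps = 0 both
    come from the logistic bound at the critical speed. *)
Lemma cutoff_field_bound k eps : 0 < k -> 0 <= eps < 1 ->
  exists C, forall u, 0 < u < 1 ->
    0 < cutoff_field k eps (cutoff_speed k eps) u <= C * (u * (1 - u)).
Proof.
  intros hk He. destruct (Req_dec eps 0) as [->|Hne].
  - rewrite cutoff_speed_0. destruct (profile_c_crit_le k hk) as [C HC]. exists C. intros u Hu.
    rewrite cutoff_field_above by lra. split.
    + apply (profile_pos k (c_crit k)); [now apply profile_spec | lra].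
    + destruct (HC (1 - u)) as [H _]; [lra|]. replace (1 - (1 - u)) with u in H by ring.
      now rewrite (Rmult_comm u).
  - destruct (cutoff_speed_spec k eps hk ltac:(lra)) as [Hc _]. set (c := cutoff_speed k eps) in *.
    assert (Hp := profile_spec k c hk). assert (Hp' := Hp). destruct Hp' as [_ [m Hm]].
    assert (Hce : 0 < c / (1 - eps)) by (apply Rdiv_lt_0_compat; lra).
    assert (Hme : 0 <= Rabs m / eps) by (apply Rdiv_le_0_compat; [apply Rabs_pos | lra]).
    exists (Rabs m / eps + c / (1 - eps)). intros u Hu. assert (Huu : 0 < u * (1 - u)) by nra.
    destruct (Rle_lt_dec eps u) as [H|H].
    + rewrite cutoff_field_above by assumption. split; [apply (profile_pos k c); [assumption | lra]|].
      eapply Rle_trans; [apply Hm; lra|].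
      assert (m * (1 - u) <= Rabs m * (1 - u)) by (apply Rmult_le_compat_r; [lra | apply Rle_abs]).
      assert (Rabs m * (1 - u) <= Rabs m / eps * (u * (1 - u))).
      { replace (Rabs m / eps * (u * (1 - u))) with (Rabs m * (1 - u) * (u / eps)) by (field; lra).
        rewrite <- (Rmult_1_r (Rabs m * (1 - u))) at 1. apply Rmult_le_compat_l.
        - apply Rmult_le_pos; [apply Rabs_pos | lra].
        - apply Rmult_le_reg_r with eps; [lra|]. unfold Rdiv. rewrite Rmult_assoc, Rinv_l; lra. }
      assert (0 <= c / (1 - eps) * (u * (1 - u))) by (apply Rmult_le_pos; lra). lra.
    + rewrite cutoff_field_below by assumption. split; [apply Rmult_lt_0_compat; lra|].
      assert (c * u <= c / (1 - eps) * (u * (1 - u))).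
      { replace (c / (1 - eps) * (u * (1 - u))) with (c * u * ((1 - u) / (1 - eps))) by (field; lra).
        rewrite <- (Rmult_1_r (c * u)) at 1. apply Rmult_le_compat_l; [apply Rmult_le_pos; lra|].
        apply Rmult_le_reg_r with (1 - eps); [lra|]. unfold Rdiv. rewrite Rmult_assoc, Rinv_l; lra. }
      assert (0 <= Rabs m / eps * (u * (1 - u))) by (apply Rmult_le_pos; lra). lra.
Qed.

Lemma critical_orbit_exists k eps : 0 < k -> 0 <= eps < 1 ->
  exists U : R -> R,
    (forall xi, 0 < U xi < 1 /\ is_derive U xi (- cutoff_field k eps (cutoff_speed k eps) (U xi))) /\
    is_lim U m_infty 1 /\ is_lim U p_infty 0.
Proof.
  intros hk He. destruct (cutoff_field_bound k eps hk He) as [C HC].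
  apply (decreasing_orbit_exists _ C). intros u Hu. split; [|now apply HC].
  apply cutoff_field_continuous; auto. apply cutoff_speed_match; lra.
Qed.

Lemma critical_orbit_unique k eps U1 U2 : 0 < k -> 0 <= eps < 1 ->
  (forall xi, 0 < U1 xi < 1 /\ is_derive U1 xi (- cutoff_field k eps (cutoff_speed k eps) (U1 xi))) ->
  (forall xi, 0 < U2 xi < 1 /\ is_derive U2 xi (- cutoff_field k eps (cutoff_speed k eps) (U2 xi))) ->
  exists h, forall xi, U2 xi = U1 (xi + h).
Proof.
  intros hk He. destruct (cutoff_field_bound k eps hk He) as [C HC].
  apply decreasing_orbit_unique. intros u Hu. split; [|now apply HC].
  apply cutoff_field_continuous; auto. apply cutoff_speed_match; lra.
Qed.

Lemma critical_orbit_slope_limits k eps U : 0 < k -> 0 <= eps < 1 ->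
  (forall xi, 0 < U xi < 1) -> is_lim U m_infty 1 -> is_lim U p_infty 0 ->
  is_lim (fun xi => - cutoff_field k eps (cutoff_speed k eps) (U xi)) m_infty 0 /\
  is_lim (fun xi => - cutoff_field k eps (cutoff_speed k eps) (U xi)) p_infty 0.
Proof.
  intros hk He HU Hm Hp. destruct (cutoff_field_bound k eps hk He) as [C HC].
  assert (HC0 : 0 < C) by (specialize (HC (/ 2) ltac:(lra)); lra).
  assert (HV : forall xi, Rabs (- cutoff_field k eps (cutoff_speed k eps) (U xi) - 0) <= C * (1 - U xi)
               /\ Rabs (- cutoff_field k eps (cutoff_speed k eps) (U xi) - 0) <= C * U xi).
  { intros xi. specialize (HU xi). destruct (HC (U xi) HU) as [H1 H2].
    rewrite Rminus_0_r, Rabs_Ropp, Rabs_right by lra.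
    split; (eapply Rle_trans; [exact H2|]); apply Rmult_le_compat_l; nra. }
  split.
  - apply is_lim_m_infty_iff. intros eta Heta.
    destruct (proj1 (is_lim_m_infty_iff U 1) Hm (eta / C)) as [M HM]; [apply Rdiv_lt_0_compat; lra|].
    exists M. intros xi Hxi. destruct (HV xi) as [A _]. specialize (HM xi Hxi). specialize (HU xi).
    rewrite Rabs_left in HM by lra. eapply Rle_lt_trans; [exact A|].
    apply (Rmult_lt_compat_l C) in HM; [|assumption]. replace (C * (eta / C)) with eta in HM by (field; lra). lra.
  - apply is_lim_p_infty_iff. intros eta Heta.
    destruct (proj1 (is_lim_p_infty_iff U 0) Hp (eta / C)) as [M HM]; [apply Rdiv_lt_0_compat; lra|].
    exists M. intros xi Hxi. destruct (HV xi) as [_ A]. specialize (HM xi Hxi). specialize (HU xi).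
    rewrite Rminus_0_r, Rabs_right in HM by lra. eapply Rle_lt_trans; [exact A|].
    apply (Rmult_lt_compat_l C) in HM; [|assumption]. replace (C * (eta / C)) with eta in HM by (field; lra). lra.
Qed.

Lemma critical_orbit_meets k eps U : 0 < k -> 0 < eps < 1 ->
  (forall xi, 0 < U xi < 1 /\ is_derive U xi (- cutoff_field k eps (cutoff_speed k eps) (U xi))) ->
  is_lim U m_infty 1 -> is_lim U p_infty 0 ->
  meets_at_cutoff eps (cutoff_speed k eps) U (fun xi => - cutoff_field k eps (cutoff_speed k eps) (U xi)).
Proof.
  intros hk He HU Hm Hp. destruct (cutoff_field_bound k eps hk ltac:(lra)) as [C HC].
  set (c := cutoff_speed k eps) in *.
  assert (HUd : forall xi, is_derive U xi (- cutoff_field k eps c (U xi))) by apply HU.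
  assert (HUc : forall xi, continuous U xi) by (intros; eapply continuous_of_derive; apply HUd).
  assert (Hdec : forall x y, x < y -> U y < U x).
  { intros x y Hxy. destruct (mvt U (fun xi => - cutoff_field k eps c (U xi)) x y Hxy) as [z [Hz E]]; auto.
    destruct (HC (U z)) as [Hz' _]; [apply HU|]. nra. }
  destruct (proj1 (is_lim_m_infty_iff U 1) Hm (1 - eps)) as [M1 H1]; [lra|].
  destruct (proj1 (is_lim_p_infty_iff U 0) Hp eps) as [M2 H2]; [lra|].
  set (a := Rmin M1 M2 - 1). set (b := Rmax M1 M2 + 1).
  assert (Rmin M1 M2 <= M1) by apply Rmin_l. assert (M2 <= Rmax M1 M2) by apply Rmax_r.
  assert (Rmin M1 M2 <= M2) by apply Rmin_r.
  specialize (H1 a ltac:(unfold a; lra)). specialize (H2 b ltac:(unfold b; lra)).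
  apply Rabs_def2 in H1. apply Rabs_def2 in H2.
  destruct (first_crossing (fun x => - U x) a b (- eps)) as [x0 [Hx0 [E0 _]]]; try lra.
  { unfold a, b. lra. }
  { intros x _. apply (continuous_opp U). apply HUc. }
  assert (E : U x0 = eps) by lra.
  exists x0. split; [exact E|]. split; [|split].
  - rewrite E, cutoff_field_above by lra. unfold c. rewrite cutoff_speed_match by lra. ring.
  - intros xi Hxi. specialize (Hdec xi x0 Hxi). destruct (HU xi) as [Hb _].
    destruct (HC (U xi) Hb) as [Hpos _]. lra.
  - intros xi Hxi. specialize (Hdec x0 xi Hxi). destruct (HU xi) as [Hb _].
    split; [lra|]. rewrite cutoff_field_below by lra. ring.
Qed.

Lemma eq_of_eq_left (f g : R -> R) (x : R) :
  continuous f x -> continuous g x -> (forall y, y < x -> f y = g y) -> f x = g x.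
Proof.
  intros Hf Hg H. destruct (Req_dec (f x) (g x)) as [|Hne]; [assumption|exfalso].
  assert (He : 0 < Rabs (f x - g x) / 2) by (assert (0 < Rabs (f x - g x)) by (apply Rabs_pos_lt; lra); lra).
  destruct (continuous_eps f x Hf _ He) as [d1 [Hd1 H1]].
  destruct (continuous_eps g x Hg _ He) as [d2 [Hd2 H2]].
  set (y := x - Rmin d1 d2 / 2).
  assert (0 < Rmin d1 d2) by now apply Rmin_glb_lt.
  assert (Rmin d1 d2 <= d1) by apply Rmin_l. assert (Rmin d1 d2 <= d2) by apply Rmin_r.
  assert (Hy : Rabs (y - x) < Rmin d1 d2) by (unfold y; rewrite Rabs_left; lra).
  specialize (H1 y ltac:(lra)). specialize (H2 y ltac:(lra)).
  rewrite (H y ltac:(unfold y; lra)) in H1.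
  assert (Rabs (f x - g x) <= Rabs (g y - f x) + Rabs (g y - g x)).
  { replace (f x - g x) with (- (g y - f x) + (g y - g x)) by ring.
    rewrite <- (Rabs_Ropp (g y - f x)). apply Rabs_triang. }
  lra.
Qed.

(** Left of the crossing the orbit lies on the profile, and continuity of V at the crossing yields
    the matching condition, hence the speed. At the crossing itself the orbit system says nothing
    about derivatives; there the continuous slope supplied by the equation closes the argument. *)
Lemma cutoff_front_on_field k eps c u : 0 < k -> 0 < eps < 1 -> critical_front k eps c u ->
  c = cutoff_speed k eps /\
  exists U, travelling_wave c U u /\
    forall xi, 0 < U xi < 1 /\ is_derive U xi (- cutoff_field k eps c (U xi)).
Proof.
  intros hk He [[Hpde _] [Horb _]]. destruct (Horb (proj1 He)) as [U [V [Hw [Hhet Hmeet]]]].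
  destruct Hhet as [Hcont [Hode [HUm [HVm _]]]].
  destruct Hmeet as [x0 [EU [EV [Hleft Hright]]]].
  destruct (pde_gives_wave_profile k eps c u U Hpde Hw) as [HW1 [HW2 _]].
  assert (Hon : forall xi, xi < x0 -> V xi = - profile k c (1 - U xi)).
  { apply (orbit_on_profile k c (profile k c) U V x0); auto.
    - now apply profile_spec.
    - intros xi Hxi. destruct (Hleft xi Hxi) as [Hb _]. split; [lra|].
      destruct (Hode xi ltac:(lra)) as [D1 D2]. split; [exact D1|].
      unfold Heaviside in D2. destruct (Rlt_dec 0 (U xi - eps)); [|lra].
      now rewrite !Rmult_1_r in D2. }
  assert (HPc : continuous (fun xi => - profile k c (1 - U xi)) x0).
  { apply (continuous_opp (fun xi => profile k c (1 - U xi))).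
    apply (continuous_comp U (fun u => profile k c (1 - u))); [apply Hcont|].
    eapply continuous_of_derive. apply profile_reflect_derive; lra. }
  assert (Hmatch : profile k c (1 - eps) = c * eps).
  { assert (A := eq_of_eq_left V _ x0 (proj2 (Hcont x0)) HPc Hon). cbv beta in A. rewrite EU, EV in A. lra. }
  split; [now apply cutoff_speed_unique|].
  assert (Hpos : forall xi, 0 < U xi < 1).
  { intros xi. destruct (Rtotal_order xi x0) as [H|[->|H]].
    - destruct (Hleft xi H). lra.
    - lra.
    - destruct (Hright xi H) as [Hb _]. split; [|lra].
      (* On the line V = - c U the solution decays exactly exponentially, so it cannot reach 0 in
         finite time. *)
      assert (G : U x0 <= U xi * exp (c * (xi - x0))).
      { apply (gronwall_backward U V c x0 xi); [lra| | |].
        - intros y Hy. destruct (Hright y ltac:(lra)) as [Hby _]. apply (Hode y). lra.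
        - intros y _. apply Hcont.
        - intros y Hy. destruct (Hright y ltac:(lra)) as [_ ->]. lra. }
      rewrite EU in G. pose proof (exp_pos (c * (xi - x0))). nra. }
  assert (HV : forall xi, xi <> x0 -> V xi = - cutoff_field k eps c (U xi)).
  { intros xi Hne. destruct (Rtotal_order xi x0) as [H|[->|H]]; [|lra|].
    - destruct (Hleft xi H). rewrite cutoff_field_above by lra. now apply Hon.
    - destruct (Hright xi H) as [Hb ->]. rewrite cutoff_field_below by lra. ring. }
  assert (HDV : forall xi, xi <> x0 -> Derive U xi = - cutoff_field k eps c (U xi)).
  { intros xi Hne. rewrite <- HV by assumption. apply is_derive_unique. apply (Hode xi).
    destruct (Rtotal_order xi x0) as [H|[H|H]]; [|lra|].
    - destruct (Hleft xi H). lra.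
    - destruct (Hright xi H). lra. }
  exists U. split; [exact Hw|]. intros xi. split; [apply Hpos|].
  destruct (Req_dec xi x0) as [->|Hne]; [|rewrite <- HDV by assumption; apply HW1].
  rewrite <- (eq_of_eq_left (Derive U) (fun xi => - cutoff_field k eps c (U xi)) x0); [apply HW1 | apply HW2 | |].
  - apply (continuous_opp (fun xi => cutoff_field k eps c (U xi))).
    apply (continuous_comp U (cutoff_field k eps c)); [apply Hcont|].
    apply cutoff_field_continuous; auto.
  - intros y Hy. apply HDV. lra.
Qed.

(** The cut-off speeds tend to [c_crit], so below [c_crit] one of them exceeds c. At that eps the
    smaller speed puts the profile strictly above the line c eps, which [front_below_cutoff_line]
    forbids. *)
Lemma plain_front_minimal_speed k c u : 0 < k -> front_solution k 0 c u -> c_crit k <= c.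
Proof.
  intros hk [Hpde [U [Hw [Hm Hp]]]].
  assert (HW := pde_gives_wave_profile k 0 c u U Hpde Hw).
  destruct (Rle_lt_dec (c_crit k) c) as [|Hlt]; [assumption|exfalso].
  assert (Hgap : 0 < c_crit k - c) by lra.
  assert (A := proj1 (filterlim_locally (cutoff_speed k) (c_crit k)) (cutoff_speed_limit k hk) (mkposreal _ Hgap)).
  assert (B : at_right 0 (fun eps => 0 < eps < 1)) by (apply (eventually_at_right 1); [lra | auto]).
  destruct (filter_ex _ (filter_and _ _ A B)) as [eps [H1 H2]].
  change (Rabs (cutoff_speed k eps - c_crit k) < c_crit k - c) in H1. apply Rabs_def2 in H1.
  destruct (cutoff_speed_spec k eps hk H2) as [_ E].
  assert (G := profile_gap_decr k c (cutoff_speed k eps) eps hk H2 ltac:(lra)).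
  assert (F := front_below_cutoff_line k c U (Derive U) hk HW Hm Hp eps H2). lra.
Qed.

Lemma plain_front_on_field k u : 0 < k -> front_solution k 0 (c_crit k) u ->
  exists U, travelling_wave (c_crit k) U u /\
    forall xi, 0 < U xi < 1 /\ is_derive U xi (- cutoff_field k 0 (cutoff_speed k 0) (U xi)).
Proof.
  intros hk [Hpde [U [Hw [Hm Hp]]]].
  assert (HW := pde_gives_wave_profile k 0 _ u U Hpde Hw).
  exists U. split; [exact Hw|]. intros xi.
  assert (H0 := front_pos k _ U (Derive U) hk HW Hm Hp xi).
  assert (H1 := front_lt_one k _ U (Derive U) hk HW Hm Hp xi).
  split; [lra|]. rewrite cutoff_speed_0, cutoff_field_above by lra.
  rewrite <- (front_on_profile k _ U (Derive U) hk HW Hm Hp xi). apply HW.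
Qed.

Theorem theorem2 (k : R) (hk : 0 < k) :
  exists (eps0 : R) (c : R -> R),
    0 < eps0 /\
    (forall eps : R, 0 <= eps < eps0 ->
       exists u : R -> R -> R,
         critical_front k eps (c eps) u /\
         forall (c' : R) (u' : R -> R -> R),
           critical_front k eps c' u' ->
           c' = c eps /\
           exists h : R, forall x t, 0 <= t -> u' x t = u (x + h) t) /\
    c 0 = c_crit k /\
    filterlim c (at_right 0) (locally (c_crit k)) /\
    filterlim (fun eps => (c 0 - c eps) / Delta_c_leading k eps)
      (at_right 0) (locally 1).
Proof.
  (* The matching condition has exactly one solution for every cut-off in (0, 1), so the whole range
     is admissible. *)
  exists 1, (cutoff_speed k). split; [lra|].
  split; [|split; [apply cutoff_speed_0 | split; [now apply cutoff_speed_limit | now apply speed_gap_limit]]].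
  intros eps He. destruct (critical_orbit_exists k eps hk He) as [U [HU [Hm Hp]]].
  set (c := cutoff_speed k eps) in *.
  assert (HW : wave_profile k eps c U (fun xi => - cutoff_field k eps c (U xi))).
  { apply cutoff_field_wave; auto. intros H0. now apply cutoff_speed_match. }
  assert (Hw : travelling_wave c U (fun x t => U (x - c * t))) by (intros x t _; reflexivity).
  assert (Hfront : front_solution k eps c (fun x t => U (x - c * t))).
  { split; [now apply (wave_solves_pde k eps c U _ HW)|]. now exists U. }
  assert (Hshift : forall c' u' U', travelling_wave c' U' u' -> c' = c ->
    (forall xi, 0 < U' xi < 1 /\ is_derive U' xi (- cutoff_field k eps c (U' xi))) ->
    exists h, forall x t, 0 <= t -> u' x t = U (x + h - c * t)).
  { intros c' u' U' Hw' -> HU'. destruct (critical_orbit_unique k eps U U' hk He HU HU') as [h Hh].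
    exists h. intros x t Ht. rewrite (Hw' x t Ht), Hh. f_equal. ring. }
  exists (fun x t => U (x - c * t)). split.
  - split; [exact Hfront|]. split.
    + intros H0. exists U, (fun xi => - cutoff_field k eps c (U xi)).
      split; [exact Hw|]. destruct HW as [W1 [W2 W3]].
      assert (HVl := critical_orbit_slope_limits k eps U hk He (fun xi => proj1 (HU xi)) Hm Hp).
      split; [|apply critical_orbit_meets; auto; lra].
      split; [intros xi; split; [eapply continuous_of_derive; apply W1 | apply W2]|].
      split; [intros xi Hne; split; [apply W1 | now apply W3]|].
      split; [exact Hm|]. split; [apply HVl|]. split; [exact Hp | apply HVl].
    + intros E c' u' Hf. unfold c. rewrite E, cutoff_speed_0. now apply (plain_front_minimal_speed k c' u').
  - intros c' u' Hc'. destruct (Req_dec eps 0) as [E|Hne].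
    + assert (Ec : c = c_crit k) by (unfold c; rewrite E; apply cutoff_speed_0).
      destruct Hc' as [Hf' [_ Hmin']].
      (* For eps = 0 the minimality of c' is tested against the front just constructed; the lower
         bound [c_crit] on all front speeds gives the other inequality. *)
      assert (Hle : c' <= c) by (apply (Hmin' E c (fun x t => U (x - c * t))); rewrite <- E; exact Hfront).
      rewrite E in Hf'.
      assert (Hge := plain_front_minimal_speed k c' u' hk Hf').
      assert (Ecc : c' = c) by lra. split; [exact Ecc|].
      rewrite Ecc, Ec in Hf'. destruct (plain_front_on_field k u' hk Hf') as [U' [Hw' HU']].
      apply (Hshift (c_crit k) u' U' Hw' (eq_sym Ec)). unfold c. rewrite E. exact HU'.
    + destruct (cutoff_front_on_field k eps c' u' hk ltac:(lra) Hc') as [Ecc [U' [Hw' HU']]].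
      split; [exact Ecc|]. apply (Hshift c' u' U' Hw' Ecc). unfold c. rewrite <- Ecc. exact HU'.
Qed.
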